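(* Let $\lambda\in\mathbb R\setminus\{0\}$, let $n>1$, let $Q_1,Q_2$ be non-zero real homogeneous polynomials of degree $n$, and consider the system $\dot x=\lambda x+Q_1(x,y)$, $\dot y=\lambda y+Q_2(x,y)$. Suppose that the system has finitely many infinite equilibria, and at least one. Then the dynamics near the infinite equilibria determines the global dynamics on the plane, as follows. Consider a trajectory at infinity connecting two consecutive infinite equilibria, going from $\mathbf a_-$ to $\mathbf a_+$, and let $C$ be the half-cone determined by them. Let $p_\pm$ denote the (unique, when it exists) finite equilibrium other than the origin on the radius ending at $\mathbf a_\pm$. The dynamics in the interior of $C$ is one of the following. (1) Each of the angles at $\mathbf a_-$ and $\mathbf a_+$ consists of a single (parabolic or hyperbolic) sector. If $\lambda>0$: (a) ($P^-$ at $\mathbf a_-$, $P^+$ at $\mathbf a_+$) $p_-$ exists, $p_+$ does not; all trajectories have $\omega$-limit $\mathbf a_+$ and the unstable manifold of $p_-$ separates the trajectories with $\alpha$-limit the origin from those with $\alpha$-limit $\mathbf a_-$; (b) ($H^+$ at $\mathbf a_-$, $H^-$ at $\mathbf a_+$) $p_+$ exists, $p_-$ does not; all trajectories go from the origin to $p_+$; (c) ($H^+$ at $\mathbf a_-$, $P^+$ at $\mathbf a_+$) neither $p_\pm$ exists; all trajectories go from the origin to $\mathbf a_+$; (d) ($P^-$ at $\mathbf a_-$, $H^-$ at $\mathbf a_+$) both $p_\pm$ exist; there is a robust heteroclinic connection from $p_-$ to $p_+$, all trajectories have $\omega$-limit $p_+$, and the connection separates the trajectories with $\alpha$-limit the origin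 from those with $\alpha$-limit $\mathbf a_-$. If $\lambda<0$: (a) ($P^-$, $P^+$) $p_+$ exists, $p_-$ does not; all trajectories have $\alpha$-limit $\mathbf a_-$ and the stable manifold of $p_+$ separates the basins of attraction of the origin and of $\mathbf a_+$; (b) ($H^+$, $H^-$) $p_-$ exists, $p_+$ does not; all trajectories go from $p_-$ to the origin; (c) ($H^+$, $P^+$) both $p_\pm$ exist; there is a robust heteroclinic connection from $p_-$ to $p_+$, all trajectories have $\alpha$-limit $p_-$, and the connection separates the trajectories with $\omega$-limit the origin from those with $\omega$-limit $\mathbf a_+$; (d) ($P^-$, $H^-$) neither $p_\pm$ exists; all trajectories go from $\mathbf a_-$ to the origin. (2) One of the angles consists of two sectors, one hyperbolic and one parabolic; it is of type $H^-$ (denoted $H_0^-$) if $\lambda<0$ and of type $H^+$ (denoted $H_0^+$) if $\lambda>0$. Then the trajectory separating the two sectors splits the half-cone into two basins of attraction or repulsion, and: (a) if $\lambda<0$ with $H^+$ at $\mathbf a_-$ and $H_0^-$ at $\mathbf a_+$: $p_-$ exists, all trajectories have $\alpha$-limit $p_-$, and the two basins are the basins of attraction of the origin and of $\mathbf a_+$; (b) if $\lambda<0$ with $P^-$ at $\mathbf a_-$ and $H_0^-$ at $\mathbf a_+$: neither $p_\pm$ exists, all trajectories have $\alpha$-limit $\mathbf a_-$, and the two basins are the basins of attraction of the origin and of $\mathbf a_+$; there is a parabolic sector at infinity connecting the two infinite equilibria; (c) if $\lambda>0$ with $H_0^+$ at $\mathbf a_-$ and $H^-$ at $\mathbf a_+$: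 $p_+$ exists, all trajectories have $\omega$-limit $p_+$, and the two basins are the basins of repulsion of the origin and of $\mathbf a_-$; (d) if $\lambda>0$ with $H_0^+$ at $\mathbf a_-$ and $P^+$ at $\mathbf a_+$: neither $p_\pm$ exists, all trajectories have $\omega$-limit $\mathbf a_+$, and the two basins are the basins of repulsion of the origin and of $\mathbf a_-$; there is a parabolic sector at infinity connecting the two infinite equilibria.
   Context: Polar form: $\dot r=\lambda r+f(\theta)r^n$, $\dot\theta=g(\theta)r^{n-1}$, with $f(\theta)=\cos\theta\,Q_1(\cos\theta,\sin\theta)+\sin\theta\,Q_2(\cos\theta,\sin\theta)$ and $g(\theta)=\cos\theta\,Q_2(\cos\theta,\sin\theta)-\sin\theta\,Q_1(\cos\theta,\sin\theta)$. The radius $\theta=\theta_0$ is the half-line $\{\theta=\theta_0,\ r>0\}$. The Poincaré disk is the compactification of $\mathbb R^2$ by the circle at infinity (one point per direction $\theta$). Near it, with $R=1/r$ and after multiplication by $R^{n-1}>0$, the flow is $\dot R=-\lambda R^n-Rf(\theta)$, $\dot\theta=g(\theta)$, and the circle at infinity is $R=0$. Infinite equilibria are the points $(R,\theta)=(0,\theta_0)$ with $g(\theta_0)=0$; the radius $\theta=\theta_0$ is then flow-invariant. Finitely many infinite equilibria means that $g$ is not identically zero. If $\theta_1<\theta_2$ are two consecutive zeros of $g$ (so $0<\theta_2-\theta_1\le\pi$), the corresponding infinite equilibria are called consecutive and the flow-invariant set $C=\{r\ge0,\ \theta_1\le\theta\le\theta_2\}$ is the half-cone determined by them. The flow on the arc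 at infinity between them goes from one of them (called $\mathbf a_-$ here) to the other ($\mathbf a_+$). At each of the two infinite equilibria $\mathbf a$, the line at infinity and the invariant radius ending at $\mathbf a$ determine an angle in $C$. It is of type $P^-$ if $\mathbf a$ is repelling both in the line at infinity (on the side of $C$) and along the radius; $P^+$ if attracting in both; $H^-$ if attracting in the line at infinity and radially repelling; $H^+$ if repelling in the line at infinity and radially attracting. A parabolic sector at $\mathbf a$ is a region at $\mathbf a$ in which the dynamics is qualitatively that of a node (all nearby trajectories in it tend to $\mathbf a$ as $t\to+\infty$, or all do as $t\to-\infty$); a hyperbolic sector is one in which the dynamics is qualitatively that of a saddle. The trajectory separating the hyperbolic and the parabolic sector at an angle $H_0^\pm$ tends to that infinite equilibrium. ''Go from $A$ to $B$'' means having $\alpha$-limit $A$ and $\omega$-limit $B$; the basin of repulsion of a point is the set of points whose trajectory has that point as $\alpha$-limit.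
   Formalization: ''Robust'' is read as: for small changes of λ, Q1, Q2 (n fixed) the connection persists between any nearby consecutive infinite equilibria, which surely exist if both are simple zeros of g; unconditional persistence fails at multiple zeros (f=-1, g=cos²θ, λ=1), where p± can vanish. *)

(* Defs.v *)
From Stdlib Require Export Reals List.
From Coquelicot Require Export Coquelicot.
Open Scope R_scope.

(** * The system *)

(** A homogeneous polynomial of degree [n] in two variables, given by its
    coefficients [c 0, ..., c n]; the values [c k] with [k > n] are ignored. *)
Definition hpoly (n : nat) (c : nat -> R) (x y : R) : R :=
  sum_f_R0 (fun k => c k * x ^ k * y ^ (n - k)) n.

Definition hpoly_nonzero (n : nat) (c : nat -> R) : Prop :=
  exists k : nat, (k <= n)%nat /\ c k <> 0.

Record system : Type := System {
  lam : R;
  deg : nat;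
  coef1 : nat -> R;
  coef2 : nat -> R
}.

Definition Q1 (S : system) : R -> R -> R := hpoly (deg S) (coef1 S).
Definition Q2 (S : system) : R -> R -> R := hpoly (deg S) (coef2 S).

Definition vfield (S : system) (z : R * R) : R * R :=
  (lam S * fst z + Q1 S (fst z) (snd z), lam S * snd z + Q2 S (fst z) (snd z)).

Definition f (S : system) (th : R) : R :=
  cos th * Q1 S (cos th) (sin th) + sin th * Q2 S (cos th) (sin th).

Definition g (S : system) (th : R) : R :=
  cos th * Q2 S (cos th) (sin th) - sin th * Q1 S (cos th) (sin th).

Definition polar (r th : R) : R * R := (r * cos th, r * sin th).

Definition origin : R * R := (0, 0).

(** * Curves, trajectories and limit sets *)

(** A curve in the plane over the open time interval [(tmin, tmax)]; the
    values of [pos] outside of that interval are irrelevant. *)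
Record curve : Type := Curve {
  pos : R -> R * R;
  tmin : Rbar;
  tmax : Rbar
}.

Definition time (T : curve) (t : R) : Prop :=
  Rbar_lt (tmin T) t /\ Rbar_lt t (tmax T).

Definition orbit (T : curve) (z : R * R) : Prop :=
  exists t : R, time T t /\ pos T t = z.

Definition solution (S : system) (T : curve) : Prop :=
  Rbar_lt (tmin T) (tmax T) /\
  forall t : R, time T t ->
    is_derive (fun s => fst (pos T s)) t (fst (vfield S (pos T t))) /\
    is_derive (fun s => snd (pos T s)) t (snd (vfield S (pos T t))).

(** Trajectories are solutions on a maximal interval of existence, which need
    not be the whole line: solutions may reach infinity in finite time. *)
Definition trajectory (S : system) (T : curve) : Prop :=
  solution S T /\
  forall T' : curve, solution S T' ->
    Rbar_le (tmin T') (tmin T) -> Rbar_le (tmax T) (tmax T') ->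
    (forall t : R, time T t -> pos T' t = pos T t) ->
    tmin T' = tmin T /\ tmax T' = tmax T.

Definition omega_limit_set (G : curve) (w : R * R) : Prop :=
  forall (U : R * R -> Prop) (V : R -> Prop),
    locally w U -> Rbar_locally (tmax G) V ->
    exists t : R, time G t /\ V t /\ U (pos G t).

Definition alpha_limit_set (G : curve) (w : R * R) : Prop :=
  forall (U : R * R -> Prop) (V : R -> Prop),
    locally w U -> Rbar_locally (tmin G) V ->
    exists t : R, time G t /\ V t /\ U (pos G t).

(** * The Poincaré disk *)

(** The Poincaré disk is the closed unit disk: the plane is mapped
    homeomorphically onto its interior, and the point at infinity in the
    direction [th] is the point [infinity th] of its boundary. *)
Definition poincare (z : R * R) : R * R :=
  let d := sqrt (1 + fst z ^ 2 + snd z ^ 2) in (fst z / d, snd z / d).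

Definition infinity (th : R) : R * R := polar 1 th.

Definition to_disk (T : curve) : curve :=
  Curve (fun t => poincare (pos T t)) (tmin T) (tmax T).

Definition disk_image (D : R * R -> Prop) (w : R * R) : Prop :=
  exists z : R * R, D z /\ w = poincare z.

Definition closure (E : R * R -> Prop) (w : R * R) : Prop :=
  forall U : R * R -> Prop, locally w U -> exists z : R * R, E z /\ U z.

(** The flow on the circle at infinity, multiplied by [(1 / r) ^ (deg S - 1)]. *)
Definition trajectory_at_infinity (S : system) (th : R -> R) : Prop :=
  forall t : R, is_derive th t (g S (th t)).

Inductive disk_trajectory (S : system) : curve -> Prop :=
| finite_trajectory (T : curve) :
    trajectory S T -> disk_trajectory S (to_disk T)
| infinite_trajectory (th : R -> R) :
    trajectory_at_infinity S th ->
    disk_trajectory S (Curve (fun t => infinity (th t)) m_infty p_infty).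

(** For a trajectory [T] of the plane, limits are taken in the Poincaré disk:
    [w] is [poincare p] for a point [p] of the plane, or [infinity th]. *)
Definition omega_is (T : curve) (w : R * R) : Prop :=
  forall w' : R * R, omega_limit_set (to_disk T) w' <-> w' = w.

Definition alpha_is (T : curve) (w : R * R) : Prop :=
  forall w' : R * R, alpha_limit_set (to_disk T) w' <-> w' = w.

Definition basin_of_attraction (S : system) (w z : R * R) : Prop :=
  exists T : curve, trajectory S T /\ orbit T z /\ omega_is T w.

Definition basin_of_repulsion (S : system) (w z : R * R) : Prop :=
  exists T : curve, trajectory S T /\ orbit T z /\ alpha_is T w.

Definition stable_manifold (S : system) (p : R * R) : R * R -> Prop :=
  basin_of_attraction S (poincare p).

Definition unstable_manifold (S : system) (p : R * R) : R * R -> Prop :=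
  basin_of_repulsion S (poincare p).

(** * Infinite equilibria and half-cones *)

Definition infinite_equilibrium (S : system) (w : R * R) : Prop :=
  exists th : R, w = infinity th /\ g S th = 0.

Definition finitely_many_infinite_equilibria (S : system) : Prop :=
  exists l : list (R * R),
    forall w : R * R, infinite_equilibrium S w -> In w l.

(** The two angles may come in either order. *)
Definition between (th1 th2 th : R) : Prop :=
  Rmin th1 th2 < th < Rmax th1 th2.

Definition consecutive (S : system) (th1 th2 : R) : Prop :=
  th1 <> th2 /\ g S th1 = 0 /\ g S th2 = 0 /\
  forall th : R, between th1 th2 th -> g S th <> 0.

Definition cone_interior (th1 th2 : R) (z : R * R) : Prop :=
  exists r th : R, 0 < r /\ between th1 th2 th /\ z = polar r th.

Definition radial_equilibrium (S : system) (th : R) (p : R * R) : Prop :=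
  exists r : R, 0 < r /\ p = polar r th /\ vfield S p = origin.

Definition no_radial_equilibrium (S : system) (th : R) : Prop :=
  forall p : R * R, ~ radial_equilibrium S th p.

(** * Sectors and angles *)

(** The equilibrium [x0] of [x' = h x] attracts all nearby points of the
    one-sided domain [D]. *)
Definition attracting (h : R -> R) (x0 : R) (D : R -> Prop) : Prop :=
  exists delta : R, 0 < delta /\
    forall x : R, D x -> Rabs (x - x0) < delta ->
      exists u : R -> R,
        u 0 = x /\
        (forall t : R, 0 <= t -> D (u t) /\ is_derive u t (h (u t))) /\
        is_lim u p_infty x0.

Definition repelling (h : R -> R) (x0 : R) (D : R -> Prop) : Prop :=
  attracting (fun x => - h x) x0 D.

(** The flow near infinity on an invariant radius, in the coordinate
    [rho = 1 / r] and multiplied by [rho ^ (deg S - 1)]. *)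
Definition radial_field (S : system) (th rho : R) : R :=
  - lam S * rho ^ deg S - rho * f S th.

Definition line_attracting (S : system) (th0 th1 : R) : Prop :=
  attracting (g S) th0 (between th0 th1).
Definition line_repelling (S : system) (th0 th1 : R) : Prop :=
  repelling (g S) th0 (between th0 th1).
Definition radially_attracting (S : system) (th0 : R) : Prop :=
  attracting (radial_field S th0) 0 (fun rho => 0 < rho).
Definition radially_repelling (S : system) (th0 : R) : Prop :=
  repelling (radial_field S th0) 0 (fun rho => 0 < rho).

Definition parabolic_sector
    (S : system) (D : R * R -> Prop) (a : R * R) : Prop :=
  closure (disk_image D) a /\
  exists U : R * R -> Prop, locally a U /\
    ((forall (T : curve) (t : R), trajectory S T -> time T t ->
        D (pos T t) -> U (poincare (pos T t)) -> omega_is T a) \/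
     (forall (T : curve) (t : R), trajectory S T -> time T t ->
        D (pos T t) -> U (poincare (pos T t)) -> alpha_is T a)).

(** The trajectory [G] of the disk lies on the boundary of the region [D] of
    the plane. The point [a] is excluded since it is itself a (constant)
    trajectory. *)
Definition boundary_trajectory
    (S : system) (D : R * R -> Prop) (a : R * R) (G : curve) : Prop :=
  disk_trajectory S G /\
  forall t : R, time G t ->
    pos G t <> a /\
    closure (disk_image D) (pos G t) /\ ~ disk_image D (pos G t).

(** As at a saddle, one boundary trajectory tends to [a] in forward time and
    another one in backward time, and the trajectories in the sector leave a
    neighbourhood of [a] in both time directions. *)
Definition hyperbolic_sector
    (S : system) (D : R * R -> Prop) (a : R * R) : Prop :=
  closure (disk_image D) a /\
  (exists U : R * R -> Prop, locally a U /\
    forall (T : curve) (t : R), trajectory S T -> time T t ->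
      D (pos T t) -> U (poincare (pos T t)) ->
      (exists s : R, time T s /\ s < t /\ ~ U (poincare (pos T s))) /\
      (exists s : R, time T s /\ t < s /\ ~ U (poincare (pos T s)))) /\
  (exists G : curve, boundary_trajectory S D a G /\
     forall w : R * R, omega_limit_set G w <-> w = a) /\
  (exists G : curve, boundary_trajectory S D a G /\
     forall w : R * R, alpha_limit_set G w <-> w = a).

Definition path_connected (E : R * R -> Prop) : Prop :=
  forall z w : R * R, E z -> E w ->
    exists c : R -> R * R,
      (forall t : R, continuous c t) /\ c 0 = z /\ c 1 = w /\
      forall t : R, 0 <= t <= 1 -> E (c t).

Definition inter (A B : R * R -> Prop) (z : R * R) : Prop := A z /\ B z.

Definition region (E : R * R -> Prop) : Prop :=
  (exists z : R * R, E z) /\ open E /\ path_connected E.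

(** The parts of [A] and [B] in [D] are the two components of the complement
    of [W] in [D]. *)
Definition separates (D W A B : R * R -> Prop) : Prop :=
  region (inter D A) /\ region (inter D B) /\
  forall z : R * R, D z ->
    (A z \/ W z \/ B z) /\ ~ (A z /\ W z) /\ ~ (B z /\ W z) /\ ~ (A z /\ B z).

(** The angle at [a] in [D] consists of two sectors, separated by [T]. *)
Definition sector_separatrix
    (S : system) (D : R * R -> Prop) (a : R * R) (T : curve) : Prop :=
  trajectory S T /\
  (forall z : R * R, orbit T z -> D z) /\
  (omega_is T a \/ alpha_is T a) /\
  exists A B : R * R -> Prop,
    separates D (orbit T) A B /\
    parabolic_sector S (inter D A) a /\ hyperbolic_sector S (inter D B) a.

Definition one_sector
    (S : system) (D : R * R -> Prop) (a : R * R) : Prop :=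
  parabolic_sector S D a \/ hyperbolic_sector S D a.

Definition two_sectors
    (S : system) (D : R * R -> Prop) (a : R * R) : Prop :=
  exists T : curve, sector_separatrix S D a T.

Inductive angle_type : Type :=
| Pminus | Pplus | Hminus | Hplus | H0minus | H0plus.

(** The type of the angle at [infinity th0] in the half-cone determined by
    [th0] and [th1]. *)
Definition angle (S : system) (th0 th1 : R) (ty : angle_type) : Prop :=
  let D := cone_interior th0 th1 in
  let a := infinity th0 in
  match ty with
  | Pminus =>
      line_repelling S th0 th1 /\ radially_repelling S th0 /\ one_sector S D a
  | Pplus =>
      line_attracting S th0 th1 /\ radially_attracting S th0 /\
      one_sector S D a
  | Hminus =>
      line_attracting S th0 th1 /\ radially_repelling S th0 /\
      one_sector S D a
  | Hplus =>
      line_repelling S th0 th1 /\ radially_attracting S th0 /\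
      one_sector S D a
  | H0minus =>
      line_attracting S th0 th1 /\ radially_repelling S th0 /\
      two_sectors S D a
  | H0plus =>
      line_repelling S th0 th1 /\ radially_attracting S th0 /\
      two_sectors S D a
  end.

(** * Dynamics in a half-cone *)

Definition all_omega
    (S : system) (D : R * R -> Prop) (w : R * R) : Prop :=
  forall (T : curve) (t : R), trajectory S T -> time T t -> D (pos T t) ->
    omega_is T w.

Definition all_alpha
    (S : system) (D : R * R -> Prop) (w : R * R) : Prop :=
  forall (T : curve) (t : R), trajectory S T -> time T t -> D (pos T t) ->
    alpha_is T w.

Definition all_go
    (S : system) (D : R * R -> Prop) (w w' : R * R) : Prop :=
  all_alpha S D w /\ all_omega S D w'.

(** The part of [M] in [D] is the orbit of a single trajectory. *)
Definition one_orbit (S : system) (D M : R * R -> Prop) : Prop :=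
  exists T : curve, trajectory S T /\
    forall z : R * R, orbit T z <-> D z /\ M z.

Definition connection
    (S : system) (D : R * R -> Prop) (p q : R * R) (T : curve) : Prop :=
  trajectory S T /\ (forall z : R * R, orbit T z -> D z) /\
  alpha_is T (poincare p) /\ omega_is T (poincare q).

Definition close_system (delta : R) (S S' : system) : Prop :=
  deg S' = deg S /\ Rabs (lam S' - lam S) < delta /\
  forall k : nat, (k <= deg S)%nat ->
    Rabs (coef1 S' k - coef1 S k) < delta /\
    Rabs (coef2 S' k - coef2 S k) < delta.

Definition connected_near
    (S : system) (th1 th2 : R) (p1 p2 : R * R) (eps : R) : Prop :=
  exists p1' p2' : R * R,
    radial_equilibrium S th1 p1' /\ radial_equilibrium S th2 p2' /\
    ball p1 eps p1' /\ ball p2 eps p2' /\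
    exists T : curve, connection S (cone_interior th1 th2) p1' p2' T.

(** The connection from [p1] to [p2] persists in all nearby systems of the
    same form in which the two infinite equilibria persist as consecutive
    ones. The latter is automatic if they are simple zeros of [g]; when they
    are not, a perturbation may destroy them, and [p1] and [p2] as well. *)
Definition robust_connection
    (S : system) (th1 th2 : R) (p1 p2 : R * R) : Prop :=
  forall eps : R, 0 < eps -> exists delta : R, 0 < delta /\
    forall S' : system, close_system delta S S' ->
      (forall th1' th2' : R,
         Rabs (th1' - th1) < delta -> Rabs (th2' - th2) < delta ->
         consecutive S' th1' th2' ->
         connected_near S' th1' th2' p1 p2 eps) /\
      (Derive (g S) th1 <> 0 -> Derive (g S) th2 <> 0 ->
       exists th1' th2' : R,
         Rabs (th1' - th1) < eps /\ Rabs (th2' - th2) < eps /\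
         consecutive S' th1' th2' /\
         connected_near S' th1' th2' p1 p2 eps).

(** A parabolic sector along the arc at infinity between the directions
    [th1] and [th2], connecting its two end points. *)
Definition parabolic_sector_connecting (S : system) (th1 th2 : R) : Prop :=
  exists E : R * R -> Prop,
    region E /\
    (forall z : R * R, E z -> cone_interior th1 th2 z) /\
    (forall th : R, between th1 th2 th ->
       closure (disk_image E) (infinity th)) /\
    parabolic_sector S E (infinity th1) /\
    parabolic_sector S E (infinity th2) /\
    all_go S E (infinity th1) (infinity th2).

(* Main.v *)
Require Import Defs.
From Stdlib Require Import Lra Lia Classical FunctionalExtensionality PropExtensionality.

(** In the variable [w = r ^ (n - 1)] the system reads [w' = (n - 1) w (lam + f w)],
    [th' = w g]. Measured in the time [s] of the flow at infinity [dth / ds = g], with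
    [ds = w dt], the first equation becomes linear,

      dw / ds = (n - 1) (lam + f (th s) w),

    and a half-cone, whose angles are swept once by a connecting trajectory at infinity,
    is filled by the graphs of the positive parts of its solutions. Variation of the
    constant writes these as [growth * (c + height)], where [height] increases if
    [lam > 0], so that the orbits in the half-cone are the leaves of a foliation indexed
    by the constant [c] ([cone_follows], [follows_orbit]). Everything follows from the
    asymptotics of a linear equation whose coefficient [F s = f (th s)] tends to
    [f thm] and [f thp].

    Let [lam > 0]. Forward in time every leaf tends to the equilibrium [w = - lam / f]
    on the radius of [thp] if [f thp < 0], and to infinity otherwise ([omega_equilibrium],
    [omega_infinity]). Backward in time it matters whether [height] is bounded below. If
    it is not, every leaf reaches [w = 0], so that every trajectory comes from the
    origin. If it is, let [- c0] be its infimum. The leaves with [c < c0] come from the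
    origin and those with [c > c0] come from infinity; the leaf of [c0], called the
    lowest one, separates them. If [f thm < 0] then [c0] exists and the lowest leaf comes
    from the equilibrium on the radius of [thm], of which it is the unstable manifold.
    If [f thm >= 0] and [c0] exists, the lowest leaf comes from infinity as well and is
    the trajectory that separates the two sectors at [infinity thm]. So an angle at
    [infinity thm] has type H+ with one sector if there is no lowest leaf, type P- if the
    lowest leaf comes from an equilibrium, and type H+ with two sectors if it comes from
    infinity; the sign of [f thp] distinguishes P+ from H-. This is the content of the
    lemmas whose names start with [angle_plus] and [angle_minus]. Conversely the case is
    recovered from the type of the angle, by the lemmas whose names end with [elim]:
    radial attraction gives the sign of [f], and the number of sectors tells whether
    there is a lowest leaf. No other leaf can separate a parabolic from a hyperbolic
    sector, since both sides of a leaf are connected ([separatrix_lowest]).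

    The connection between two equilibria is robust because it exists for every nearby
    system for which the two directions are still consecutive: [f] remains negative at
    both ends, and the direction of the flow at infinity is read off at the middle of
    the arc. Simple zeros of [g] persist as consecutive zeros by a sign change argument
    ([perturbed_zeros]).

    For [lam < 0] the time is reversed: this exchanges the two ends of the arc, the
    types P- with P+ and H- with H+, and alpha- with omega-limits. *)

(** * Real analysis on an interval *)

Lemma mean_value (h dh : R -> R) (a b : R) :
  a < b -> (forall x, a <= x <= b -> is_derive h x (dh x)) ->
  exists x, a <= x <= b /\ h b - h a = dh x * (b - a).
Proof.
  intros Hab Hd.
  destruct (MVT_gen h a b dh) as [x [Hx Heq]].
  - intros x Hx. rewrite Rmin_left, Rmax_right in Hx by lra. apply Hd. lra.
  - intros x Hx. rewrite Rmin_left, Rmax_right in Hx by lra.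
    apply continuity_pt_filterlim.
    apply (ex_derive_continuous h x). exists (dh x). apply Hd. lra.
  - rewrite Rmin_left, Rmax_right in Hx by lra. now exists x.
Qed.

Lemma nondecreasing_of_derive (h dh : R -> R) (a b : R) :
  a <= b -> (forall x, a <= x <= b -> is_derive h x (dh x)) ->
  (forall x, a <= x <= b -> 0 <= dh x) -> h a <= h b.
Proof.
  intros [Hab | ->] Hd Hp; [|lra].
  destruct (mean_value h dh a b Hab Hd) as [x [Hx Heq]].
  specialize (Hp x Hx). nra.
Qed.

Lemma increasing_of_derive (h dh : R -> R) (a b : R) :
  a < b -> (forall x, a <= x <= b -> is_derive h x (dh x)) ->
  (forall x, a <= x <= b -> 0 < dh x) -> h a < h b.
Proof.
  intros Hab Hd Hp.
  destruct (mean_value h dh a b Hab Hd) as [x [Hx Heq]].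
  specialize (Hp x Hx). nra.
Qed.

Lemma is_derive_eq (h : R -> R) (x l l' : R) : is_derive h x l -> l = l' -> is_derive h x l'.
Proof. now intros H <-. Qed.

Lemma intermediate_value (h : R -> R) (a b y : R) :
  a <= b -> (forall x, a <= x <= b -> continuous h x) ->
  (h a <= y <= h b \/ h b <= y <= h a) -> exists x, a <= x <= b /\ h x = y.
Proof.
  intros Hab Hc Hy.
  (* freeze [h] outside [[a, b]] to get a function continuous everywhere *)
  set (clamp := fun x => Rmax a (Rmin b x)).
  assert (Hcl : forall x, a <= clamp x <= b).
  { intros x. unfold clamp. split; [apply Rmax_l | apply Rmax_lub; [lra|apply Rmin_l]]. }
  assert (Hid : forall x, a <= x <= b -> clamp x = x).
  { intros x Hx. unfold clamp. rewrite Rmin_right, Rmax_right; lra. }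
  assert (Hcont : forall x, continuous (fun x => h (clamp x)) x).
  { intros x. apply (continuous_comp clamp h); [|apply Hc, Hcl].
    apply continuity_pt_filterlim.
    intros eps He. exists eps. split; [exact He|].
    intros z [_ Hz]. simpl in *. unfold R_dist in *.
    refine (Rle_lt_trans _ _ _ _ Hz).
    unfold clamp, Rmax, Rmin. repeat destruct Rle_dec; unfold Rabs; repeat destruct Rcase_abs; lra. }
  destruct (IVT_gen (fun x => h (clamp x)) a b y) as [x [Hx Heq]].
  - intros x. apply continuity_pt_filterlim, Hcont.
  - rewrite (Hid a), (Hid b) by lra.
    unfold Rmin, Rmax; destruct Rle_dec; lra.
  - rewrite Rmin_left, Rmax_right in Hx by lra.
    exists x. split; [exact Hx|]. now rewrite Hid in Heq.
Qed.

Lemma locally_interval (x : R) (P : R -> Prop) : locally x P ->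
  exists d, 0 < d /\ forall y, Rabs (y - x) < d -> P y.
Proof. intros [d Hd]. exists d. split; [apply cond_pos|exact Hd]. Qed.

Lemma near_point (h : R -> R) x e : continuous h x -> 0 < e ->
  exists d, 0 < d /\ forall y, Rabs (y - x) < d -> Rabs (h y - h x) < e.
Proof.
  intros Hc He. apply locally_interval.
  exact (proj1 (filterlim_locally _ _) Hc (mkposreal e He)).
Qed.

Lemma quotient_nonneg x y : 0 < y -> (0 <= x / y <-> 0 <= x).
Proof.
  intros Hy. split; intros H.
  - replace x with (x / y * y) by (field; lra). nra.
  - apply Rmult_le_pos; [exact H|]. left. now apply Rinv_0_lt_compat.
Qed.

(** * The linear equation w' = k (l + F w) *)

Section LinearEquation.
Variables (k l : R) (F : R -> R).
Hypothesis Hk : 0 < k.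
Hypothesis Hl : 0 < l.
Hypothesis HF : forall s, continuous F s.

(** The solutions are the functions [leaf c]: [growth] solves the homogeneous
    equation and [height] is the primitive coming from the variation of the
    constant. As [height] is increasing, a solution stays positive once it is. *)
Definition growth (s : R) : R := exp (k * RInt F 0 s).
Definition height (s : R) : R := RInt (fun x => k * l / growth x) 0 s.
Definition leaf (c s : R) : R := growth s * (c + height s).

Lemma growth_pos s : 0 < growth s.
Proof. apply exp_pos. Qed.

Lemma primitive (h : R -> R) (s : R) :
  (forall x, continuous h x) -> is_derive (fun x => RInt h 0 x) s (h s).
Proof.
  intros Hh. apply (is_derive_RInt h (fun x => RInt h 0 x) 0 s); [|apply Hh].
  exists (mkposreal 1 Rlt_0_1). intros y _. apply (RInt_correct (V := R_CompleteNormedModule)).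
  apply (ex_RInt_continuous (V := R_CompleteNormedModule)). intros z _. apply Hh.
Qed.

Lemma growth_derive s : is_derive growth s (k * F s * growth s).
Proof.
  unfold growth. evar_last.
  - apply (is_derive_comp exp (fun x => k * RInt F 0 x)).
    + apply is_derive_exp.
    + apply (is_derive_scal (fun x => RInt F 0 x)). apply primitive, HF.
  - unfold scal; simpl; unfold mult; simpl. ring.
Qed.

Lemma inv_growth_derive s : is_derive (fun x => / growth x) s (- (k * F s) / growth s).
Proof.
  evar_last.
  - apply is_derive_inv; [apply growth_derive|]. pose proof (growth_pos s). lra.
  - simpl. pose proof (growth_pos s). field. lra.
Qed.

Lemma height_derive s : is_derive height s (k * l / growth s).
Proof.
  unfold height. apply (primitive (fun x => k * l / growth x)). intros x.
  apply (ex_derive_continuous (fun x => k * l / growth x)).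
  eexists. apply (is_derive_scal (fun x => / growth x)). apply inv_growth_derive.
Qed.

Lemma leaf_derive c s : is_derive (leaf c) s (k * (l + F s * leaf c s)).
Proof.
  unfold leaf. evar_last.
  - apply (is_derive_mult growth (fun x => c + height x)).
    + apply growth_derive.
    + apply (is_derive_plus (fun _ => c) height); [apply is_derive_const|apply height_derive].
    + intros; apply Rmult_comm.
  - unfold plus, zero, mult; simpl. pose proof (growth_pos s). field. lra.
Qed.

Lemma height_increasing s s' : s < s' -> height s < height s'.
Proof.
  intros H. apply (increasing_of_derive height (fun x => k * l / growth x)); auto.
  - intros; apply height_derive.
  - intros x _. pose proof (growth_pos x). apply Rdiv_lt_0_compat; nra.
Qed.

Lemma leaf_pos c s : 0 < leaf c s <-> 0 < c + height s.
Proof. unfold leaf. pose proof (growth_pos s). split; intros; nra. Qed.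

Lemma leaf_pos_after c s s' : 0 < leaf c s -> s <= s' -> 0 < leaf c s'.
Proof.
  rewrite !leaf_pos. intros H [H'| ->]; [|exact H].
  pose proof (height_increasing s s' H'). lra.
Qed.

(** A constant [b] solves the equation up to the excess [l + F b], whose sign
    therefore governs the growth of the relative distance of a solution to [b].
    The sign [sg] treats lower and upper bounds at the same time. *)
Lemma relative_distance_increasing sg c b s s' : s <= s' ->
  (forall x, s <= x <= s' -> 0 <= sg * (l + F x * b)) ->
  sg * (leaf c s - b) / growth s <= sg * (leaf c s' - b) / growth s'.
Proof.
  intros Hs He.
  assert (E : forall x, sg * (leaf c x - b) / growth x = sg * (c + height x - b / growth x)).
  { intros x. unfold leaf. pose proof (growth_pos x). field. lra. }
  rewrite !E.
  apply (nondecreasing_of_derive (fun x => sg * (c + height x - b / growth x))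
    (fun x => sg * (k * (l + F x * b) / growth x)) _ _ Hs).
  - intros x _. evar_last.
    + apply (is_derive_scal (fun x => c + height x - b / growth x)).
      apply (is_derive_minus (fun x => c + height x) (fun x => b / growth x)).
      * apply (is_derive_plus (fun _ => c) height); [apply is_derive_const|apply height_derive].
      * apply (is_derive_scal (fun x => / growth x)). apply inv_growth_derive.
    + unfold minus, plus, opp, zero; simpl. pose proof (growth_pos x). field. lra.
  - intros x Hx. pose proof (growth_pos x).
    replace (sg * (k * (l + F x * b) / growth x)) with (k * (sg * (l + F x * b)) / growth x)
      by (field; lra).
    apply quotient_nonneg; [auto|]. apply Rmult_le_pos; [lra|]. now apply He.
Qed.

(** As long as it has not crossed [b], the solution approaches [b] at a speed bounded
    from below. *)
Lemma leaf_crosses sg c s1 b e : sg = 1 \/ sg = -1 -> 0 < e ->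
  (forall s, s1 <= s -> 0 <= sg * (l + F s * b)) ->
  (forall s, s1 <= s -> sg * (leaf c s - b) < 0 -> e <= sg * (l + F s * leaf c s)) ->
  exists s2, forall s, s2 <= s -> 0 <= sg * (leaf c s - b).
Proof.
  intros Hsg He Hb Hspeed.
  assert (Hreach : exists s2, s1 <= s2 /\ 0 <= sg * (leaf c s2 - b)).
  { apply NNPP. intros Hno.
    assert (Hlt : forall s, s1 <= s -> sg * (leaf c s - b) < 0).
    { intros s Hs. apply Rnot_le_lt. intros Hle. apply Hno. now exists s. }
    set (T := - (sg * (leaf c s1 - b)) / (k * e)).
    assert (Hke : 0 < k * e) by now apply Rmult_lt_0_compat.
    pose proof (Hlt s1 (Rle_refl _)).
    assert (HT : 0 < T) by (apply Rdiv_lt_0_compat; lra).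
    assert (Hg : sg * leaf c s1 - k * e * s1 <= sg * leaf c (s1 + T) - k * e * (s1 + T)).
    { apply (nondecreasing_of_derive (fun x => sg * leaf c x - k * e * x)
               (fun x => sg * (k * (l + F x * leaf c x)) - k * e)); [lra| |].
      - intros x _. evar_last.
        + apply (is_derive_minus (fun x => sg * leaf c x) (fun x => k * e * x)).
          * apply (is_derive_scal (leaf c)), leaf_derive.
          * apply (is_derive_scal (fun x => x)). apply is_derive_id.
        + unfold minus, plus, opp, one; simpl. ring.
      - intros x [Hx _]. specialize (Hspeed x Hx (Hlt x Hx)). nra. }
    assert (k * e * T = - (sg * (leaf c s1 - b))) by (unfold T; field; lra).
    specialize (Hlt (s1 + T) ltac:(lra)). lra. }
  destruct Hreach as [s2 [Hs2 Hge]]. exists s2. intros s Hs.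
  pose proof (growth_pos s). pose proof (growth_pos s2).
  apply (quotient_nonneg _ (growth s)); [auto|].
  apply Rle_trans with (sg * (leaf c s2 - b) / growth s2); [now apply quotient_nonneg|].
  apply relative_distance_increasing; [exact Hs|]. intros x Hx. apply Hb. lra.
Qed.

(** [- c0] is the infimum of [height]: the leaf of [c0] is the lowest one along which
    the solution stays positive for all times. *)
Definition lowest_leaf (c0 : R) : Prop :=
  (forall s, 0 < c0 + height s) /\
  forall e, 0 < e -> exists s, c0 + height s < e.

Definition height_unbounded : Prop := forall M, exists s, height s < M.

Lemma height_dichotomy : height_unbounded \/ exists c0, lowest_leaf c0.
Proof.
  destruct (classic height_unbounded) as [H|H]; [now left|right].
  apply not_all_ex_not in H. destruct H as [M HM].
  assert (Hb : forall s, M <= height s).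
  { intros s. apply Rnot_lt_le. intros Hs. apply HM. now exists s. }
  destruct (completeness (fun y => exists s, y = - height s)) as [c0 [Hub Hlub]].
  - exists (- M). intros y [s ->]. specialize (Hb s). lra.
  - exists (- height 0). now exists 0.
  - exists c0. split.
    + intros s. pose proof (height_increasing (s - 1) s ltac:(lra)).
      specialize (Hub (- height (s - 1)) (ex_intro _ _ eq_refl)). lra.
    + intros e He. apply NNPP. intros Hno.
      assert (c0 <= c0 - e); [|lra].
      apply Hlub. intros y [s ->].
      destruct (Rle_dec e (c0 + height s)); [lra|].
      exfalso. apply Hno. exists s. lra.
Qed.

Lemma lowest_leaf_near c0 s1 e : lowest_leaf c0 -> 0 < e ->
  exists s, s < s1 /\ forall s', s' <= s -> c0 + height s' < e.
Proof.
  intros [Hp Hi] He. destruct (Hi e He) as [s Hs].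
  exists (Rmin s s1 - 1). pose proof (Rmin_l s s1). pose proof (Rmin_r s s1).
  split; [lra|].
  intros s' Hs'. pose proof (height_increasing s' s ltac:(lra)). lra.
Qed.

(** Otherwise the derivative of [height] is bounded away from [0] and [height] has no
    lower bound. *)
Lemma inv_growth_small c0 s1 e : lowest_leaf c0 -> 0 < e ->
  exists s, s < s1 /\ / growth s < e.
Proof.
  intros [Hp _] He. apply NNPP. intros Hno.
  assert (Hge : forall s, s < s1 -> e <= / growth s).
  { intros s Hs. apply Rnot_lt_le. intros Hle. apply Hno. now exists s. }
  set (s2 := s1 - 1). set (A := (c0 + height s2) / (k * l * e)).
  assert (Hkl : 0 < k * l * e) by (repeat apply Rmult_lt_0_compat; auto).
  assert (HA : 0 < A) by (apply Rdiv_lt_0_compat; auto).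
  assert (H : height (s2 - A) - k * l * e * (s2 - A) <= height s2 - k * l * e * s2).
  { apply (nondecreasing_of_derive (fun x => height x - k * l * e * x)
             (fun x => k * l / growth x - k * l * e)); [lra| |].
    - intros x _. evar_last.
      + apply (is_derive_minus height (fun x => k * l * e * x)); [apply height_derive|].
        apply (is_derive_scal (fun x => x)). apply is_derive_id.
      + unfold minus, plus, opp, one; simpl. ring.
    - intros x [_ Hx]. specialize (Hge x ltac:(unfold s2 in Hx; lra)).
      unfold Rdiv. rewrite <- Rmult_minus_distr_l. apply Rmult_le_pos; [|lra].
      apply Rmult_le_pos; lra. }
  assert (k * l * e * A = c0 + height s2) by (unfold A; field; repeat split; lra).
  specialize (Hp (s2 - A)). nra.
Qed.

(** The relative distance of the lowest leaf to [b] accumulates at [0] as time tends to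
    minus infinity, so that monotonicity determines its sign. *)
Lemma lowest_leaf_side sg c0 s1 b : lowest_leaf c0 -> sg = 1 \/ sg = -1 -> 0 < b ->
  (forall s, s <= s1 -> 0 <= sg * (l + F s * b)) ->
  forall s, s <= s1 -> 0 <= sg * (leaf c0 s - b).
Proof.
  intros H0 Hsg Hb HFb s Hs. apply Rnot_lt_le. intros Hlt.
  pose proof (growth_pos s).
  set (e := - (sg * (leaf c0 s - b)) / growth s).
  assert (He : 0 < e) by (apply Rdiv_lt_0_compat; lra).
  destruct (lowest_leaf_near c0 s e H0 He) as [s2 [Hs2 Hnear]].
  destruct (inv_growth_small c0 s2 (e / b) H0 ltac:(now apply Rdiv_lt_0_compat)) as [s' [Hs' Hg]].
  pose proof (relative_distance_increasing sg c0 b s' s ltac:(lra)) as Hm.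
  specialize (Hm ltac:(intros x Hx; apply HFb; lra)).
  specialize (Hnear s' ltac:(lra)). destruct H0 as [Hp _]. specialize (Hp s').
  pose proof (growth_pos s') as Hg'.
  replace (sg * (leaf c0 s' - b) / growth s')
    with (sg * (c0 + height s') - sg * (b * / growth s')) in Hm by (unfold leaf; field; lra).
  replace (sg * (leaf c0 s - b) / growth s) with (- e) in Hm by (unfold e; field; lra).
  assert (b * / growth s' < e).
  { apply Rmult_lt_compat_l with (r := b) in Hg; [|exact Hb].
    replace (b * (e / b)) with e in Hg by (field; lra). exact Hg. }
  assert (0 < b * / growth s') by (apply Rmult_lt_0_compat; [exact Hb|now apply Rinv_0_lt_compat]).
  destruct Hsg as [-> | ->]; lra.
Qed.

Lemma lowest_leaf_exists s1 e : 0 < e -> (forall s, s <= s1 -> F s <= - e) ->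
  exists c0, lowest_leaf c0.
Proof.
  intros He HFe. destruct height_dichotomy as [Hu|H]; [exfalso|exact H].
  destruct (Hu (Rmin (height s1) (height s1 - l / e / growth s1))) as [s Hs].
  pose proof (Rmin_l (height s1) (height s1 - l / e / growth s1)).
  pose proof (Rmin_r (height s1) (height s1 - l / e / growth s1)).
  assert (Hlt : s <= s1).
  { apply Rnot_lt_le. intros Hlt. pose proof (height_increasing s1 s Hlt). lra. }
  (* [F <= - e] makes [(l / e) / growth] grow at least as fast as [height] *)
  assert (Hm : l / e / growth s - height s <= l / e / growth s1 - height s1).
  { apply (nondecreasing_of_derive (fun x => l / e / growth x - height x)
       (fun x => l / e * (- (k * F x) / growth x) - k * l / growth x) _ _ Hlt).
    - intros x _. apply (is_derive_minus (fun x => l / e / growth x) height); [|apply height_derive].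
      apply (is_derive_scal (fun x => / growth x)), inv_growth_derive.
    - intros x Hx. pose proof (HFe x ltac:(lra)). pose proof (growth_pos x).
      replace (l / e * (- (k * F x) / growth x) - k * l / growth x)
        with (k * l * ((- F x - e) / e / growth x)) by (field; lra).
      apply Rmult_le_pos; [nra|]. apply quotient_nonneg; [auto|]. apply quotient_nonneg; lra. }
  assert (0 < l / e / growth s).
  { repeat apply Rdiv_lt_0_compat; auto. apply growth_pos. }
  lra.
Qed.

(** * Asymptotics of the linear equation *)

Lemma excess_near phi b : 0 < b -> l + phi * b <> 0 ->
  exists e, 0 < e /\ forall y, Rabs (y - phi) < e ->
    Rabs ((l + y * b) - (l + phi * b)) < Rabs (l + phi * b) / 2.
Proof.
  intros Hb Hp. apply (near_point (fun y => l + y * b)).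
  - apply (ex_derive_continuous (fun y => l + y * b)). auto_derive. exact I.
  - pose proof (Rabs_pos_lt _ Hp). lra.
Qed.

Lemma equilibrium_pos phi : phi < 0 -> 0 < - l / phi /\ phi * (- l / phi) = - l.
Proof.
  intros H. split; [|field; lra].
  replace (- l / phi) with (l / - phi) by (field; lra). apply Rdiv_lt_0_compat; lra.
Qed.

Section Forward.
Variable phi : R.
Hypothesis Hphi : is_lim F p_infty phi.

Lemma limit_forward e : 0 < e -> exists s1, forall s, s1 <= s -> Rabs (F s - phi) < e.
Proof.
  intros He. apply is_lim_spec in Hphi. destruct (Hphi (mkposreal e He)) as [M HM].
  exists (M + 1). intros s Hs. apply HM. lra.
Qed.

Lemma leaf_side_forward sg c s0 b : sg = 1 \/ sg = -1 -> 0 < leaf c s0 -> 0 < b ->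
  0 < sg * (l + phi * b) -> exists s2, forall s, s2 <= s -> 0 <= sg * (leaf c s - b).
Proof.
  intros Hsg Hp Hb Hlb.
  destruct (excess_near phi b Hb) as [e [He Hy]]; [intros E; rewrite E in Hlb; lra|].
  destruct (limit_forward e He) as [s1 Hs1]. set (d := Rabs (l + phi * b) / 2) in *.
  assert (Ed : sg * (l + phi * b) = 2 * d).
  { unfold d, Rabs. destruct Rcase_abs; destruct Hsg as [-> | ->]; lra. }
  assert (Hex : forall s, s1 <= s -> d <= sg * (l + F s * b)).
  { intros s Hs. specialize (Hy _ (Hs1 s Hs)). apply Rabs_def2 in Hy.
    destruct Hsg as [-> | ->]; lra. }
  pose proof (Rmax_l s0 s1). pose proof (Rmax_r s0 s1).
  pose proof (Rmin_l l d). pose proof (Rmin_r l d).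
  apply (leaf_crosses sg c (Rmax s0 s1) b (Rmin l d) Hsg).
  - apply Rmin_pos; lra.
  - intros s Hs. specialize (Hex s ltac:(lra)). lra.
  - (* [w = 0] has excess [l], and the excess is affine in between *)
    intros s Hs Hw. specialize (Hex s ltac:(lra)).
    pose proof (leaf_pos_after c s0 s Hp ltac:(lra)) as Hpos.
    destruct Hsg as [-> | ->].
    + destruct (Rle_dec 0 (F s)); nra.
    + assert (F s < 0) by nra. nra.
Qed.

Lemma leaf_to_infinity c s0 : 0 <= phi -> 0 < leaf c s0 ->
  forall M, exists s2, forall s, s2 <= s -> M <= leaf c s.
Proof.
  intros H0 Hp M. pose proof (Rmax_l M 1). pose proof (Rmax_r M 1).
  destruct (leaf_side_forward 1 c s0 (Rmax M 1) ltac:(now left) Hp) as [s2 H2]; [lra|nra|].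
  exists s2. intros s Hs. specialize (H2 s Hs). lra.
Qed.

Lemma leaf_to_equilibrium c s0 : phi < 0 -> 0 < leaf c s0 ->
  forall e, 0 < e -> exists s2, forall s, s2 <= s -> Rabs (leaf c s - - l / phi) <= e.
Proof.
  intros H0 Hp e He. destruct (equilibrium_pos phi H0) as [Hq Hv].
  pose proof (Rmin_l e (- l / phi / 2)). pose proof (Rmin_r e (- l / phi / 2)).
  assert (He' : 0 < Rmin e (- l / phi / 2)) by (apply Rmin_pos; lra).
  set (e' := Rmin e (- l / phi / 2)) in *.
  destruct (leaf_side_forward 1 c s0 (- l / phi - e') ltac:(now left) Hp) as [s2 H2]; [lra|nra|].
  destruct (leaf_side_forward (-1) c s0 (- l / phi + e') ltac:(now right) Hp) as [s3 H3]; [lra|nra|].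
  exists (Rmax s2 s3). intros s Hs. pose proof (Rmax_l s2 s3). pose proof (Rmax_r s2 s3).
  specialize (H2 s ltac:(lra)). specialize (H3 s ltac:(lra)). apply Rabs_le. lra.
Qed.
End Forward.

Section Backward.
Variable phi : R.
Hypothesis Hphi : is_lim F m_infty phi.

Lemma limit_backward e : 0 < e -> exists s1, forall s, s <= s1 -> Rabs (F s - phi) < e.
Proof.
  intros He. apply is_lim_spec in Hphi. destruct (Hphi (mkposreal e He)) as [M HM].
  exists (M - 1). intros s Hs. apply HM. lra.
Qed.

Lemma lowest_leaf_exists_limit : phi < 0 -> exists c0, lowest_leaf c0.
Proof.
  intros H0. destruct (limit_backward (- phi / 2) ltac:(lra)) as [s1 H1].
  apply (lowest_leaf_exists s1 (- phi / 2)); [lra|].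
  intros s Hs. specialize (H1 s Hs). apply Rabs_def2 in H1. lra.
Qed.

Lemma lowest_leaf_side_limit sg c0 b : lowest_leaf c0 -> sg = 1 \/ sg = -1 -> 0 < b ->
  0 < sg * (l + phi * b) -> exists s2, forall s, s <= s2 -> 0 <= sg * (leaf c0 s - b).
Proof.
  intros Hc Hsg Hb Hlb.
  destruct (excess_near phi b Hb) as [e [He Hy]]; [intros E; rewrite E in Hlb; lra|].
  destruct (limit_backward e He) as [s1 Hs1]. exists s1.
  apply lowest_leaf_side; auto. intros s Hs. specialize (Hy _ (Hs1 s Hs)).
  apply Rabs_def2 in Hy. unfold Rabs in Hy.
  destruct (Rcase_abs (l + phi * b)); destruct Hsg as [-> | ->]; lra.
Qed.

Lemma leaf_from_infinity c0 c : 0 <= phi -> lowest_leaf c0 -> c0 <= c ->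
  forall M, exists s2, forall s, s <= s2 -> M <= leaf c s.
Proof.
  intros H0 Hc Hle M. pose proof (Rmax_l M 1). pose proof (Rmax_r M 1).
  destruct (lowest_leaf_side_limit 1 c0 (Rmax M 1) Hc ltac:(now left)) as [s2 H2]; [lra|nra|].
  exists s2. intros s Hs. specialize (H2 s Hs). unfold leaf in *. pose proof (growth_pos s). nra.
Qed.

Lemma leaf_from_equilibrium c0 : phi < 0 -> lowest_leaf c0 ->
  forall e, 0 < e -> exists s2, forall s, s <= s2 -> Rabs (leaf c0 s - - l / phi) <= e.
Proof.
  intros H0 Hc e He. destruct (equilibrium_pos phi H0) as [Hq Hv].
  pose proof (Rmin_l e (- l / phi / 2)). pose proof (Rmin_r e (- l / phi / 2)).
  assert (He' : 0 < Rmin e (- l / phi / 2)) by (apply Rmin_pos; lra).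
  set (e' := Rmin e (- l / phi / 2)) in *.
  destruct (lowest_leaf_side_limit 1 c0 (- l / phi - e') Hc ltac:(now left)) as [s2 H2]; [lra|nra|].
  destruct (lowest_leaf_side_limit (-1) c0 (- l / phi + e') Hc ltac:(now right)) as [s3 H3]; [lra|nra|].
  exists (Rmin s2 s3). intros s Hs. pose proof (Rmin_l s2 s3). pose proof (Rmin_r s2 s3).
  specialize (H2 s ltac:(lra)). specialize (H3 s ltac:(lra)). apply Rabs_le. lra.
Qed.

(** The lowest leaf stays away from [0] while [c0 + height] vanishes, so that
    [growth], their quotient, is unbounded. *)
Lemma leaf_from_infinity_strict c0 c : lowest_leaf c0 -> c0 < c ->
  forall M, exists s2, forall s, s <= s2 -> M <= leaf c s.
Proof.
  intros Hc Hlt M. destruct (Rle_dec 0 phi) as [H0|H0].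
  { apply (leaf_from_infinity c0); auto; lra. }
  destruct (equilibrium_pos phi ltac:(lra)) as [Hq Hv]. set (b := - l / phi / 2).
  destruct (lowest_leaf_side_limit 1 c0 b Hc ltac:(now left)) as [s2 H2]; [unfold b; lra|unfold b; nra|].
  pose proof (Rmax_l M 1). pose proof (Rmax_r M 1). set (M' := Rmax M 1) in *.
  destruct (lowest_leaf_near c0 s2 (b * (c - c0) / M') Hc) as [s3 [Hs3 H3]].
  { apply Rdiv_lt_0_compat; [unfold b|]; nra. }
  exists s3. intros s Hs. specialize (H2 s ltac:(lra)). specialize (H3 s Hs).
  destruct Hc as [Hp _]. specialize (Hp s). unfold leaf in *. pose proof (growth_pos s).
  assert (Hb : 0 < b) by (unfold b; lra).
  assert (growth s * (c0 + height s) <= growth s * (b * (c - c0) / M')) by nra.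
  assert (Hx : growth s * (b * (c - c0) / M') = b * (growth s * (c - c0) / M')) by (field; lra).
  assert (1 <= growth s * (c - c0) / M') by nra.
  assert (growth s * (c - c0) = growth s * (c - c0) / M' * M') by (field; lra).
  nra.
Qed.
End Backward.

End LinearEquation.

(** * Separation of variables *)

Section ScalarFlow.
Variables (J : R -> Prop) (w : R -> R) (s0 t0 : R).
Hypothesis Hs0 : J s0.
Hypothesis Hconv : forall a b x, J a -> J b -> a <= x <= b -> J x.
Hypothesis Hopen : forall x, J x -> exists a b, J a /\ J b /\ a < x < b.
Hypothesis Hcont : forall x, J x -> continuous w x.
Hypothesis Hpos : forall x, J x -> 0 < w x.

Let tau (s : R) : R := t0 + RInt (fun x => / w x) s0 s.
Let sigma (t : R) : R := real (Lub_Rbar (fun s => J s /\ tau s <= t)).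
Let first : Rbar := Glb_Rbar (fun t => exists s, J s /\ tau s = t).
Let last : Rbar := Lub_Rbar (fun t => exists s, J s /\ tau s = t).

Lemma tau_derive s : J s -> is_derive tau s (/ w s).
Proof.
  intros Hs.
  assert (Hinv : forall z, J z -> continuous (fun x => / w x) z).
  { intros z Hz. apply (continuous_comp w Rinv); [now apply Hcont|].
    apply (ex_derive_continuous Rinv). specialize (Hpos z Hz). auto_derive. lra. }
  unfold tau. evar_last.
  - apply (is_derive_plus (fun _ => t0) (fun s => RInt (fun x => / w x) s0 s)).
    + apply is_derive_const.
    + apply (is_derive_RInt (fun x => / w x) _ s0 s); [|now apply Hinv].
      destruct (Hopen s Hs) as [a [b [Ha [Hb Hab]]]].
      generalize (filter_and _ _ (open_gt a s (proj1 Hab)) (open_lt b s (proj2 Hab))).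
      apply filter_imp. intros y Hy. assert (HJy : J y) by (apply (Hconv a b); auto; lra).
      apply (RInt_correct (V := R_CompleteNormedModule)).
      apply (ex_RInt_continuous (V := R_CompleteNormedModule)).
      intros z Hz. apply Hinv. destruct (Rle_dec s0 y).
      * rewrite Rmin_left, Rmax_right in Hz by lra. now apply (Hconv s0 y).
      * rewrite Rmin_right, Rmax_left in Hz by lra. now apply (Hconv y s0).
  - unfold plus, zero; simpl. ring.
Qed.

Lemma tau_increasing s s' : J s -> J s' -> s < s' -> tau s < tau s'.
Proof.
  intros Hs Hs' Hlt. apply (increasing_of_derive tau (fun x => / w x)); auto.
  - intros x Hx. apply tau_derive. now apply (Hconv s s').
  - intros x Hx. apply Rinv_0_lt_compat, Hpos. now apply (Hconv s s').
Qed.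

Lemma tau_le s s' : J s -> J s' -> tau s <= tau s' -> s <= s'.
Proof.
  intros Hs Hs' Hle. apply Rnot_lt_le. intros Hlt.
  pose proof (tau_increasing s' s Hs' Hs Hlt). lra.
Qed.

Lemma sigma_tau s : J s -> sigma (tau s) = s.
Proof.
  intros Hs. unfold sigma.
  rewrite (is_lub_Rbar_unique _ (Finite s)); [reflexivity|]. split.
  - intros x [Hx Hle]. now apply tau_le.
  - intros b Hb. apply (Hb s). split; [exact Hs|lra].
Qed.

Lemma tau_range (t : R) : Rbar_lt first t -> Rbar_lt t last -> exists s, J s /\ tau s = t.
Proof.
  intros H1 H2.
  assert (Ha : exists a, J a /\ tau a < t).
  { apply NNPP. intros Hno. apply Rbar_lt_not_le in H1. apply H1.
    apply Glb_Rbar_correct. intros x [s [Hs <-]]. simpl.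
    apply Rnot_lt_le. intros Hlt. apply Hno. now exists s. }
  assert (Hb : exists b, J b /\ t < tau b).
  { apply NNPP. intros Hno. apply Rbar_lt_not_le in H2. apply H2.
    apply Lub_Rbar_correct. intros x [s [Hs <-]]. simpl.
    apply Rnot_lt_le. intros Hlt. apply Hno. now exists s. }
  destruct Ha as [a [Ha Hta]]. destruct Hb as [b [Hb Htb]].
  assert (Hab : a <= b) by (apply tau_le; auto; lra).
  destruct (intermediate_value tau a b t) as [s [Hs Hts]]; [exact Hab| |lra|].
  - intros x Hx. apply (ex_derive_continuous tau). eexists.
    apply tau_derive. now apply (Hconv a b).
  - exists s. split; [now apply (Hconv a b)|exact Hts].
Qed.

Lemma tau_between s : J s -> Rbar_lt first (tau s) /\ Rbar_lt (tau s) last.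
Proof.
  intros Hs. destruct (Hopen s Hs) as [a [b [Ha [Hb Hab]]]]. split.
  - apply Rbar_le_lt_trans with (tau a); [|apply tau_increasing; tauto].
    apply Glb_Rbar_correct. now exists a.
  - apply Rbar_lt_le_trans with (tau b); [apply tau_increasing; tauto|].
    apply Lub_Rbar_correct. now exists b.
Qed.

Lemma sigma_derive s : J s -> is_derive sigma (tau s) (w s).
Proof.
  intros Hs. apply is_derive_Reals. intros eps He.
  destruct (Hopen s Hs) as [a [b [Ha [Hb Hab]]]].
  destruct (near_point w s eps (Hcont s Hs) He) as [d [Hd0 Hd]].
  set (a' := Rmax a (s - d / 2)). set (b' := Rmin b (s + d / 2)).
  assert (Ha' : a <= a' < s /\ s - d < a').
  { unfold a', Rmax. destruct Rle_dec; lra. }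
  assert (Hb' : s < b' <= b /\ b' < s + d).
  { unfold b', Rmin. destruct Rle_dec; lra. }
  assert (HJa : J a') by (apply (Hconv a b); auto; lra).
  assert (HJb : J b') by (apply (Hconv a b); auto; lra).
  pose proof (tau_increasing a' s HJa Hs ltac:(lra)).
  pose proof (tau_increasing s b' Hs HJb ltac:(lra)).
  assert (Hdel : 0 < Rmin (tau s - tau a') (tau b' - tau s)) by (apply Rmin_pos; lra).
  exists (mkposreal _ Hdel). intros h Hh Hlt. simpl in Hlt.
  apply Rabs_def2 in Hlt.
  pose proof (Rmin_l (tau s - tau a') (tau b' - tau s)).
  pose proof (Rmin_r (tau s - tau a') (tau b' - tau s)).
  destruct (intermediate_value tau a' b' (tau s + h)) as [z [Hz Hzt]]; [lra| |lra|].
  { intros x Hx. apply (ex_derive_continuous tau). eexists.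
    apply tau_derive. apply (Hconv a b); auto; lra. }
  assert (HJz : J z) by (apply (Hconv a b); auto; lra).
  rewrite <- Hzt, !sigma_tau by auto.
  (* the difference quotient of the inverse is [w] at an intermediate point *)
  assert (Hxi : exists x, a' <= x <= b' /\ h = (z - s) / w x).
  { destruct (Rtotal_order s z) as [Hsz|[Hsz|Hsz]].
    - destruct (mean_value tau (fun x => / w x) s z Hsz) as [x [Hx Heq]].
      + intros x Hx. apply tau_derive. apply (Hconv a b); auto; lra.
      + exists x. split; [lra|]. unfold Rdiv. lra.
    - exfalso. subst z. lra.
    - destruct (mean_value tau (fun x => / w x) z s Hsz) as [x [Hx Heq]].
      + intros x Hx. apply tau_derive. apply (Hconv a b); auto; lra.
      + exists x. split; [lra|]. unfold Rdiv. lra. }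
  destruct Hxi as [x [Hx Hhx]].
  assert (HJx : J x) by (apply (Hconv a b); auto; lra).
  pose proof (Hpos x HJx) as Hwx.
  replace ((z - s) / h) with (w x).
  - apply Hd. apply Rabs_def1; lra.
  - assert (z - s <> 0) by (intros E; apply Hh; rewrite Hhx, E; unfold Rdiv; ring).
    rewrite Hhx. field. split; lra.
Qed.

(** Separation of variables: [tau] is the time needed to reach a given state, and
    the solution is its inverse. *)
Lemma scalar_flow : exists (t1 t2 : Rbar) (sig : R -> R),
  Rbar_lt t1 t0 /\ Rbar_lt t0 t2 /\ sig t0 = s0 /\
  (forall t : R, Rbar_lt t1 t -> Rbar_lt t t2 -> J (sig t) /\ is_derive sig t (w (sig t))) /\
  (forall s, J s -> exists t : R, Rbar_lt t1 t /\ Rbar_lt t t2 /\ sig t = s).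
Proof.
  exists first, last, sigma.
  assert (H0 : tau s0 = t0).
  { unfold tau. rewrite RInt_point. unfold zero; simpl. ring. }
  rewrite <- H0. destruct (tau_between s0 Hs0) as [H1 H2].
  split; [exact H1|]. split; [exact H2|]. split; [now apply sigma_tau|]. split.
  - intros t Ht1 Ht2. destruct (tau_range t Ht1 Ht2) as [s [Hs <-]].
    rewrite sigma_tau by exact Hs. split; [exact Hs|]. now apply sigma_derive.
  - intros s Hs. exists (tau s). destruct (tau_between s Hs) as [H3 H4].
    repeat split; auto. now apply sigma_tau.
Qed.
End ScalarFlow.

(** * Powers of the radius *)

Definition rate (S : system) : R := INR (deg S - 1).
Definition root (S : system) (w : R) : R := Rpower w (/ rate S).

Lemma rate_pos S : (1 < deg S)%nat -> 0 < rate S.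
Proof. intros H. unfold rate. apply lt_0_INR. lia. Qed.

Lemma root_pos S w : 0 < root S w.
Proof. unfold root, Rpower. apply exp_pos. Qed.

Lemma root_pow S w : (1 < deg S)%nat -> 0 < w -> root S w ^ (deg S - 1) = w.
Proof.
  intros Hd Hw. rewrite <- Rpower_pow by apply root_pos.
  unfold root. rewrite Rpower_mult. fold (rate S). rewrite Rinv_l.
  - now apply Rpower_1.
  - pose proof (rate_pos S Hd). lra.
Qed.

Lemma root_of_pow S r : (1 < deg S)%nat -> 0 < r -> root S (r ^ (deg S - 1)) = r.
Proof.
  intros Hd Hr. unfold root. rewrite <- Rpower_pow by exact Hr.
  rewrite Rpower_mult. fold (rate S). rewrite Rinv_r.
  - now apply Rpower_1.
  - pose proof (rate_pos S Hd). lra.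
Qed.

Lemma root_derive S w : (1 < deg S)%nat -> 0 < w ->
  is_derive (root S) w (root S w / (rate S * w)).
Proof.
  intros Hd Hw. pose proof (rate_pos S Hd). unfold root, Rpower. auto_derive; [exact Hw|].
  field. split; lra.
Qed.

Lemma root_increasing S w w' : (1 < deg S)%nat -> 0 < w -> w < w' -> root S w < root S w'.
Proof.
  intros Hd Hw Hlt. unfold root, Rpower. apply exp_increasing.
  apply Rmult_lt_compat_l; [apply Rinv_0_lt_compat, rate_pos, Hd|]. now apply ln_increasing.
Qed.

Lemma root_le S w w' : (1 < deg S)%nat -> 0 < w -> w <= w' -> root S w <= root S w'.
Proof. intros Hd Hw [H| ->]; [left; now apply root_increasing|right; reflexivity]. Qed.

Lemma root_inj S w w' : (1 < deg S)%nat -> 0 < w -> 0 < w' -> root S w = root S w' -> w = w'.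
Proof. intros Hd Hw Hw' H. rewrite <- (root_pow S w), <- (root_pow S w'), H by auto. reflexivity. Qed.

(** * The field in polar coordinates *)

Lemma hpoly_scale n c r x y : hpoly n c (r * x) (r * y) = r ^ n * hpoly n c x y.
Proof.
  unfold hpoly. rewrite scal_sum. apply sum_eq. intros k Hk.
  rewrite !Rpow_mult_distr. replace (r ^ n) with (r ^ k * r ^ (n - k)); [ring|].
  rewrite <- pow_add. f_equal. lia.
Qed.

Lemma vfield_polar S r th :
  vfield S (polar r th) =
  ((lam S * r + f S th * r ^ deg S) * cos th - g S th * r ^ deg S * sin th,
   (lam S * r + f S th * r ^ deg S) * sin th + g S th * r ^ deg S * cos th).
Proof.
  unfold vfield, polar, f, g, Q1, Q2; simpl. rewrite !hpoly_scale.
  pose proof (sin2_cos2 th) as H. unfold Rsqr in H.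
  set (q1 := hpoly _ (coef1 S) _ _). set (q2 := hpoly _ (coef2 S) _ _).
  set (C := cos th) in *. set (s := sin th) in *. set (P := r ^ deg S).
  f_equal.
  - replace (P * q1) with ((s * s + C * C) * (P * q1)) by (rewrite H; ring). ring.
  - replace (P * q2) with ((s * s + C * C) * (P * q2)) by (rewrite H; ring). ring.
Qed.

Lemma pow_deg S r : (1 < deg S)%nat -> r ^ deg S = r * r ^ (deg S - 1).
Proof. intros H. replace (deg S) with (Datatypes.S (deg S - 1)) at 1 by lia. reflexivity. Qed.

(** The chart of a sector in which trajectories solve a linear equation: the angle is
    transported by the flow at infinity [th], and [w] is the power [deg S - 1] of the
    radius. *)
Definition chart (S : system) (th : R -> R) (s w : R) : R * R := polar (root S w) (th s).

(** In the time of the flow at infinity, which runs at speed [w], the equation for [w]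
    loses the factor [w] and becomes linear. *)
Lemma chart_derive S (th : R -> R) (sg w : R -> R) (t : R) :
  (1 < deg S)%nat -> 0 < w t ->
  is_derive th (sg t) (g S (th (sg t))) ->
  is_derive sg t (w t) ->
  is_derive w t (rate S * (lam S + f S (th (sg t)) * w t) * w t) ->
  is_derive (fun u => fst (chart S th (sg u) (w u))) t (fst (vfield S (chart S th (sg t) (w t)))) /\
  is_derive (fun u => snd (chart S th (sg u) (w u))) t (snd (vfield S (chart S th (sg t) (w t)))).
Proof.
  intros Hd Hw Hth Hs Hdw. unfold chart. rewrite vfield_polar, pow_deg, root_pow by auto.
  assert (Hr : is_derive (fun u => root S (w u)) t
                 (lam S * root S (w t) + f S (th (sg t)) * (root S (w t) * w t))).
  { eapply is_derive_eq; [apply (is_derive_comp (root S) w); [now apply root_derive|exact Hdw]|].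
    unfold scal; simpl; unfold mult; simpl. pose proof (rate_pos S Hd). field. split; lra. }
  assert (Ha : is_derive (fun u => th (sg u)) t (w t * g S (th (sg t)))).
  { eapply is_derive_eq; [apply (is_derive_comp th sg); eassumption|].
    unfold scal; simpl; unfold mult; simpl. reflexivity. }
  unfold polar; simpl. split.
  - eapply is_derive_eq.
    + apply (is_derive_mult (fun u => root S (w u)) (fun u => cos (th (sg u)))).
      * exact Hr.
      * apply (is_derive_comp cos (fun u => th (sg u))); [apply is_derive_cos|exact Ha].
      * intros; apply Rmult_comm.
    + unfold plus, scal, mult; simpl; unfold mult; simpl. ring.
  - eapply is_derive_eq.
    + apply (is_derive_mult (fun u => root S (w u)) (fun u => sin (th (sg u)))).
      * exact Hr.
      * apply (is_derive_comp sin (fun u => th (sg u))); [apply is_derive_sin|exact Ha].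
      * intros; apply Rmult_comm.
    + unfold plus, scal, mult; simpl; unfold mult; simpl. ring.
Qed.

(** * Lipschitz estimates *)

(** This serves Gronwall's inequality for the field and, on the unit circle, the
    regularity of [f] and [g]. *)
Definition lipschitz_on_boxes (h : R -> R -> R) : Prop :=
  forall M, exists L, 0 <= L /\ forall x y x' y',
    Rabs x <= M -> Rabs y <= M -> Rabs x' <= M -> Rabs y' <= M ->
    Rabs (h x y - h x' y') <= L * (Rabs (x - x') + Rabs (y - y')).

Lemma lipschitz_const c : lipschitz_on_boxes (fun _ _ => c).
Proof.
  intros M. exists 0. split; [lra|]. intros. rewrite Rminus_diag, Rabs_R0. lra.
Qed.

Lemma lipschitz_fst : lipschitz_on_boxes (fun x _ => x).
Proof.
  intros M. exists 1. split; [lra|]. intros x y x' y' _ _ _ _.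
  pose proof (Rabs_pos (y - y')). lra.
Qed.

Lemma lipschitz_snd : lipschitz_on_boxes (fun _ y => y).
Proof.
  intros M. exists 1. split; [lra|]. intros x y x' y' _ _ _ _.
  pose proof (Rabs_pos (x - x')). lra.
Qed.

Lemma lipschitz_plus h1 h2 : lipschitz_on_boxes h1 -> lipschitz_on_boxes h2 ->
  lipschitz_on_boxes (fun x y => h1 x y + h2 x y).
Proof.
  intros H1 H2 M. destruct (H1 M) as [L1 [HL1 E1]]. destruct (H2 M) as [L2 [HL2 E2]].
  exists (L1 + L2). split; [lra|]. intros x y x' y' Hx Hy Hx' Hy'.
  specialize (E1 x y x' y' Hx Hy Hx' Hy'). specialize (E2 x y x' y' Hx Hy Hx' Hy').
  replace (h1 x y + h2 x y - (h1 x' y' + h2 x' y'))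
    with ((h1 x y - h1 x' y') + (h2 x y - h2 x' y')) by ring.
  pose proof (Rabs_triang (h1 x y - h1 x' y') (h2 x y - h2 x' y')). lra.
Qed.

Lemma lipschitz_bounded h M : lipschitz_on_boxes h ->
  exists B, 0 <= B /\ forall x y, Rabs x <= M -> Rabs y <= M -> Rabs (h x y) <= B.
Proof.
  intros H. destruct (H M) as [L [HL E]].
  exists (Rabs (h 0 0) + L * (Rabs M + Rabs M)).
  pose proof (Rabs_pos (h 0 0)). pose proof (Rabs_pos M). split; [nra|].
  intros x y Hx Hy. pose proof (Rabs_pos x). pose proof (Rle_abs M).
  specialize (E x y 0 0 Hx Hy). rewrite Rabs_R0, !Rminus_0_r in E.
  specialize (E ltac:(lra) ltac:(lra)).
  replace (h x y) with ((h x y - h 0 0) + h 0 0) by ring.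
  pose proof (Rabs_triang (h x y - h 0 0) (h 0 0)).
  assert (L * (Rabs x + Rabs y) <= L * (Rabs M + Rabs M)) by (apply Rmult_le_compat_l; lra).
  lra.
Qed.

Lemma lipschitz_mult h1 h2 : lipschitz_on_boxes h1 -> lipschitz_on_boxes h2 ->
  lipschitz_on_boxes (fun x y => h1 x y * h2 x y).
Proof.
  intros H1 H2 M.
  destruct (lipschitz_bounded h1 M H1) as [B1 [HB1 E1]].
  destruct (lipschitz_bounded h2 M H2) as [B2 [HB2 E2]].
  destruct (H1 M) as [L1 [HL1 F1]]. destruct (H2 M) as [L2 [HL2 F2]].
  exists (B1 * L2 + B2 * L1). split; [nra|]. intros x y x' y' Hx Hy Hx' Hy'.
  specialize (F1 x y x' y' Hx Hy Hx' Hy'). specialize (F2 x y x' y' Hx Hy Hx' Hy').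
  specialize (E1 x y Hx Hy). specialize (E2 x' y' Hx' Hy').
  set (d := Rabs (x - x') + Rabs (y - y')) in *.
  replace (h1 x y * h2 x y - h1 x' y' * h2 x' y')
    with (h1 x y * (h2 x y - h2 x' y') + h2 x' y' * (h1 x y - h1 x' y')) by ring.
  eapply Rle_trans; [apply Rabs_triang|]. rewrite !Rabs_mult.
  assert (A1 : Rabs (h1 x y) * Rabs (h2 x y - h2 x' y') <= B1 * (L2 * d)).
  { apply Rmult_le_compat; auto using Rabs_pos. }
  assert (A2 : Rabs (h2 x' y') * Rabs (h1 x y - h1 x' y') <= B2 * (L1 * d)).
  { apply Rmult_le_compat; auto using Rabs_pos. }
  lra.
Qed.

Lemma lipschitz_pow h k : lipschitz_on_boxes h -> lipschitz_on_boxes (fun x y => h x y ^ k).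
Proof.
  intros H. induction k as [|k IH]; simpl; [apply lipschitz_const|].
  now apply (lipschitz_mult h (fun x y => h x y ^ k)).
Qed.

Lemma lipschitz_hpoly n c : lipschitz_on_boxes (hpoly n c).
Proof.
  unfold hpoly.
  assert (Hm : forall k, lipschitz_on_boxes (fun x y => c k * x ^ k * y ^ (n - k))).
  { intros k. apply (lipschitz_mult (fun x y => c k * x ^ k) (fun x y => y ^ (n - k))).
    - apply (lipschitz_mult (fun _ _ => c k) (fun x _ => x ^ k)); [apply lipschitz_const|].
      apply (lipschitz_pow (fun x _ => x)), lipschitz_fst.
    - apply (lipschitz_pow (fun _ y => y)), lipschitz_snd. }
  assert (H : forall m, lipschitz_on_boxes
                 (fun x y => sum_f_R0 (fun k => c k * x ^ k * y ^ (n - k)) m)).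
  { induction m as [|m IH]; simpl sum_f_R0; [apply Hm|].
    apply (lipschitz_plus (fun x y => sum_f_R0 (fun k => c k * x ^ k * y ^ (n - k)) m)); auto. }
  apply H.
Qed.

Lemma lipschitz_vfield S :
  lipschitz_on_boxes (fun x y => fst (vfield S (x, y))) /\
  lipschitz_on_boxes (fun x y => snd (vfield S (x, y))).
Proof.
  unfold vfield, Q1, Q2; simpl. split.
  - apply (lipschitz_plus (fun x y => lam S * x) (hpoly (deg S) (coef1 S))); [|apply lipschitz_hpoly].
    apply (lipschitz_mult (fun _ _ => lam S) (fun x _ => x)); [apply lipschitz_const|apply lipschitz_fst].
  - apply (lipschitz_plus (fun x y => lam S * y) (hpoly (deg S) (coef2 S))); [|apply lipschitz_hpoly].
    apply (lipschitz_mult (fun _ _ => lam S) (fun _ y => y)); [apply lipschitz_const|apply lipschitz_snd].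
Qed.

Lemma sin_cos_lipschitz a b :
  Rabs (cos a - cos b) <= Rabs (a - b) /\ Rabs (sin a - sin b) <= Rabs (a - b).
Proof.
  assert (W : forall (h dh : R -> R), (forall x, is_derive h x (dh x)) ->
            (forall x, Rabs (dh x) <= 1) -> forall a b, a < b -> Rabs (h a - h b) <= Rabs (a - b)).
  { intros h dh Hd Hb x y Hxy. destruct (mean_value h dh x y Hxy) as [z [_ Hz]]; [auto|].
    rewrite (Rabs_minus_sym (h x)), (Rabs_minus_sym x), Hz, Rabs_mult.
    specialize (Hb z). pose proof (Rabs_pos (y - x)). nra. }
  assert (W' : forall (h dh : R -> R), (forall x, is_derive h x (dh x)) ->
            (forall x, Rabs (dh x) <= 1) -> Rabs (h a - h b) <= Rabs (a - b)).
  { intros h dh Hd Hb. destruct (Rtotal_order a b) as [H|[H|H]].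
    - now apply (W h dh).
    - subst. rewrite !Rminus_diag. lra.
    - rewrite (Rabs_minus_sym (h a)), (Rabs_minus_sym a). now apply (W h dh). }
  split.
  - apply (W' cos (fun x => - sin x)); [apply is_derive_cos|].
    intros x. rewrite Rabs_Ropp. apply Rabs_le. pose proof (SIN_bound x). lra.
  - apply (W' sin cos); [apply is_derive_sin|].
    intros x. apply Rabs_le. pose proof (COS_bound x). lra.
Qed.

Lemma cos_sin_abs th : Rabs (cos th) <= 1 /\ Rabs (sin th) <= 1.
Proof.
  split; apply Rabs_le; [pose proof (COS_bound th)|pose proof (SIN_bound th)]; lra.
Qed.

Lemma lipschitz_circle h : lipschitz_on_boxes h ->
  exists L, 0 <= L /\ forall a b,
    Rabs (h (cos a) (sin a) - h (cos b) (sin b)) <= L * Rabs (a - b).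
Proof.
  intros H. destruct (H 1) as [L [HL E]]. exists (L * 2). split; [lra|]. intros a b.
  destruct (cos_sin_abs a), (cos_sin_abs b), (sin_cos_lipschitz a b).
  eapply Rle_trans; [now apply E|]. rewrite Rmult_assoc. apply Rmult_le_compat_l; [exact HL|lra].
Qed.

Lemma g_lipschitz S : exists L, 0 <= L /\ forall a b, Rabs (g S a - g S b) <= L * Rabs (a - b).
Proof.
  apply (lipschitz_circle (fun x y => x * Q2 S x y - y * Q1 S x y)).
  intros M.
  destruct (lipschitz_plus (fun x y => x * Q2 S x y) (fun x y => -1 * (y * Q1 S x y))) with (M := M)
    as [L [HL E]].
  - apply lipschitz_mult; [apply lipschitz_fst|apply lipschitz_hpoly].
  - apply (lipschitz_mult (fun _ _ => -1) (fun x y => y * Q1 S x y)); [apply lipschitz_const|].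
    apply lipschitz_mult; [apply lipschitz_snd|apply lipschitz_hpoly].
  - exists L. split; [exact HL|]. intros x y x' y' Hx Hy Hx' Hy'.
    refine (Rle_trans _ _ _ _ (E x y x' y' Hx Hy Hx' Hy')). right. f_equal. ring.
Qed.

Lemma f_lipschitz S : exists L, 0 <= L /\ forall a b, Rabs (f S a - f S b) <= L * Rabs (a - b).
Proof.
  apply (lipschitz_circle (fun x y => x * Q1 S x y + y * Q2 S x y)).
  apply lipschitz_plus; apply lipschitz_mult;
    solve [apply lipschitz_fst | apply lipschitz_snd | apply lipschitz_hpoly].
Qed.

Lemma continuous_of_lipschitz (h : R -> R) (L x : R) :
  (forall a b, Rabs (h a - h b) <= L * Rabs (a - b)) -> continuous h x.
Proof.
  intros H. apply filterlim_locally. intros eps.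
  pose proof (cond_pos eps) as He.
  assert (HL : 0 < Rabs L + 1) by (pose proof (Rabs_pos L); lra).
  exists (mkposreal (eps / (Rabs L + 1)) (Rdiv_lt_0_compat _ _ He HL)).
  intros y Hy. unfold ball in *; simpl in *. unfold AbsRing_ball, abs, minus, plus, opp in *; simpl in *.
  eapply Rle_lt_trans; [apply H|].
  assert (L * Rabs (y - x) <= (Rabs L + 1) * Rabs (y - x)).
  { apply Rmult_le_compat_r; [apply Rabs_pos|]. pose proof (Rle_abs L). lra. }
  assert ((Rabs L + 1) * Rabs (y - x) < (Rabs L + 1) * (eps / (Rabs L + 1))).
  { apply Rmult_lt_compat_l; auto. }
  replace ((Rabs L + 1) * (eps / (Rabs L + 1))) with (RIneq.pos eps) in * by (field; lra). lra.
Qed.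

Lemma g_continuous S th : continuous (g S) th.
Proof. destruct (g_lipschitz S) as [L [_ H]]. now apply (continuous_of_lipschitz _ L). Qed.

Lemma f_continuous S th : continuous (f S) th.
Proof. destruct (f_lipschitz S) as [L [_ H]]. now apply (continuous_of_lipschitz _ L). Qed.

(** * Uniqueness of solutions *)

Definition solves_at (S : system) (z : R -> R * R) (t : R) : Prop :=
  is_derive (fun s => fst (z s)) t (fst (vfield S (z t))) /\
  is_derive (fun s => snd (z s)) t (snd (vfield S (z t))).

Lemma bounded_on (h : R -> R) (a b : R) : a <= b ->
  (forall x, a <= x <= b -> continuous h x) ->
  exists M, forall x, a <= x <= b -> Rabs (h x) <= M.
Proof.
  intros Hab Hc. destruct (continuity_ab_maj (fun x => Rabs (h x)) a b Hab) as [m [Hm _]].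
  - intros x Hx. apply continuity_pt_filterlim.
    apply (continuous_comp h Rabs); [now apply Hc|]. apply continuous_Rabs.
  - now exists (Rabs (h m)).
Qed.

(** [h exp (C t)] increases and [h exp (- C t)] decreases, so that [h] vanishes at both
    ends or at none. *)
Lemma gronwall (h dh : R -> R) (C a b : R) : a <= b ->
  (forall t, a <= t <= b -> is_derive h t (dh t)) ->
  (forall t, a <= t <= b -> 0 <= h t /\ Rabs (dh t) <= C * h t) ->
  h a = 0 \/ h b = 0 -> h a = 0 /\ h b = 0.
Proof.
  intros Hab Hd Hb.
  assert (H1 : - (h a * exp (- C * a)) <= - (h b * exp (- C * b))).
  { apply (nondecreasing_of_derive (fun t => - (h t * exp (- C * t)))
       (fun t => (C * h t - dh t) * exp (- C * t)) _ _ Hab).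
    - intros t Ht. pose proof (Hd t Ht). auto_derive.
      + now exists (dh t).
      + replace (Derive (fun x => h x) t) with (dh t) by (symmetry; apply is_derive_unique; exact H). ring.
    - intros t Ht. destruct (Hb t Ht) as [_ H]. apply Rmult_le_pos; [|left; apply exp_pos].
      apply Rabs_le_between in H. lra. }
  assert (H2 : h a * exp (C * a) <= h b * exp (C * b)).
  { apply (nondecreasing_of_derive (fun t => h t * exp (C * t))
       (fun t => (C * h t + dh t) * exp (C * t)) _ _ Hab).
    - intros t Ht. pose proof (Hd t Ht). auto_derive.
      + now exists (dh t).
      + replace (Derive (fun x => h x) t) with (dh t) by (symmetry; apply is_derive_unique; exact H). ring.
    - intros t Ht. destruct (Hb t Ht) as [_ H]. apply Rmult_le_pos; [|left; apply exp_pos].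
      apply Rabs_le_between in H. lra. }
  destruct (Hb a ltac:(lra)) as [Ha _]. destruct (Hb b ltac:(lra)) as [Hb' _].
  pose proof (exp_pos (- C * a)). pose proof (exp_pos (- C * b)).
  pose proof (exp_pos (C * a)). pose proof (exp_pos (C * b)).
  intros [E|E]; split; auto; rewrite E in *; nra.
Qed.

Lemma pair_eq_of_squares (u v : R * R) :
  (fst u - fst v) ^ 2 + (snd u - snd v) ^ 2 = 0 <-> u = v.
Proof.
  destruct u as [x y], v as [x' y']; simpl. split.
  - intros H. pose proof (pow2_ge_0 (x - x')). pose proof (pow2_ge_0 (y - y')).
    assert (x - x' = 0) by (apply Rsqr_0_uniq; unfold Rsqr; nra).
    assert (y - y' = 0) by (apply Rsqr_0_uniq; unfold Rsqr; nra). f_equal; lra.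
  - intros E. injection E as -> ->. ring.
Qed.

(** Gronwall's inequality for the squared distance of the two curves. *)
Lemma solves_at_unique S (z1 z2 : R -> R * R) (a b : R) : a <= b ->
  (forall t, a <= t <= b -> solves_at S z1 t /\ solves_at S z2 t) ->
  z1 a = z2 a \/ z1 b = z2 b -> z1 a = z2 a /\ z1 b = z2 b.
Proof.
  intros Hab Hs.
  assert (Hbd : exists M, forall t, a <= t <= b ->
    (Rabs (fst (z1 t)) <= M /\ Rabs (snd (z1 t)) <= M) /\
    (Rabs (fst (z2 t)) <= M /\ Rabs (snd (z2 t)) <= M)).
  { assert (W : forall h : R -> R, (forall t, a <= t <= b -> ex_derive h t) ->
       exists M, forall t, a <= t <= b -> Rabs (h t) <= M).
    { intros h Hh. apply bounded_on; [exact Hab|]. intros t Ht. apply (ex_derive_continuous h); auto. }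
    destruct (W (fun t => fst (z1 t))) as [M1 H1].
    { intros t Ht. eexists. exact (proj1 (proj1 (Hs t Ht))). }
    destruct (W (fun t => snd (z1 t))) as [M2 H2].
    { intros t Ht. eexists. exact (proj2 (proj1 (Hs t Ht))). }
    destruct (W (fun t => fst (z2 t))) as [M3 H3].
    { intros t Ht. eexists. exact (proj1 (proj2 (Hs t Ht))). }
    destruct (W (fun t => snd (z2 t))) as [M4 H4].
    { intros t Ht. eexists. exact (proj2 (proj2 (Hs t Ht))). }
    exists (Rmax (Rmax M1 M2) (Rmax M3 M4)). intros t Ht.
    specialize (H1 t Ht). specialize (H2 t Ht). specialize (H3 t Ht). specialize (H4 t Ht).
    simpl in *.
    pose proof (Rmax_l (Rmax M1 M2) (Rmax M3 M4)). pose proof (Rmax_r (Rmax M1 M2) (Rmax M3 M4)).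
    pose proof (Rmax_l M1 M2). pose proof (Rmax_r M1 M2).
    pose proof (Rmax_l M3 M4). pose proof (Rmax_r M3 M4). repeat split; lra. }
  destruct Hbd as [M HM].
  destruct (lipschitz_vfield S) as [HL1 HL2].
  destruct (HL1 M) as [L1 [P1 E1]]. destruct (HL2 M) as [L2 [P2 E2]].
  set (h := fun t => (fst (z1 t) - fst (z2 t)) ^ 2 + (snd (z1 t) - snd (z2 t)) ^ 2).
  set (dh := fun t =>
     2 * (fst (z1 t) - fst (z2 t)) * (fst (vfield S (z1 t)) - fst (vfield S (z2 t))) +
     2 * (snd (z1 t) - snd (z2 t)) * (snd (vfield S (z1 t)) - snd (vfield S (z2 t)))).
  assert (G : h a = 0 \/ h b = 0 -> h a = 0 /\ h b = 0).
  { apply (gronwall h dh (4 * (L1 + L2)) a b Hab).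
    - intros t Ht. destruct (Hs t Ht) as [[D1 D2] [D3 D4]]. unfold h, dh.
      evar_last.
      + apply (is_derive_plus (fun t => (fst (z1 t) - fst (z2 t)) ^ 2)
                              (fun t => (snd (z1 t) - snd (z2 t)) ^ 2)).
        * apply (is_derive_pow (fun t => fst (z1 t) - fst (z2 t)) 2).
          apply (is_derive_minus (fun t => fst (z1 t)) (fun t => fst (z2 t))); eassumption.
        * apply (is_derive_pow (fun t => snd (z1 t) - snd (z2 t)) 2).
          apply (is_derive_minus (fun t => snd (z1 t)) (fun t => snd (z2 t))); eassumption.
      + unfold plus, minus, plus, opp; simpl. unfold minus, plus, opp; simpl. ring.
    - intros t Ht. destruct (HM t Ht) as [[B1 B2] [B3 B4]].
      specialize (E1 _ _ _ _ B1 B2 B3 B4). specialize (E2 _ _ _ _ B1 B2 B3 B4).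
      rewrite <- !surjective_pairing in E1, E2. unfold h, dh.
      set (x := fst (z1 t) - fst (z2 t)) in *. set (y := snd (z1 t) - snd (z2 t)) in *.
      set (X := fst (vfield S (z1 t)) - fst (vfield S (z2 t))) in *.
      set (Y := snd (vfield S (z1 t)) - snd (vfield S (z2 t))) in *.
      assert (Hxy : (Rabs x + Rabs y) * (Rabs x + Rabs y) <= 2 * (x ^ 2 + y ^ 2)).
      { rewrite <- (pow2_abs x), <- (pow2_abs y).
        pose proof (pow2_ge_0 (Rabs x - Rabs y)). nra. }
      pose proof (Rabs_pos x). pose proof (Rabs_pos y).
      split; [nra|].
      eapply Rle_trans; [apply Rabs_triang|]. rewrite !Rabs_mult, !(Rabs_right 2) by lra.
      assert (A1 : Rabs x * Rabs X <= (Rabs x + Rabs y) * (L1 * (Rabs x + Rabs y))).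
      { apply Rmult_le_compat; auto using Rabs_pos. lra. }
      assert (A2 : Rabs y * Rabs Y <= (Rabs x + Rabs y) * (L2 * (Rabs x + Rabs y))).
      { apply Rmult_le_compat; auto using Rabs_pos. lra. }
      nra. }
  unfold h in G. rewrite !pair_eq_of_squares in G. exact G.
Qed.

(** * Time reversal *)

Definition reversed (S : system) : system :=
  System (- lam S) (deg S) (fun k => - coef1 S k) (fun k => - coef2 S k).

Definition reversed_curve (T : curve) : curve :=
  Curve (fun t => pos T (- t)) (Rbar_opp (tmax T)) (Rbar_opp (tmin T)).

Lemma neg_neg S : reversed (reversed S) = S.
Proof.
  destruct S as [l n c1 c2]. unfold reversed; simpl. rewrite Ropp_involutive. f_equal;
  apply functional_extensionality; intros k; apply Ropp_involutive.
Qed.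

Lemma rev_rev T : reversed_curve (reversed_curve T) = T.
Proof.
  destruct T as [p a b]. unfold reversed_curve; simpl. rewrite !Rbar_opp_involutive. f_equal.
  apply functional_extensionality; intros t. now rewrite Ropp_involutive.
Qed.

Lemma hpoly_neg n c x y : hpoly n (fun k => - c k) x y = - hpoly n c x y.
Proof.
  unfold hpoly. set (s := sum_f_R0 (fun k => c k * _ * _) n). replace (- s) with (-1 * s) by ring. unfold s. rewrite scal_sum. apply sum_eq. intros; ring.
Qed.

Lemma vfield_neg S z : vfield (reversed S) z = (- fst (vfield S z), - snd (vfield S z)).
Proof. unfold vfield, Q1, Q2; simpl. rewrite !hpoly_neg. f_equal; ring. Qed.

Lemma g_neg S th : g (reversed S) th = - g S th.
Proof. unfold g, Q1, Q2; simpl. rewrite !hpoly_neg. ring. Qed.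

Lemma f_neg S th : f (reversed S) th = - f S th.
Proof. unfold f, Q1, Q2; simpl. rewrite !hpoly_neg. ring. Qed.

Lemma Rbar_opp_lt_l x (t : R) : Rbar_lt (Rbar_opp x) t <-> Rbar_lt (- t) x.
Proof. destruct x; simpl; try tauto. split; intros; lra. Qed.

Lemma Rbar_opp_lt_r x (t : R) : Rbar_lt t (Rbar_opp x) <-> Rbar_lt x (- t).
Proof. destruct x; simpl; try tauto. split; intros; lra. Qed.

Lemma time_rev T t : time (reversed_curve T) t <-> time T (- t).
Proof. unfold time. change (tmin (reversed_curve T)) with (Rbar_opp (tmax T)). change (tmax (reversed_curve T)) with (Rbar_opp (tmin T)). rewrite Rbar_opp_lt_l, Rbar_opp_lt_r. tauto. Qed.

Lemma is_derive_rev (h : R -> R) (t l : R) :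
  is_derive h (- t) l -> is_derive (fun s => h (- s)) t (- l).
Proof.
  intros H. eapply is_derive_eq.
  - apply (is_derive_comp h Ropp); [exact H|]. exact (is_derive_opp (fun x : R => x) t 1 (is_derive_id t)).
  - unfold scal, opp, one; simpl. unfold mult; simpl. ring.
Qed.

Lemma solves_at_rev S z t : solves_at S z (- t) -> solves_at (reversed S) (fun s => z (- s)) t.
Proof.
  intros [H1 H2]. unfold solves_at. rewrite vfield_neg. simpl.
  split; [now apply (is_derive_rev (fun s => fst (z s)))|now apply (is_derive_rev (fun s => snd (z s)))].
Qed.

Lemma solution_rev S T : solution S T -> solution (reversed S) (reversed_curve T).
Proof.
  intros [Hlt H]. split.
  - simpl. now apply Rbar_opp_lt.
  - intros t Ht. apply (solves_at_rev S (pos T)). apply H. now apply time_rev.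
Qed.

Lemma trajectory_rev S T : trajectory S T -> trajectory (reversed S) (reversed_curve T).
Proof.
  intros [Hs Hm]. split; [now apply solution_rev|].
  intros T' Hs' H1 H2 Heq.
  apply solution_rev in Hs'. rewrite neg_neg in Hs'.
  destruct (Hm (reversed_curve T') Hs') as [E1 E2].
  - simpl. rewrite <- (Rbar_opp_involutive (tmin T)). now apply Rbar_opp_le.
  - simpl. rewrite <- (Rbar_opp_involutive (tmax T)). now apply Rbar_opp_le.
  - intros t Ht. simpl. rewrite (Heq (- t)).
    + simpl. now rewrite Ropp_involutive.
    + apply time_rev. now rewrite Ropp_involutive.
  - simpl in *. rewrite <- E1, <- E2, !Rbar_opp_involutive. split; reflexivity.
Qed.

(** * Trajectories are determined by one of their points *)

Lemma time_convex T a b t : time T a -> time T b -> a <= t <= b -> time T t.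
Proof.
  intros [Ha _] [_ Hb] Ht. split.
  - eapply Rbar_lt_le_trans; [exact Ha|]. simpl. lra.
  - eapply Rbar_le_lt_trans; [|exact Hb]. simpl. lra.
Qed.

Lemma solution_unique S T T' t0 t : solution S T -> solution S T' ->
  time T t0 -> time T' t0 -> pos T t0 = pos T' t0 ->
  time T t -> time T' t -> pos T t = pos T' t.
Proof.
  intros [_ Hs] [_ Hs'] H0 H0' E Ht Ht'.
  destruct (Rle_dec t0 t) as [Hle|Hle].
  - apply (solves_at_unique S (pos T) (pos T') t0 t Hle); auto.
    intros u Hu. split; [apply Hs; now apply (time_convex T t0 t)|apply Hs'; now apply (time_convex T' t0 t)].
  - apply (solves_at_unique S (pos T) (pos T') t t0 ltac:(lra)); auto.
    intros u Hu. split; [apply Hs; now apply (time_convex T t t0)|apply Hs'; now apply (time_convex T' t t0)].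
Qed.

Lemma locally_lt_Rbar (b : Rbar) (t : R) : Rbar_lt t b -> locally t (fun u : R => Rbar_lt u b).
Proof. intros H. apply (open_Rbar_lt b t H). Qed.

Lemma locally_gt_Rbar (a : Rbar) (t : R) : Rbar_lt a t -> locally t (fun u : R => Rbar_lt a u).
Proof. intros H. apply (open_Rbar_gt a t H). Qed.

Lemma solves_at_ext S z z' t :
  locally t (fun u => z u = z' u) -> solves_at S z t -> solves_at S z' t.
Proof.
  intros Hl [H1 H2]. unfold solves_at. rewrite <- (locally_singleton _ _ Hl). split.
  - eapply is_derive_ext_loc; [|exact H1]. revert Hl. apply filter_imp. now intros u ->.
  - eapply is_derive_ext_loc; [|exact H2]. revert Hl. apply filter_imp. now intros u ->.
Qed.

Lemma trajectory_last_le S T T' t0 : trajectory S T -> trajectory S T' ->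
  time T t0 -> time T' t0 -> pos T t0 = pos T' t0 -> Rbar_le (tmax T') (tmax T).
Proof.
  intros [Hs Hm] [Hs' _] H0 H0' E. apply Rbar_not_lt_le. intros Hlt.
  (* otherwise [T] could be continued along [T'] *)
  set (G := Curve (fun t => if Rbar_lt_dec t (tmax T) then pos T t else pos T' t)
                  (tmin T) (tmax T')).
  assert (HG : solution S G).
  { split; [simpl; eapply Rbar_lt_trans; [apply Hs|exact Hlt]|].
    intros t [Ht1 Ht2]. simpl in Ht1, Ht2. fold (solves_at S (pos G) t).
    destruct (Rbar_lt_dec t (tmax T)) as [Ht|Ht].
    - apply (solves_at_ext S (pos T)); [|apply Hs; now split].
      generalize (locally_lt_Rbar _ _ Ht). apply filter_imp. intros u Hu. simpl.
      destruct (Rbar_lt_dec u (tmax T)); [reflexivity|contradiction].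
    - assert (Ht0 : t0 < t).
      { apply Rbar_not_lt_le in Ht. destruct H0 as [_ H0].
        exact (Rbar_lt_le_trans t0 (tmax T) t H0 Ht). }
      apply (solves_at_ext S (pos T')).
      + generalize (filter_and _ _ (locally_gt_Rbar t0 t Ht0) (locally_lt_Rbar _ _ Ht2)).
        apply filter_imp. intros u [Hu1 Hu2]. simpl in *.
        destruct (Rbar_lt_dec u (tmax T)); [|reflexivity].
        symmetry. apply (solution_unique S T T' t0); auto.
        * split; [|assumption]. destruct H0 as [H0 _]. exact (Rbar_lt_trans _ t0 u H0 Hu1).
        * split; [|assumption]. destruct H0' as [H0' _]. exact (Rbar_lt_trans _ t0 u H0' Hu1).
      + apply Hs'. split; [|exact Ht2]. destruct H0' as [H0' _]. exact (Rbar_lt_trans _ t0 t H0' Ht0). }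
  destruct (Hm G HG) as [_ E2].
  - apply Rbar_le_refl.
  - simpl. now apply Rbar_lt_le.
  - intros t [_ Ht]. simpl. destruct (Rbar_lt_dec t (tmax T)); [reflexivity|contradiction].
  - simpl in E2. rewrite E2 in Hlt. now apply (Rbar_lt_not_eq _ _ Hlt).
Qed.

Lemma trajectory_first_le S T T' t0 : trajectory S T -> trajectory S T' ->
  time T t0 -> time T' t0 -> pos T t0 = pos T' t0 -> Rbar_le (tmin T) (tmin T').
Proof.
  intros HT HT' H0 H0' E.
  rewrite <- (Rbar_opp_involutive (tmin T)), <- (Rbar_opp_involutive (tmin T')).
  apply Rbar_opp_le.
  apply (trajectory_last_le (reversed S) (reversed_curve T) (reversed_curve T') (- t0)); try apply trajectory_rev; auto.
  - apply time_rev. now rewrite Ropp_involutive.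
  - apply time_rev. now rewrite Ropp_involutive.
  - simpl. now rewrite Ropp_involutive.
Qed.

Lemma trajectory_unique S T T' t0 : trajectory S T -> trajectory S T' ->
  time T t0 -> time T' t0 -> pos T t0 = pos T' t0 ->
  tmin T = tmin T' /\ tmax T = tmax T' /\ forall t, time T t -> pos T t = pos T' t.
Proof.
  intros HT HT' H0 H0' E.
  assert (E1 : tmin T = tmin T').
  { apply Rbar_le_antisym.
    - now apply (trajectory_first_le S T T' t0).
    - now apply (trajectory_first_le S T' T t0). }
  assert (E2 : tmax T = tmax T').
  { apply Rbar_le_antisym.
    - now apply (trajectory_last_le S T' T t0).
    - now apply (trajectory_last_le S T T' t0). }
  split; [exact E1|]. split; [exact E2|].
  intros t Ht. apply (solution_unique S T T' t0); auto; [apply HT|apply HT'|].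
  destruct Ht as [Ht1 Ht2]. rewrite E1 in Ht1. rewrite E2 in Ht2. now split.
Qed.

(** * A criterion for maximality *)

Definition sqnorm (z : R * R) : R := fst z ^ 2 + snd z ^ 2.

(** A solution cannot be continued beyond a time at which it is unbounded, or at which
    a nonzero solution accumulates at the equilibrium [origin]. *)
Definition escapes_at_last (T : curve) : Prop :=
  forall b : R, tmax T = b ->
    (forall M t1 : R, t1 < b -> exists t, time T t /\ t1 < t /\ M < sqnorm (pos T t)) \/
    ((forall e t1 : R, 0 < e -> t1 < b -> exists t, time T t /\ t1 < t /\ sqnorm (pos T t) < e) /\
     exists t, time T t /\ pos T t <> origin).

Lemma vfield_origin S : (1 < deg S)%nat -> vfield S origin = origin.
Proof.
  intros Hd. pose proof (vfield_polar S 0 0) as H. unfold polar in H.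
  rewrite !Rmult_0_l in H. unfold origin. rewrite H.
  rewrite pow_ne_zero by lia. f_equal; ring.
Qed.

Lemma solution_origin S T t0 t : (1 < deg S)%nat -> solution S T -> time T t0 -> time T t ->
  pos T t0 = origin -> pos T t = origin.
Proof.
  intros Hd Hs H0 Ht E.
  set (O := Curve (fun _ => origin) m_infty p_infty).
  apply (solution_unique S T O t0); auto; try (split; exact I).
  split; [exact I|]. intros u _. simpl pos. rewrite vfield_origin by exact Hd. unfold origin; simpl.
  split; apply (is_derive_const (K := R_AbsRing) (V := R_NormedModule)).
Qed.

Lemma maximal_at_last S T T' : (1 < deg S)%nat -> solution S T -> escapes_at_last T ->
  solution S T' -> Rbar_le (tmin T') (tmin T) -> Rbar_le (tmax T) (tmax T') ->
  (forall t : R, time T t -> pos T' t = pos T t) -> tmax T' = tmax T.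
Proof.
  intros Hd Hs He Hs' H1 H2 Heq. apply Rbar_le_antisym; [|exact H2].
  apply Rbar_not_lt_le. intros Hlt.
  destruct (tmax T) as [b| |] eqn:Eb; [|destruct (tmax T'); contradiction|].
  2: { destruct Hs as [Hs _]. rewrite Eb in Hs. now destruct (tmin T). }
  specialize (He b Eb).
  assert (Hb : time T' b).
  { split; [|exact Hlt]. eapply Rbar_le_lt_trans; [exact H1|]. rewrite <- Eb. apply Hs. }
  assert (Hcont : continuous (fun t => sqnorm (pos T' t)) b).
  { destruct (proj2 Hs' b Hb) as [D1 D2].
    apply (ex_derive_continuous (fun t => sqnorm (pos T' t))). unfold sqnorm.
    apply (ex_derive_plus (fun t => fst (pos T' t) ^ 2) (fun t => snd (pos T' t) ^ 2)).
    - apply (ex_derive_pow (fun t => fst (pos T' t))). eexists; exact D1.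
    - apply (ex_derive_pow (fun t => snd (pos T' t))). eexists; exact D2. }
  assert (Hnear : forall e, 0 < e -> exists t1, t1 < b /\
            forall t, t1 < t -> time T t -> Rabs (sqnorm (pos T t) - sqnorm (pos T' b)) < e).
  { intros e He'.
    destruct (proj1 (filterlim_locally _ _) Hcont (mkposreal e He')) as [d Hdd].
    exists (b - d). pose proof (cond_pos d). split; [lra|].
    intros t Ht HTt. rewrite <- (Heq t HTt). apply Hdd.
    destruct HTt as [_ HTt]. rewrite Eb in HTt. simpl in HTt.
    unfold ball; simpl. unfold AbsRing_ball, abs, minus, plus, opp; simpl. apply Rabs_def1; lra. }
  destruct He as [He|[He [t [Ht Hne]]]].
  - destruct (Hnear 1 ltac:(lra)) as [t1 [Ht1 Hn]].
    destruct (He (sqnorm (pos T' b) + 1) t1 Ht1) as [t [Ht [Hlt1 HM]]].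
    specialize (Hn t Hlt1 Ht). apply Rabs_def2 in Hn. lra.
  - apply Hne. rewrite <- Heq by exact Ht.
    assert (Hzero : pos T' b = origin).
    { apply pair_eq_of_squares. unfold origin; simpl fst; simpl snd. rewrite !Rminus_0_r.
      fold (sqnorm (pos T' b)).
      destruct (Req_dec (sqnorm (pos T' b)) 0) as [E|E]; [exact E|exfalso].
      assert (Hp : 0 < sqnorm (pos T' b)).
      { unfold sqnorm in *. pose proof (pow2_ge_0 (fst (pos T' b))).
        pose proof (pow2_ge_0 (snd (pos T' b))). lra. }
      destruct (Hnear (sqnorm (pos T' b) / 2) ltac:(lra)) as [t1 [Ht1 Hn]].
      destruct (He (sqnorm (pos T' b) / 2) t1 ltac:(lra) Ht1) as [u [Hu [Hlt1 HM]]].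
      specialize (Hn u Hlt1 Hu). apply Rabs_def2 in Hn. lra. }
    apply (solution_origin S T' b t Hd Hs' Hb); [|exact Hzero].
    destruct Ht as [Ht1 Ht2]. split.
    + eapply Rbar_le_lt_trans; [exact H1|exact Ht1].
    + eapply Rbar_lt_trans; [exact Ht2|]. rewrite Eb. exact Hlt.
Qed.

Lemma trajectory_intro S T : (1 < deg S)%nat -> solution S T ->
  escapes_at_last T -> escapes_at_last (reversed_curve T) -> trajectory S T.
Proof.
  intros Hd Hs H1 H2. split; [exact Hs|]. intros T' Hs' Hmin Hmax Heq. split.
  - assert (E : tmax (reversed_curve T') = tmax (reversed_curve T)).
    { apply (maximal_at_last (reversed S)); auto using solution_rev.
      - simpl. now apply Rbar_opp_le.
      - simpl. now apply Rbar_opp_le.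
      - intros t Ht. simpl. apply Heq. now apply time_rev. }
    simpl in E. rewrite <- (Rbar_opp_involutive (tmin T')), E. apply Rbar_opp_involutive.
  - now apply (maximal_at_last S).
Qed.

(** * Limit sets of convergent curves *)

Lemma Rbar_locally_before (b : Rbar) (a : R) (V : R -> Prop) :
  Rbar_lt a b -> Rbar_locally b V -> exists t : R, a < t /\ Rbar_lt t b /\ V t.
Proof.
  intros Hab HV. destruct b as [b| |]; simpl in *; [| |contradiction].
  - destruct HV as [d Hd]. pose proof (cond_pos d).
    exists (Rmax ((a + b) / 2) (b - d / 2)).
    pose proof (Rmax_l ((a + b) / 2) (b - d / 2)). pose proof (Rmax_r ((a + b) / 2) (b - d / 2)).
    assert (Rmax ((a + b) / 2) (b - d / 2) < b) by (apply Rmax_lub_lt; lra).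
    repeat split; [lra|lra|]. apply Hd.
    unfold ball; simpl. unfold AbsRing_ball, abs, minus, plus, opp; simpl. apply Rabs_def1; lra.
  - destruct HV as [M HM]. exists (Rmax a M + 1).
    pose proof (Rmax_l a M). pose proof (Rmax_r a M). repeat split; [lra|]. apply HM. lra.
Qed.

Lemma Rbar_locally_after (b : Rbar) (a : R) : Rbar_lt a b -> Rbar_locally b (fun t : R => a < t).
Proof.
  intros Hab. destruct b as [b| |]; simpl in *; [| |contradiction].
  - apply (open_gt a b Hab).
  - now exists a.
Qed.

Lemma separated_neighbourhoods (w w' : R * R) : w <> w' ->
  exists U U' : R * R -> Prop, locally w U /\ locally w' U' /\ forall z, U z -> U' z -> False.
Proof.
  intros Hne. apply NNPP. intros Hno. apply Hne.
  apply eq_close. intros eps.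
  apply NNPP. intros Hb. apply Hno.
  assert (He : 0 < eps / 2) by (pose proof (cond_pos eps); lra).
  exists (ball w (mkposreal _ He)), (ball w' (mkposreal _ He)).
  split; [apply locally_ball|]. split; [apply locally_ball|].
  intros z Hz Hz'. apply Hb. replace (RIneq.pos eps) with (eps / 2 + eps / 2) by lra.
  apply (ball_triangle w z w'); [exact Hz|]. now apply ball_sym.
Qed.

Lemma omega_limit_set_intro (G : curve) (w : R * R) :
  (exists t, time G t) ->
  (forall U, locally w U -> exists t1, time G t1 /\ forall t, time G t -> t1 < t -> U (pos G t)) ->
  forall w', omega_limit_set G w' <-> w' = w.
Proof.
  intros [t0 Ht0] HU w'. split.
  - intros Hw'. apply NNPP. intros Hne.
    destruct (separated_neighbourhoods w' w Hne) as [U' [U [HU' [HU1 Hsep]]]].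
    destruct (HU U HU1) as [t1 [Ht1 Hin]].
    destruct (Hw' U' (fun t => t1 < t) HU') as [t [Ht [Hlt Hz]]].
    { apply Rbar_locally_after, Ht1. }
    apply (Hsep (pos G t)); auto.
  - intros -> U V HU1 HV. destruct (HU U HU1) as [t1 [Ht1 Hin]].
    destruct (Rbar_locally_before _ t1 V (proj2 Ht1) HV) as [t [Hlt [Ht2 HVt]]].
    exists t. assert (Ht : time G t).
    { split; [|exact Ht2]. exact (Rbar_lt_trans _ t1 t (proj1 Ht1) Hlt). }
    auto.
Qed.

Lemma Rbar_locally_opp (b : Rbar) (V : R -> Prop) :
  Rbar_locally b V -> Rbar_locally (Rbar_opp b) (fun t => V (- t)).
Proof.
  destruct b as [b| |]; simpl.
  - intros [d Hd]. exists d. intros y Hy. apply Hd.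
    unfold ball in *; simpl in *. unfold AbsRing_ball, abs, minus, plus, opp in *; simpl in *.
    rewrite <- Rabs_Ropp. replace (- (- y + - b)) with (y + - - b) by ring. exact Hy.
  - intros [M HM]. exists (- M). intros x Hx. apply HM. lra.
  - intros [M HM]. exists (- M). intros x Hx. apply HM. lra.
Qed.

Lemma omega_limit_set_rev G w : omega_limit_set (reversed_curve G) w <-> alpha_limit_set G w.
Proof.
  split; intros H U V HU HV.
  - destruct (H U (fun t => V (- t)) HU) as [t [Ht [HVt HUt]]].
    { simpl. now apply Rbar_locally_opp. }
    exists (- t). repeat split; auto; now apply time_rev.
  - destruct (H U (fun t => V (- t)) HU) as [t [Ht [HVt HUt]]].
    { apply Rbar_locally_opp in HV. simpl in HV. now rewrite Rbar_opp_involutive in HV. }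
    exists (- t). split; [apply time_rev; now rewrite Ropp_involutive|].
    split; [exact HVt|]. simpl. now rewrite Ropp_involutive.
Qed.

Lemma alpha_limit_set_rev G w : alpha_limit_set (reversed_curve G) w <-> omega_limit_set G w.
Proof. now rewrite <- omega_limit_set_rev, rev_rev. Qed.

Lemma omega_is_rev T w : omega_is (reversed_curve T) w <-> alpha_is T w.
Proof.
  unfold omega_is, alpha_is. change (to_disk (reversed_curve T)) with (reversed_curve (to_disk T)).
  split; intros H w'; specialize (H w'); rewrite omega_limit_set_rev in *; exact H.
Qed.

Lemma alpha_is_rev T w : alpha_is (reversed_curve T) w <-> omega_is T w.
Proof. now rewrite <- omega_is_rev, rev_rev. Qed.

Lemma alpha_limit_set_intro (G : curve) (w : R * R) :
  (exists t, time G t) ->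
  (forall U, locally w U -> exists t1, time G t1 /\ forall t, time G t -> t < t1 -> U (pos G t)) ->
  forall w', alpha_limit_set G w' <-> w' = w.
Proof.
  intros [t0 Ht0] HU w'. rewrite <- omega_limit_set_rev. revert w'.
  apply omega_limit_set_intro.
  - exists (- t0). apply time_rev. now rewrite Ropp_involutive.
  - intros U HU1. destruct (HU U HU1) as [t1 [Ht1 Hin]]. exists (- t1).
    split; [apply time_rev; now rewrite Ropp_involutive|].
    intros t Ht Hlt. simpl. apply Hin; [now apply time_rev|lra].
Qed.

(** * Neighbourhoods in the disk *)

(** The radius in the disk of a point at distance [r] from the origin. *)
Definition shrink (r : R) : R := r / sqrt (1 + r ^ 2).

Lemma poincare_polar r th : poincare (polar r th) = polar (shrink r) th.
Proof.
  unfold poincare, polar, shrink; simpl fst; simpl snd.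
  replace (1 + (r * cos th) ^ 2 + (r * sin th) ^ 2) with (1 + r ^ 2).
  - f_equal; unfold Rdiv; ring.
  - pose proof (sin2_cos2 th) as H. unfold Rsqr in H. nra.
Qed.

Lemma sqrt_gt r : 0 <= r -> r < sqrt (1 + r ^ 2) <= r + 1 /\ 1 <= sqrt (1 + r ^ 2).
Proof.
  intros Hr. split; [split|].
  - rewrite <- (sqrt_pow2 r) at 1 by exact Hr. apply sqrt_lt_1; nra.
  - rewrite <- (sqrt_pow2 (r + 1)) by lra. apply sqrt_le_1; nra.
  - rewrite <- sqrt_1 at 1. apply sqrt_le_1; nra.
Qed.

Lemma shrink_bounds r : 0 <= r -> 0 <= shrink r < 1 /\ shrink r <= r /\ 1 - / (r + 1) <= shrink r.
Proof.
  intros Hr. destruct (sqrt_gt r Hr) as [[H1 H2] H3]. unfold shrink.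
  set (q := sqrt (1 + r ^ 2)) in *.
  assert (Hq : r / q * q = r) by (field; lra).
  repeat split.
  - apply quotient_nonneg; lra.
  - nra.
  - assert (0 <= r / q) by (apply quotient_nonneg; lra). nra.
  - replace (1 - / (r + 1)) with (r * / (r + 1)) by (field; lra).
    apply Rmult_le_compat_l; [exact Hr|]. apply Rinv_le_contravar; lra.
Qed.

Lemma shrink_pos r : 0 < r -> 0 < shrink r.
Proof. intros Hr. destruct (sqrt_gt r ltac:(lra)) as [_ H]. apply Rdiv_lt_0_compat; lra. Qed.

Lemma shrink_continuous r : continuous shrink r.
Proof.
  assert (H : 0 < 1 + r ^ 2) by nra.
  apply (ex_derive_continuous shrink). unfold shrink. auto_derive.
  pose proof (sqrt_lt_R0 _ H). simpl in H, H0. repeat split; auto; lra.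
Qed.

Lemma polar_near r0 th0 (U : R * R -> Prop) : locally (polar r0 th0) U ->
  exists e, 0 < e /\ forall r th, Rabs (r - r0) < e -> Rabs (th - th0) < e -> U (polar r th).
Proof.
  intros [d Hd]. pose proof (cond_pos d) as Hd0. pose proof (Rabs_pos r0).
  exists (d / (1 + Rabs r0) / 2).
  assert (He : 0 < d / (1 + Rabs r0) / 2) by (repeat apply Rdiv_lt_0_compat; lra).
  split; [exact He|]. intros r th Hr Ht. apply Hd.
  assert (Hsum : (1 + Rabs r0) * (d / (1 + Rabs r0) / 2) = d / 2) by (field; lra).
  set (e := d / (1 + Rabs r0) / 2) in *.
  assert (W : forall u v, Rabs u <= 1 -> Rabs (u - v) <= Rabs (th - th0) ->
            Rabs (r * u - r0 * v) < d).
  { intros u v Hu Huv.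
    replace (r * u - r0 * v) with ((r - r0) * u + r0 * (u - v)) by ring.
    eapply Rle_lt_trans; [apply Rabs_triang|]. rewrite !Rabs_mult.
    pose proof (Rabs_pos (r - r0)). pose proof (Rabs_pos u). pose proof (Rabs_pos (u - v)).
    assert (Rabs (r - r0) * Rabs u <= e) by nra.
    assert (Rabs r0 * Rabs (u - v) <= Rabs r0 * e) by nra. lra. }
  destruct (cos_sin_abs th), (sin_cos_lipschitz th th0).
  split; unfold ball; simpl; unfold AbsRing_ball, abs, minus, plus, opp; simpl; now apply W.
Qed.

Section DiskNear.
Variable S : system.
Hypothesis Hdeg : (1 < deg S)%nat.

Lemma root_continuous w : 0 < w -> continuous (root S) w.
Proof. intros Hw. apply (ex_derive_continuous (root S)). eexists. now apply root_derive. Qed.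

Lemma near_finite w0 th0 U : 0 < w0 -> locally (poincare (polar (root S w0) th0)) U ->
  exists e, 0 < e /\ forall w th, Rabs (w - w0) < e -> Rabs (th - th0) < e ->
    U (poincare (polar (root S w) th)).
Proof.
  intros Hw HU. rewrite poincare_polar in HU.
  destruct (polar_near _ _ _ HU) as [e1 [He1 H1]].
  destruct (near_point (fun w => shrink (root S w)) w0 e1) as [d [Hd H2]]; auto.
  { apply (continuous_comp (root S) shrink); [now apply root_continuous|apply shrink_continuous]. }
  exists (Rmin d e1). split; [now apply Rmin_pos|].
  pose proof (Rmin_l d e1). pose proof (Rmin_r d e1).
  intros w th Hw' Ht. rewrite poincare_polar. apply H1; [apply H2; lra|lra].
Qed.

Lemma near_infinity th0 U : locally (infinity th0) U ->
  exists e M, 0 < e /\ 0 < M /\ forall w th, M <= w -> Rabs (th - th0) < e ->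
    U (poincare (polar (root S w) th)).
Proof.
  intros HU. destruct (polar_near _ _ _ HU) as [e [He H1]].
  exists e, ((/ e) ^ (deg S - 1)).
  pose proof (Rinv_0_lt_compat e He).
  assert (HM : 0 < (/ e) ^ (deg S - 1)) by now apply pow_lt.
  split; [exact He|]. split; [exact HM|].
  intros w th Hw Ht. rewrite poincare_polar. apply H1; [|exact Ht].
  assert (Hr : / e <= root S w).
  { rewrite <- (root_of_pow S (/ e)) by auto. now apply root_le. }
  destruct (shrink_bounds (root S w)) as [[_ H2] [_ H3]]; [lra|].
  assert (Hinv : / (root S w + 1) < e).
  { rewrite <- (Rinv_inv e). apply Rinv_lt_contravar; nra. }
  apply Rabs_def1; lra.
Qed.

Lemma near_origin U : locally (poincare origin) U ->
  exists e, 0 < e /\ forall w th, 0 < w < e -> U (poincare (polar (root S w) th)).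
Proof.
  intros HU. replace (poincare origin) with (polar 0 0) in HU.
  2: { unfold polar, poincare, origin; simpl fst; simpl snd. f_equal; unfold Rdiv; ring. }
  destruct HU as [d Hd]. pose proof (cond_pos d).
  exists (d ^ (deg S - 1)). split; [now apply pow_lt|].
  intros w th [Hw Hwd]. rewrite poincare_polar. apply Hd.
  assert (Hr : root S w < d) by (rewrite <- (root_of_pow S d) by auto; now apply root_increasing).
  pose proof (root_pos S w).
  destruct (shrink_bounds (root S w)) as [[H1 _] [H2 _]]; [lra|].
  destruct (cos_sin_abs th) as [Hc Hs].
  assert (W : forall u v, Rabs u <= 1 -> Rabs (shrink (root S w) * u - 0 * v) < d).
  { intros u v Hu. rewrite Rmult_0_l, Rminus_0_r, Rabs_mult, (Rabs_right (shrink _)) by lra.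
    pose proof (Rabs_pos u). nra. }
  split; unfold ball; simpl; unfold AbsRing_ball, abs, minus, plus, opp; simpl; now apply W.
Qed.
End DiskNear.

(** For [lam > 0] and [f < 0] this is the equilibrium on the radius, where the radial
    growth rate [lam + f w] vanishes. *)
Definition radial_point (S : system) (th : R) : R * R := polar (root S (- lam S / f S th)) th.

(** * Trajectories along leaves *)

(** The coefficient of the linear equation over a flow [th] at infinity. Both the flow
    along an arc and the constant flow at a zero of [g] are used: the latter describes
    the invariant radius. *)
Definition radial_rate (S : system) (th : R -> R) (s : R) : R := f S (th s).
Definition leaf_of (S : system) (th : R -> R) : R -> R -> R :=
  leaf (rate S) (lam S) (radial_rate S th).
Definition height_of (S : system) (th : R -> R) : R -> R :=
  height (rate S) (lam S) (radial_rate S th).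
Definition lowest_leaf_of (S : system) (th : R -> R) : R -> Prop :=
  lowest_leaf (rate S) (lam S) (radial_rate S th).

(** [sg] is the time at infinity that elapses along [T]. *)
Definition parametrizes (S : system) (th : R -> R) (c : R) (T : curve) (sg : R -> R) : Prop :=
  (forall t, time T t ->
     0 < leaf_of S th c (sg t) /\ pos T t = chart S th (sg t) (leaf_of S th c (sg t))) /\
  (forall t t', time T t -> time T t' -> t < t' -> sg t < sg t') /\
  (forall s, 0 < leaf_of S th c s -> exists t, time T t /\ sg t = s).

Definition follows (S : system) (th : R -> R) (c : R) (T : curve) : Prop :=
  trajectory S T /\ exists sg : R -> R, parametrizes S th c T sg.

Definition on_leaf (S : system) (th : R -> R) (c : R) (z : R * R) : Prop :=
  exists s, 0 < leaf_of S th c s /\ z = chart S th s (leaf_of S th c s).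

Lemma sqnorm_polar r th : sqnorm (polar r th) = r ^ 2.
Proof.
  unfold sqnorm, polar; simpl fst; simpl snd.
  pose proof (sin2_cos2 th) as H. unfold Rsqr in H. nra.
Qed.

Section Leaves.
Variables (S : system) (th : R -> R).
Hypothesis Hdeg : (1 < deg S)%nat.
Hypothesis Hlam : 0 < lam S.
Hypothesis Hth : trajectory_at_infinity S th.

Lemma flow_continuous s : continuous th s.
Proof. apply (ex_derive_continuous th). eexists. apply Hth. Qed.

Lemma radial_rate_continuous s : continuous (radial_rate S th) s.
Proof. apply (continuous_comp th (f S)); [apply flow_continuous|apply f_continuous]. Qed.

Lemma leaf_of_derive c s :
  is_derive (leaf_of S th c) s (rate S * (lam S + f S (th s) * leaf_of S th c s)).
Proof. apply leaf_derive. apply radial_rate_continuous. Qed.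

Lemma leaf_of_continuous c s : continuous (leaf_of S th c) s.
Proof. apply (ex_derive_continuous (leaf_of S th c)). eexists. apply leaf_of_derive. Qed.

Lemma leaf_of_pos c s : 0 < leaf_of S th c s <-> 0 < c + height_of S th s.
Proof. apply leaf_pos. Qed.

Lemma leaf_of_pos_after c s s' : 0 < leaf_of S th c s -> s <= s' -> 0 < leaf_of S th c s'.
Proof. apply leaf_pos_after; auto using rate_pos, radial_rate_continuous. Qed.

(** Such a leaf vanishes at the time at which it becomes positive. *)
Lemma leaf_of_small c s0 w0 : 0 < leaf_of S th c s0 -> 0 < w0 ->
  (exists s, leaf_of S th c s <= 0) ->
  exists s, s < s0 /\ 0 < leaf_of S th c s < w0.
Proof.
  intros H0 Hw [s1 H1].
  assert (Hlt : s1 <= s0).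
  { apply Rnot_lt_le. intros Hlt. pose proof (leaf_of_pos_after c s0 s1 H0 ltac:(lra)). lra. }
  set (y := Rmin w0 (leaf_of S th c s0) / 2).
  pose proof (Rmin_l w0 (leaf_of S th c s0)). pose proof (Rmin_r w0 (leaf_of S th c s0)).
  assert (Hy : 0 < Rmin w0 (leaf_of S th c s0)) by (apply Rmin_pos; auto).
  destruct (intermediate_value (leaf_of S th c) s1 s0 y Hlt) as [s [Hs E]].
  - intros; apply leaf_of_continuous.
  - unfold y. lra.
  - exists s. rewrite E. unfold y. split; [|lra].
    destruct Hs as [_ [Hs|Hs]]; [exact Hs|]. exfalso. subst s. unfold y in E. lra.
Qed.

Lemma sqnorm_chart s w : sqnorm (chart S th s w) = root S w ^ 2.
Proof. apply sqnorm_polar. Qed.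

Lemma root_bounded w M : 0 < w -> root S w ^ 2 <= M -> w <= (M + 1) ^ (deg S - 1).
Proof.
  intros Hw HM. rewrite <- (root_pow S w Hdeg Hw) at 1.
  pose proof (root_pos S w). apply pow_incr. split; [lra|]. nra.
Qed.

(** Radius bounds give speed bounds for [sg], so that it remains bounded in finite time
    if the trajectory does. But [sg] takes arbitrarily large values. *)
Lemma leaf_escapes_last c T sg t0 : parametrizes S th c T sg -> time T t0 ->
  (forall t, time T t -> is_derive sg t (leaf_of S th c (sg t))) -> escapes_at_last T.
Proof.
  intros [Hsg [Hinc Honto]] Ht0 Hd b Hb. left. intros M u Hu. apply NNPP. intros Hno.
  assert (Htb : forall t, time T t -> t < b).
  { intros t [_ Ht]. rewrite Hb in Ht. exact Ht. }
  pose proof (Htb t0 Ht0). set (v := (Rmax u t0 + b) / 2).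
  assert (Hv : Rmax u t0 < v < b) by (pose proof (Rmax_lub_lt u t0 b); unfold v; lra).
  pose proof (Rmax_l u t0). pose proof (Rmax_r u t0).
  assert (HTv : time T v).
  { split; [|rewrite Hb; simpl; lra]. apply (Rbar_lt_trans _ t0); [apply Ht0|simpl; lra]. }
  set (B := (M + 1) ^ (deg S - 1)).
  assert (HB : forall t, time T t -> v <= t -> leaf_of S th c (sg t) <= B).
  { intros t Ht Hvt. destruct (Hsg t Ht) as [Hp E]. apply root_bounded; [exact Hp|].
    apply Rnot_lt_le. intros Hlt. apply Hno. exists t. rewrite E, sqnorm_chart.
    split; [exact Ht|]. lra. }
  assert (HB0 : 0 < B) by (specialize (HB v HTv (Rle_refl _)); pose proof (proj1 (Hsg v HTv)); lra).
  assert (HBv : 0 < B * (b - v)) by (apply Rmult_lt_0_compat; lra).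
  destruct (Honto (sg v + B * (b - v))) as [t [Ht E]].
  { apply (leaf_of_pos_after c (sg v)); [now apply Hsg|lra]. }
  assert (Hvt : v < t).
  { apply Rnot_le_lt. intros [Hle|Hle]; [pose proof (Hinc t v Ht HTv Hle)|subst t]; lra. }
  destruct (mean_value sg (fun x => leaf_of S th c (sg x)) v t Hvt) as [x [Hx Heq]].
  { intros x Hx. now apply Hd, (time_convex T v t). }
  specialize (HB x (time_convex T v t x HTv Ht Hx) ltac:(lra)).
  specialize (Htb t Ht). rewrite E in Heq. nra.
Qed.

(** Backwards in time, either the same argument applies or the leaf ends at [origin]. *)
Lemma leaf_escapes_first c T sg t0 : parametrizes S th c T sg -> time T t0 ->
  (forall t, time T t -> is_derive sg t (leaf_of S th c (sg t))) ->
  escapes_at_last (reversed_curve T).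
Proof.
  intros [Hsg [Hinc Honto]] Ht0 Hd b Hb. simpl in Hb.
  assert (Eb : tmin T = - b) by (rewrite <- (Rbar_opp_involutive (tmin T)), Hb; reflexivity).
  assert (Htb : forall t, time T t -> - b < t).
  { intros t [Ht _]. rewrite Eb in Ht. exact Ht. }
  assert (Hrev : forall t, time T t -> time (reversed_curve T) (- t) /\ pos (reversed_curve T) (- t) = pos T t).
  { intros t Ht. split; [apply time_rev|simpl]; now rewrite Ropp_involutive. }
  pose proof (Htb t0 Ht0).
  assert (Hearly : forall u, u < b -> exists v, time T v /\ v < - u).
  { intros u Hu. exists ((Rmin (- u) t0 - b) / 2).
    pose proof (Rmin_l (- u) t0). pose proof (Rmin_r (- u) t0). pose proof (Rmin_glb_lt (- u) t0 (- b)).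
    split; [|lra]. split; [rewrite Eb; simpl; lra|].
    apply (Rbar_le_lt_trans _ t0); [simpl; lra|apply Ht0]. }
  destruct (classic (exists s, leaf_of S th c s <= 0)) as [Hneg|Hneg]; [right; split|left].
  - intros e u He Hu. destruct (Hearly u Hu) as [v [Hv Hvu]].
    set (q := Rmin e 1 / 2).
    assert (Hq : 0 < Rmin e 1) by (apply Rmin_pos; lra).
    pose proof (Rmin_l e 1). pose proof (Rmin_r e 1).
    assert (Hqp : 0 < q ^ (deg S - 1)) by (apply pow_lt; unfold q; lra).
    destruct (leaf_of_small c (sg v) (q ^ (deg S - 1)) (proj1 (Hsg v Hv)) Hqp Hneg) as [s [Hs Hws]].
    destruct (Honto s (proj1 Hws)) as [t [Ht E]]. destruct (Hrev t Ht) as [Hr1 Hr2].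
    exists (- t). split; [exact Hr1|]. split.
    + assert (t < v); [|lra].
      apply Rnot_le_lt. intros [Hle|Hle]; [pose proof (Hinc v t Hv Ht Hle)|subst t]; lra.
    + rewrite Hr2, (proj2 (Hsg t Ht)), sqnorm_chart, E.
      assert (Hr : root S (leaf_of S th c s) < q).
      { rewrite <- (root_of_pow S q) by (auto; unfold q; lra). apply root_increasing; auto; apply Hws. }
      pose proof (root_pos S (leaf_of S th c s)). unfold q in *. nra.
  - destruct (Hrev t0 Ht0) as [Hr1 Hr2]. exists (- t0). split; [exact Hr1|].
    rewrite Hr2, (proj2 (Hsg t0 Ht0)). intros E. apply (f_equal sqnorm) in E.
    rewrite sqnorm_chart in E. unfold sqnorm, origin in E; simpl fst in E; simpl snd in E.
    pose proof (root_pos S (leaf_of S th c (sg t0))). nra.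
  - intros M u Hu. apply NNPP. intros Hno. destruct (Hearly u Hu) as [v [Hv Hvu]].
    set (B := (M + 1) ^ (deg S - 1)).
    assert (HB : forall t, time T t -> t <= v -> leaf_of S th c (sg t) <= B).
    { intros t Ht Hvt. destruct (Hsg t Ht) as [Hp E]. apply root_bounded; [exact Hp|].
      apply Rnot_lt_le. intros Hlt. apply Hno. destruct (Hrev t Ht) as [Hr1 Hr2].
      exists (- t). rewrite Hr2, E, sqnorm_chart. split; [exact Hr1|]. lra. }
    assert (HB0 : 0 < B) by (specialize (HB v Hv (Rle_refl _)); pose proof (proj1 (Hsg v Hv)); lra).
    pose proof (Htb v Hv).
    assert (HBv : 0 < B * (v + b)) by (apply Rmult_lt_0_compat; lra).
    destruct (Honto (sg v - B * (v + b))) as [t [Ht E]].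
    { apply Rnot_le_lt. intros Hle. apply Hneg. now exists (sg v - B * (v + b)). }
    assert (Htv : t < v).
    { apply Rnot_le_lt. intros [Hle|Hle]; [pose proof (Hinc v t Hv Ht Hle)|subst t]; lra. }
    destruct (mean_value sg (fun x => leaf_of S th c (sg x)) t v Htv) as [x [Hx Heq]].
    { intros x Hx. now apply Hd, (time_convex T t v). }
    specialize (HB x (time_convex T t v x Ht Hv Hx) ltac:(lra)).
    specialize (Htb t Ht). rewrite E in Heq. nra.
Qed.

(** A leaf is turned into a trajectory by solving the scalar equation [ds / dt = w]. *)
Lemma leaf_trajectory c s0 t0 : 0 < leaf_of S th c s0 ->
  exists T, follows S th c T /\ time T t0 /\ pos T t0 = chart S th s0 (leaf_of S th c s0).
Proof.
  intros H0. set (w := leaf_of S th c).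
  destruct (scalar_flow (fun s => 0 < w s) w s0 t0) as [t1 [t2 [sg [Ht1 [Ht2 [Hsg0 [Hsg Honto]]]]]]].
  - exact H0.
  - intros a b x Ha _ Hx. apply (leaf_of_pos_after c a x); tauto.
  - intros x Hx. destruct (near_point w x (w x) (leaf_of_continuous c x) Hx) as [d [Hd Hn]].
    exists (x - d / 2), (x + 1). split; [|split; [apply (leaf_of_pos_after c x); auto; lra|lra]].
    specialize (Hn (x - d / 2) ltac:(apply Rabs_def1; lra)). apply Rabs_def2 in Hn. lra.
  - intros x _. apply leaf_of_continuous.
  - auto.
  - set (T := Curve (fun t => chart S th (sg t) (w (sg t))) t1 t2).
    assert (HT : forall t, time T t -> 0 < w (sg t) /\ is_derive sg t (w (sg t))).
    { intros t [Hta Htb]. now apply Hsg. }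
    assert (Hpar : parametrizes S th c T sg).
    { split; [intros t Ht; split; [now apply HT|reflexivity]|]. split.
      - intros t t' Ht Ht' Hlt.
        apply (increasing_of_derive sg (fun u => w (sg u))); auto;
          intros u Hu; apply HT; now apply (time_convex T t t').
      - intros s Hs. destruct (Honto s Hs) as [t [Hta [Htb E]]]. exists t. now split. }
    assert (Hsol : solution S T).
    { split; [exact (Rbar_lt_trans _ t0 _ Ht1 Ht2)|].
      intros t Ht. destruct (HT t Ht) as [HJ Hd].
      apply (chart_derive S th sg (fun t => w (sg t)) t Hdeg HJ); [apply Hth|exact Hd|].
      eapply is_derive_eq; [apply (is_derive_comp w sg); [apply leaf_of_derive|exact Hd]|].
      unfold scal; simpl; unfold mult; simpl. unfold w. ring. }
    assert (Ht0 : time T t0) by now split.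
    exists T. split; [|split; [exact Ht0|simpl; now rewrite Hsg0]].
    split; [|now exists sg]. apply (trajectory_intro S T Hdeg Hsol).
    + apply (leaf_escapes_last c T sg t0 Hpar Ht0). intros t Ht. now apply HT.
    + apply (leaf_escapes_first c T sg t0 Hpar Ht0). intros t Ht. now apply HT.
Qed.

Lemma follows_orbit c T z : follows S th c T -> (orbit T z <-> on_leaf S th c z).
Proof.
  intros [_ [sg [Hp [_ Honto]]]]. split.
  - intros [t [Ht <-]]. destruct (Hp t Ht) as [H1 H2]. now exists (sg t).
  - intros [s [Hs ->]]. destruct (Honto s Hs) as [t [Ht <-]]. exists t. split; [exact Ht|].
    now apply Hp.
Qed.

(** Trajectories are unique, so one that meets a leaf runs along all of it. *)
Lemma follows_of_point c T t0 s0 : trajectory S T -> time T t0 -> 0 < leaf_of S th c s0 ->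
  pos T t0 = chart S th s0 (leaf_of S th c s0) -> follows S th c T.
Proof.
  intros HT Ht0 Hs0 E.
  destruct (leaf_trajectory c s0 t0 Hs0) as [T' [HF [Ht0' E']]].
  destruct (trajectory_unique S T' T t0) as [E1 [E2 E3]]; auto; [apply HF|congruence|].
  assert (Ht : forall t, time T t <-> time T' t).
  { intros t. unfold time. rewrite E1, E2. tauto. }
  destruct HF as [_ [sg [Hp [Hinc Honto]]]]. split; [exact HT|].
  exists sg. split; [|split].
  - intros t HTt. apply Ht in HTt. rewrite <- E3 by exact HTt. now apply Hp.
  - intros t t' HTt HTt'. apply Hinc; now apply Ht.
  - intros s Hs. destruct (Honto s Hs) as [t [HTt Es]]. exists t. split; [now apply Ht|exact Es].
Qed.

Lemma time_inhabited T : trajectory S T -> exists t, time T t.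
Proof.
  intros [[Hlt _] _]. unfold time. destruct (tmin T) as [a| |], (tmax T) as [b| |]; simpl in *; try tauto.
  - exists ((a + b) / 2). simpl. lra.
  - exists (a + 1). simpl. split; [lra|exact I].
  - exists (b - 1). simpl. split; [exact I|lra].
  - exists 0. tauto.
Qed.

Lemma follows_omega c T w : follows S th c T ->
  (forall U, locally w U -> exists s1, 0 < leaf_of S th c s1 /\
     forall s, s1 < s -> U (poincare (chart S th s (leaf_of S th c s)))) ->
  omega_is T w.
Proof.
  intros [HT [sg [Hp [Hinc Honto]]]] H. unfold omega_is.
  apply omega_limit_set_intro; [exact (time_inhabited T HT)|].
  intros U HU. destruct (H U HU) as [s1 [Hs1 Hs]]. destruct (Honto s1 Hs1) as [t1 [Ht1 E]].
  exists t1. split; [exact Ht1|]. intros t Ht Hlt. simpl. rewrite (proj2 (Hp t Ht)).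
  apply Hs. rewrite <- E. now apply Hinc.
Qed.

Lemma follows_alpha c T w : follows S th c T ->
  (forall U, locally w U -> exists s1, 0 < leaf_of S th c s1 /\
     forall s, s < s1 -> 0 < leaf_of S th c s -> U (poincare (chart S th s (leaf_of S th c s)))) ->
  alpha_is T w.
Proof.
  intros [HT [sg [Hp [Hinc Honto]]]] H. unfold alpha_is.
  apply alpha_limit_set_intro; [exact (time_inhabited T HT)|].
  intros U HU. destruct (H U HU) as [s1 [Hs1 Hs]]. destruct (Honto s1 Hs1) as [t1 [Ht1 E]].
  exists t1. split; [exact Ht1|]. intros t Ht Hlt. simpl. rewrite (proj2 (Hp t Ht)).
  apply Hs; [rewrite <- E; now apply Hinc|now apply Hp].
Qed.

Lemma follows_nonempty c T : follows S th c T -> exists s, 0 < leaf_of S th c s.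
Proof.
  intros [HT [sg [Hp _]]]. destruct (time_inhabited T HT) as [t Ht]. exists (sg t). now apply Hp.
Qed.

Let HF := radial_rate_continuous.
Let Hk := rate_pos S Hdeg.

Lemma radial_rate_lim x a : is_lim th x (Finite a) -> is_lim (radial_rate S th) x (f S a).
Proof. intros H. apply (is_lim_comp_continuous th (f S)); [exact H|apply f_continuous]. Qed.

Section Omega.
Variable b : R.
Hypothesis Hb : is_lim th p_infty b.

Lemma angle_near_forward e : 0 < e -> exists s1, forall s, s1 <= s -> Rabs (th s - b) < e.
Proof.
  intros He. apply is_lim_spec in Hb. destruct (Hb (mkposreal e He)) as [M HM].
  exists (M + 1). intros s Hs. apply HM. lra.
Qed.

Lemma omega_infinity c T : 0 <= f S b -> follows S th c T -> omega_is T (infinity b).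
Proof.
  intros Hf HT. apply (follows_omega c); [exact HT|]. intros U HU.
  destruct (near_infinity S Hdeg b U HU) as [e [M [He [HM Hin]]]].
  destruct (follows_nonempty c T HT) as [s0 Hs0].
  destruct (leaf_to_infinity _ _ _ Hk Hlam HF (f S b) (radial_rate_lim _ _ Hb) c s0 Hf Hs0 M) as [s2 H2].
  destruct (angle_near_forward e He) as [s3 H3].
  set (s1 := Rmax s0 (Rmax s2 s3)).
  pose proof (Rmax_l s0 (Rmax s2 s3)). pose proof (Rmax_r s0 (Rmax s2 s3)).
  pose proof (Rmax_l s2 s3). pose proof (Rmax_r s2 s3).
  exists s1. split; [apply (leaf_of_pos_after c s0); auto|].
  intros s Hs. unfold s1 in Hs. apply Hin; [apply H2; lra|apply H3; lra].
Qed.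

Lemma omega_equilibrium c T : f S b < 0 -> follows S th c T ->
  omega_is T (poincare (radial_point S b)).
Proof.
  intros Hf HT. apply (follows_omega c); [exact HT|]. intros U HU.
  destruct (near_finite S Hdeg _ b U (proj1 (equilibrium_pos _ Hlam _ Hf)) HU) as [e [He Hin]].
  destruct (follows_nonempty c T HT) as [s0 Hs0].
  destruct (leaf_to_equilibrium _ _ _ Hk Hlam HF (f S b) (radial_rate_lim _ _ Hb) c s0 Hf Hs0 (e / 2))
    as [s2 H2]; [lra|].
  destruct (angle_near_forward e He) as [s3 H3].
  set (s1 := Rmax s0 (Rmax s2 s3)).
  pose proof (Rmax_l s0 (Rmax s2 s3)). pose proof (Rmax_r s0 (Rmax s2 s3)).
  pose proof (Rmax_l s2 s3). pose proof (Rmax_r s2 s3).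
  exists s1. split; [apply (leaf_of_pos_after c s0); auto|].
  intros s Hs. unfold s1 in Hs. apply Hin; [|apply H3; lra].
  eapply Rle_lt_trans; [apply H2; lra|lra].
Qed.
End Omega.

(** Such a leaf has a zero, to the right of which it is positive and small. *)
Lemma alpha_origin c T : (exists s, leaf_of S th c s <= 0) -> follows S th c T ->
  alpha_is T (poincare origin).
Proof.
  intros [s1 Hs1] HT. apply (follows_alpha c); [exact HT|]. intros U HU.
  destruct (near_origin S Hdeg U HU) as [e [He Hin]].
  destruct (follows_nonempty c T HT) as [s0 Hs0].
  (* the zero of the leaf, below which it is not positive *)
  destruct (intermediate_value (leaf_of S th c) s1 s0 0) as [z [Hz Ez]].
  { apply Rnot_lt_le. intros Hlt.
    pose proof (leaf_of_pos_after c s0 s1 Hs0 ltac:(lra)). lra. }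
  { intros; now apply leaf_of_continuous. }
  { lra. }
  destruct (near_point (leaf_of S th c) z e) as [d [Hd Hn]]; [now apply leaf_of_continuous|exact He|].
  destruct (leaf_of_small c s0 e Hs0 He) as [s [Hs Hse]]; [now exists s1|].
  assert (Hzs : forall u, 0 < leaf_of S th c u -> z < u).
  { intros u Hu. apply Rnot_le_lt. intros Hle.
    pose proof (leaf_of_pos_after c u z Hu Hle). lra. }
  pose proof (Hzs s (proj1 Hse)) as Hzs1.
  set (v := z + Rmin (d / 2) (s - z)).
  assert (Hv : 0 < Rmin (d / 2) (s - z)) by (apply Rmin_pos; lra).
  pose proof (Rmin_l (d / 2) (s - z)). pose proof (Rmin_r (d / 2) (s - z)).
  exists v. split.
  - apply leaf_of_pos. assert (Hh : 0 = c + height_of S th z).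
    { apply Rle_antisym.
      - apply Rnot_lt_le. intros Hlt.
        assert (leaf_of S th c z <> 0); [|contradiction].
        unfold leaf_of, leaf, height_of in *. pose proof (growth_pos (rate S) (radial_rate S th) z). nra.
      - apply Rnot_lt_le. intros Hlt. apply leaf_of_pos in Hlt. lra. }
    rewrite Hh. apply Rplus_lt_compat_l. exact (height_increasing _ _ _ Hk Hlam HF z v ltac:(unfold v; lra)).
  - intros u Hu Hpu. apply Hin. split; [exact Hpu|].
    pose proof (Hzs u Hpu).
    specialize (Hn u). rewrite Ez, Rminus_0_r in Hn.
    apply Rle_lt_trans with (Rabs (leaf_of S th c u)); [apply Rle_abs|]. apply Hn.
    unfold v in Hu. apply Rabs_def1; lra.
Qed.

Section Alpha.
Variable a : R.
Hypothesis Ha : is_lim th m_infty a.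

Lemma angle_near_backward e : 0 < e -> exists s1, forall s, s <= s1 -> Rabs (th s - a) < e.
Proof.
  intros He. apply is_lim_spec in Ha. destruct (Ha (mkposreal e He)) as [M HM].
  exists (M - 1). intros s Hs. apply HM. lra.
Qed.

Lemma leaf_from_infinity_any c0 c : lowest_leaf_of S th c0 -> c0 < c \/ 0 <= f S a /\ c0 <= c ->
  forall M, exists s2, forall s, s <= s2 -> M <= leaf_of S th c s.
Proof.
  intros H0 [Hc|[Hf Hc]].
  - exact (leaf_from_infinity_strict _ _ _ Hk Hlam HF _ (radial_rate_lim _ _ Ha) c0 c H0 Hc).
  - exact (leaf_from_infinity _ _ _ Hk Hlam HF _ (radial_rate_lim _ _ Ha) c0 c Hf H0 Hc).
Qed.

Lemma alpha_infinity c0 c T : lowest_leaf_of S th c0 -> c0 < c \/ 0 <= f S a /\ c0 <= c ->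
  follows S th c T -> alpha_is T (infinity a).
Proof.
  intros H0 Hc HT. apply (follows_alpha c); [exact HT|]. intros U HU.
  destruct (near_infinity S Hdeg a U HU) as [e [M [He [HM Hin]]]].
  destruct (leaf_from_infinity_any c0 c H0 Hc M) as [s2 H2].
  destruct (angle_near_backward e He) as [s3 H3].
  exists (Rmin s2 s3). pose proof (Rmin_l s2 s3). pose proof (Rmin_r s2 s3). split.
  - specialize (H2 (Rmin s2 s3) ltac:(lra)). lra.
  - intros s Hs _. apply Hin; [apply H2; lra|apply H3; lra].
Qed.

Lemma alpha_equilibrium c0 T : lowest_leaf_of S th c0 -> f S a < 0 -> follows S th c0 T ->
  alpha_is T (poincare (radial_point S a)).
Proof.
  intros H0 Hf HT. apply (follows_alpha c0); [exact HT|]. intros U HU.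
  destruct (near_finite S Hdeg _ a U (proj1 (equilibrium_pos _ Hlam _ Hf)) HU) as [e [He Hin]].
  destruct (leaf_from_equilibrium _ _ _ Hk Hlam HF (f S a) (radial_rate_lim _ _ Ha) c0 Hf H0 (e / 2))
    as [s2 H2]; [lra|].
  destruct (angle_near_backward e He) as [s3 H3].
  exists (Rmin s2 s3). pose proof (Rmin_l s2 s3). pose proof (Rmin_r s2 s3). split.
  - apply leaf_of_pos. apply (proj1 H0).
  - intros s Hs _. apply Hin; [|apply H3; lra]. eapply Rle_lt_trans; [apply H2; lra|lra].
Qed.
End Alpha.
End Leaves.

(** * Polar coordinates *)

Lemma cos_lt_1 x : x <> 0 -> Rabs x < 2 * PI -> cos x < 1.
Proof.
  assert (W : forall y, 0 < y -> y < 2 * PI -> cos y < 1).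
  { intros y H0 H1. replace y with (2 * (y / 2)) by field. rewrite cos_2a_sin.
    pose proof (sin_gt_0 (y / 2)) as H. specialize (H ltac:(lra) ltac:(lra)). nra. }
  intros Hx Hb. destruct (Rtotal_order x 0) as [H|[H|H]]; [|contradiction|].
  - rewrite <- cos_neg. apply W; [lra|]. rewrite Rabs_left in Hb; lra.
  - apply W; [lra|]. rewrite Rabs_right in Hb; lra.
Qed.

Lemma polar_inj r r' th th' : 0 < r -> 0 < r' -> Rabs (th - th') < 2 * PI ->
  polar r th = polar r' th' -> r = r' /\ th = th'.
Proof.
  intros Hr Hr' Hth E.
  assert (Er : r = r').
  { assert (H : r ^ 2 = r' ^ 2) by (rewrite <- (sqnorm_polar r th), E; apply sqnorm_polar). nra. }
  split; [exact Er|]. subst r'. apply NNPP. intros Hne.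
  pose proof (cos_lt_1 (th - th') ltac:(lra) Hth) as Hc.
  unfold polar in E. injection E as E1 E2.
  apply Rmult_eq_reg_l in E1; [|lra]. apply Rmult_eq_reg_l in E2; [|lra].
  rewrite cos_minus, E1, E2 in Hc. pose proof (sin2_cos2 th') as H. unfold Rsqr in H. lra.
Qed.

Definition dot (x : R) (w : R * R) : R := fst w * cos x + snd w * sin x.

Lemma dot_polar x r y : dot x (polar r y) = r * cos (y - x).
Proof. unfold dot, polar; simpl. rewrite cos_minus. ring. Qed.

Lemma dot_continuous x w : continuous (dot x) w.
Proof.
  apply (continuous_plus (fun z : R * R => fst z * cos x) (fun z => snd z * sin x)).
  - apply (continuous_mult (fun z : R * R => fst z) (fun _ => cos x));
      [apply continuous_fst|apply continuous_const].
  - apply (continuous_mult (fun z : R * R => snd z) (fun _ => sin x));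
      [apply continuous_snd|apply continuous_const].
Qed.

(** In the frame turned by [th0], the angle is [atan (Y / X)] where [X] is positive. *)
Lemma polar_open r0 th0 e : 0 < r0 -> 0 < e ->
  locally (polar r0 th0)
    (fun z => exists r th, Rabs (r - r0) < e /\ Rabs (th - th0) < e /\ 0 < r /\ z = polar r th).
Proof.
  intros Hr He.
  set (X := dot th0). set (Y := dot (th0 + PI / 2)). set (z0 := polar r0 th0).
  assert (HX0 : X z0 = r0) by (unfold X, z0; rewrite dot_polar, Rminus_diag, cos_0; ring).
  assert (HY0 : Y z0 = 0).
  { unfold Y, z0. rewrite dot_polar. replace (th0 - (th0 + PI / 2)) with (- (PI / 2)) by ring.
    rewrite cos_neg, cos_PI2. ring. }
  assert (HX : continuous X z0) by apply dot_continuous.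
  assert (HY : continuous Y z0) by apply dot_continuous.
  set (N := fun z => sqrt (X z * X z + Y z * Y z)).
  set (A := fun z => atan (Y z * / X z)).
  assert (HN0 : N z0 = r0).
  { unfold N. rewrite HX0, HY0, Rmult_0_l, Rplus_0_r. apply sqrt_square. lra. }
  assert (HA0 : A z0 = 0). { unfold A. rewrite HY0, Rmult_0_l. apply atan_0. }
  assert (HN : continuous N z0).
  { apply (continuous_comp (fun z => X z * X z + Y z * Y z) sqrt).
    - apply (continuous_plus (fun z => X z * X z) (fun z => Y z * Y z));
        [now apply (continuous_mult X X)|now apply (continuous_mult Y Y)].
    - apply continuity_pt_filterlim. apply continuity_pt_sqrt. nra. }
  assert (HA : continuous A z0).
  { apply (continuous_comp (fun z => Y z * / X z) atan).
    - apply (continuous_mult Y (fun z => / X z)); [exact HY|].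
      apply (continuous_comp X Rinv); [exact HX|]. rewrite HX0.
      apply (ex_derive_continuous Rinv). auto_derive. lra.
    - apply (ex_derive_continuous atan). exists (/ (1 + (Y z0 * / X z0) ^ 2)).
      apply is_derive_Reals, derivable_pt_lim_atan. }
  pose proof (HX (fun x => 0 < x)) as LX. rewrite HX0 in LX. specialize (LX (open_gt 0 r0 Hr)).
  change (locally z0 (fun z => 0 < X z)) in LX.
  pose proof (proj1 (filterlim_locally _ _) HN (mkposreal e He)) as LN.
  pose proof (proj1 (filterlim_locally _ _) HA (mkposreal e He)) as LA.
  generalize (filter_and _ _ LX (filter_and _ _ LN LA)). apply filter_imp.
  refine (fun (z : R * R) Hz => _). destruct Hz as [H1 [H2 H3]]. rewrite HN0 in H2. rewrite HA0 in H3.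
  exists (N z), (th0 + A z). split; [exact H2|]. split.
  { replace (th0 + A z - th0) with (A z - 0) by ring. exact H3. }
  split; [apply sqrt_lt_R0; nra|].
  assert (HNp : 0 < N z) by (apply sqrt_lt_R0; nra).
  assert (Hs : sqrt (1 + (Y z * / X z)²) = N z / X z).
  { unfold N. replace (1 + (Y z * / X z)²) with ((X z * X z + Y z * Y z) / (X z * X z))
      by (unfold Rsqr; field; lra).
    rewrite sqrt_div; [|nra|nra]. rewrite (sqrt_square (X z)) by lra. reflexivity. }
  assert (Hc : N z * cos (A z) = X z) by (unfold A; rewrite cos_atan, Hs; field; lra).
  assert (Hsn : N z * sin (A z) = Y z) by (unfold A; rewrite sin_atan, Hs; field; lra).
  assert (Hrot : forall x y n c d C D : R, D * D + C * C = 1 ->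
     n * c = x * C + y * D -> n * d = x * - D + y * C ->
     n * (C * c - D * d) = x /\ n * (D * c + C * d) = y).
  { intros x y n c d C D HCD E1 E2. split.
    - replace (n * (C * c - D * d)) with (C * (n * c) - D * (n * d)) by ring.
      rewrite E1, E2. transitivity (x * (D * D + C * C)); [ring|rewrite HCD; ring].
    - replace (n * (D * c + C * d)) with (D * (n * c) + C * (n * d)) by ring.
      rewrite E1, E2. transitivity (y * (D * D + C * C)); [ring|rewrite HCD; ring]. }
  unfold Y, dot in Hsn. rewrite cos_plus, sin_plus, cos_PI2, sin_PI2 in Hsn.
  destruct (Hrot (fst z) (snd z) (N z) (cos (A z)) (sin (A z)) (cos th0) (sin th0)) as [R1 R2].
  - exact (sin2_cos2 th0).
  - exact Hc.
  - rewrite Hsn. ring.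
  - unfold polar. rewrite cos_plus, sin_plus, R1, R2. apply surjective_pairing.
Qed.

(** * Half-cones *)

Lemma between_sym a b x : between a b x -> between b a x.
Proof. unfold between. now rewrite Rmin_comm, Rmax_comm. Qed.

Lemma between_cases a b x : between a b x <-> (a < x < b \/ b < x < a).
Proof. unfold between, Rmin, Rmax. destruct (Rle_dec a b); split; intros; lra. Qed.

Lemma consecutive_sym S a b : consecutive S a b -> consecutive S b a.
Proof.
  intros [H1 [H2 [H3 H4]]]. repeat split; auto. intros x Hx. apply H4. now apply between_sym.
Qed.

Lemma cone_interior_sym a b : cone_interior a b = cone_interior b a.
Proof.
  apply functional_extensionality; intros z. apply propositional_extensionality.
  unfold cone_interior. split; intros [r [t [H1 [H2 H3]]]]; exists r, t; auto using between_sym.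
Qed.

Lemma g_opposite S th : g S th = 0 -> g S (th + PI) = 0.
Proof.
  unfold g, Q1, Q2. rewrite neg_cos, neg_sin.
  replace (- cos th) with (-1 * cos th) by ring. replace (- sin th) with (-1 * sin th) by ring.
  rewrite !hpoly_scale. intros H.
  replace (_ - _) with (- (-1) ^ deg S *
     (cos th * hpoly (deg S) (coef2 S) (cos th) (sin th) -
      sin th * hpoly (deg S) (coef1 S) (cos th) (sin th))) by ring.
  rewrite H. ring.
Qed.

(** The zeros of [g] are invariant under rotation by [PI]. *)
Lemma consecutive_width S a b : consecutive S a b -> Rabs (a - b) <= PI.
Proof.
  assert (W : forall a b, consecutive S a b -> a < b -> b - a <= PI).
  { intros x y [_ [Hx [_ Hn]]] Hlt. apply Rnot_lt_le. intros Hpi. pose proof PI_RGT_0.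
    apply (Hn (x + PI)); [apply between_cases; lra|]. now apply g_opposite. }
  intros H. destruct (Rtotal_order a b) as [Hlt|[Heq|Hlt]].
  - rewrite Rabs_left by lra. specialize (W a b H Hlt). lra.
  - destruct H as [H _]. contradiction.
  - rewrite Rabs_right by lra. specialize (W b a (consecutive_sym _ _ _ H) Hlt). lra.
Qed.

Definition connecting_arc (S : system) (a b : R) (th : R -> R) : Prop :=
  consecutive S a b /\ trajectory_at_infinity S th /\ (forall t, between a b (th t)) /\
  is_lim th m_infty a /\ is_lim th p_infty b.

(** * Levels, regions and limits *)

Lemma chart_on_leaf S th s w : 0 < w ->
  exists c, leaf_of S th c s = w /\ on_leaf S th c (chart S th s w).
Proof.
  intros Hw. set (gr := growth (rate S) (radial_rate S th) s).
  assert (Hgr : 0 < gr) by apply growth_pos.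
  assert (E : leaf_of S th (w / gr - height_of S th s) s = w).
  { unfold leaf_of, leaf, height_of. fold gr. field. lra. }
  exists (w / gr - height_of S th s). split; [exact E|].
  exists s. now rewrite E.
Qed.

Lemma leaf_of_lt S th c c' s : c < c' <-> leaf_of S th c s < leaf_of S th c' s.
Proof.
  unfold leaf_of, leaf. pose proof (growth_pos (rate S) (radial_rate S th) s). split; intros; nra.
Qed.

Lemma continuous_pair (u v : R -> R) (t : R) :
  continuous u t -> continuous v t -> continuous (fun t => (u t, v t)) t.
Proof.
  intros Hu Hv. apply filterlim_locally. intros eps.
  generalize (filter_and _ _ (proj1 (filterlim_locally _ _) Hu eps) (proj1 (filterlim_locally _ _) Hv eps)).
  apply filter_imp. intros x [H1 H2]. now split.
Qed.

Definition unit_clamp (t : R) : R := Rmax 0 (Rmin 1 t).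

Lemma unit_clamp_continuous t : continuous unit_clamp t.
Proof.
  apply (continuous_of_lipschitz unit_clamp 1). intros x y. rewrite Rmult_1_l.
  unfold unit_clamp, Rmax, Rmin. repeat destruct Rle_dec; unfold Rabs; repeat destruct Rcase_abs; lra.
Qed.

Lemma unit_clamp_bounds t : 0 <= unit_clamp t <= 1.
Proof. unfold unit_clamp, Rmax, Rmin. repeat destruct Rle_dec; lra. Qed.

Lemma region_ext D A B : (forall z, D z -> (A z <-> B z)) -> region (inter D A) -> region (inter D B).
Proof.
  intros H HR. replace (inter D B) with (inter D A); [exact HR|].
  apply functional_extensionality; intros z. apply propositional_extensionality.
  unfold inter. specialize (H z). tauto.
Qed.

Lemma alpha_is_unique T w w' : alpha_is T w -> alpha_is T w' -> w = w'.
Proof. intros H H'. apply H', H. reflexivity. Qed.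

Lemma omega_is_unique T w w' : omega_is T w -> omega_is T w' -> w = w'.
Proof. intros H H'. apply H', H. reflexivity. Qed.

(** * Caps *)

(** A neighbourhood of [infinity x] in the disk, cut off by a chord. It avoids every
    limit point with a smaller value of [dot x]. *)
Definition cap (x e : R) (w : R * R) : Prop := 1 - e < dot x w.

Lemma cap_locally x e : 0 < e -> locally (infinity x) (cap x e).
Proof.
  intros He. apply (dot_continuous x (infinity x) (fun y => 1 - e < y)).
  apply open_gt. unfold infinity. rewrite dot_polar, Rminus_diag, cos_0. lra.
Qed.

Lemma outside_cap_locally x e w : dot x w < 1 - e -> locally w (fun z => ~ cap x e z).
Proof.
  intros H. generalize (dot_continuous x w (fun y => y < 1 - e) (open_lt _ _ H)).
  intros HL. change (locally w (fun z => dot x z < 1 - e)) in HL.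
  revert HL. apply filter_imp. intros z Hz. unfold cap. lra.
Qed.

Lemma alpha_leaves_cap T x e w t : alpha_is T w -> dot x w < 1 - e -> time T t ->
  exists s, time T s /\ s < t /\ ~ cap x e (poincare (pos T s)).
Proof.
  intros HA Hw Ht.
  destruct (proj2 (HA w) eq_refl (fun z => ~ cap x e z) (fun s => s < t)) as [s [H1 [H2 H3]]].
  - now apply outside_cap_locally.
  - destruct Ht as [Ht _]. simpl tmin.
    destruct (tmin T) as [u| |] eqn:Eu; [|contradiction|now exists t].
    apply (open_lt t u Ht).
  - exists s. repeat split; auto; apply H1.
Qed.

Lemma omega_leaves_cap T x e w t : omega_is T w -> dot x w < 1 - e -> time T t ->
  exists s, time T s /\ t < s /\ ~ cap x e (poincare (pos T s)).
Proof.
  intros HA Hw Ht.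
  destruct (proj2 (HA w) eq_refl (fun z => ~ cap x e z) (fun s => t < s)) as [s [H1 [H2 H3]]].
  - now apply outside_cap_locally.
  - apply Rbar_locally_after, Ht.
  - exists s. repeat split; auto; apply H1.
Qed.

Lemma dot_origin x : dot x (poincare origin) = 0.
Proof. unfold dot, poincare, origin; simpl fst; simpl snd. unfold Rdiv. ring. Qed.

Lemma sqnorm_infinity x : sqnorm (infinity x) = 1.
Proof. unfold infinity. rewrite sqnorm_polar. ring. Qed.

Lemma sqnorm_poincare z : sqnorm (poincare z) = sqnorm z / (1 + sqnorm z) /\ 0 <= sqnorm z.
Proof.
  assert (H : 0 <= sqnorm z).
  { unfold sqnorm. pose proof (pow2_ge_0 (fst z)). pose proof (pow2_ge_0 (snd z)). lra. }
  split; [|exact H]. unfold sqnorm at 1, poincare. cbv zeta. cbn [fst snd].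
  replace (1 + fst z ^ 2 + snd z ^ 2) with (1 + sqnorm z) by (unfold sqnorm; ring).
  assert (Hq : sqrt (1 + sqnorm z) ^ 2 = 1 + sqnorm z) by (apply pow2_sqrt; lra).
  assert (Hp : 0 < sqrt (1 + sqnorm z)) by (apply sqrt_lt_R0; lra).
  unfold Rdiv. rewrite !Rpow_mult_distr, pow_inv, Hq. unfold sqnorm. ring.
Qed.

Lemma sqnorm_poincare_lt z : sqnorm (poincare z) < 1.
Proof.
  destruct (sqnorm_poincare z) as [-> H].
  apply (Rmult_lt_reg_r (1 + sqnorm z)); [lra|].
  unfold Rdiv. rewrite Rmult_assoc, Rinv_l; lra.
Qed.

Lemma poincare_inj z z' : poincare z = poincare z' -> z = z'.
Proof.
  intros E. pose proof (f_equal sqnorm E) as En.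
  destruct (sqnorm_poincare z) as [H1 P1]. destruct (sqnorm_poincare z') as [H2 P2].
  rewrite H1, H2 in En.
  assert (Eq : sqnorm z = sqnorm z').
  { apply (f_equal (fun q => q * (1 + sqnorm z) * (1 + sqnorm z'))) in En.
    replace (sqnorm z / (1 + sqnorm z) * (1 + sqnorm z) * (1 + sqnorm z'))
      with (sqnorm z * (1 + sqnorm z')) in En by (field; lra).
    replace (sqnorm z' / (1 + sqnorm z') * (1 + sqnorm z) * (1 + sqnorm z'))
      with (sqnorm z' * (1 + sqnorm z)) in En by (field; lra). lra. }
  unfold poincare in E. cbv zeta in E.
  replace (1 + fst z ^ 2 + snd z ^ 2) with (1 + sqnorm z) in E by (unfold sqnorm; ring).
  replace (1 + fst z' ^ 2 + snd z' ^ 2) with (1 + sqnorm z) in E by (rewrite Eq; unfold sqnorm; ring).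
  assert (Hp : 0 < / sqrt (1 + sqnorm z)) by (apply Rinv_0_lt_compat, sqrt_lt_R0; lra).
  injection E as E1 E2. unfold Rdiv in *.
  apply Rmult_eq_reg_r in E1; [|lra]. apply Rmult_eq_reg_r in E2; [|lra].
  rewrite (surjective_pairing z), (surjective_pairing z'). now f_equal.
Qed.

Lemma closure_infinity S E x : (1 < deg S)%nat ->
  (forall e M, 0 < e -> exists w th, M <= w /\ Rabs (th - x) < e /\ E (polar (root S w) th)) ->
  closure (disk_image E) (infinity x).
Proof.
  intros Hd H U HU. destruct (near_infinity S Hd x U HU) as [e [M [He [_ Hin]]]].
  destruct (H e M He) as [w [th [Hw [Hth HE]]]].
  exists (poincare (polar (root S w) th)). split; [now exists (polar (root S w) th)|now apply Hin].
Qed.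

Lemma closure_finite S E w0 x : (1 < deg S)%nat -> 0 < w0 ->
  (forall e, 0 < e -> exists w th, Rabs (w - w0) < e /\ Rabs (th - x) < e /\ E (polar (root S w) th)) ->
  closure (disk_image E) (poincare (polar (root S w0) x)).
Proof.
  intros Hd Hw0 H U HU. destruct (near_finite S Hd w0 x U Hw0 HU) as [e [He Hin]].
  destruct (H e He) as [w [th [Hw [Hth HE]]]].
  exists (poincare (polar (root S w) th)). split; [now exists (polar (root S w) th)|now apply Hin].
Qed.

(** * Equilibria on an invariant radius *)

Lemma radial_vfield S r x : (1 < deg S)%nat -> 0 < r -> g S x = 0 ->
  (vfield S (polar r x) = origin <-> lam S + f S x * r ^ (deg S - 1) = 0).
Proof.
  intros Hd Hr Hg. rewrite vfield_polar, Hg, pow_deg by exact Hd. unfold origin.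
  pose proof (sin2_cos2 x) as H. unfold Rsqr in H. split.
  - intros E. injection E as E1 E2.
    assert (Hz : r * (lam S + f S x * r ^ (deg S - 1)) = 0).
    { set (q := r ^ (deg S - 1)) in *.
      assert (E3 : r * (lam S + f S x * q) * cos x = 0) by (rewrite <- E1; ring).
      assert (E4 : r * (lam S + f S x * q) * sin x = 0) by (rewrite <- E2; ring).
      replace (r * (lam S + f S x * q)) with
        (r * (lam S + f S x * q) * (sin x * sin x + cos x * cos x)) by (rewrite H; ring).
      replace (r * (lam S + f S x * q) * (sin x * sin x + cos x * cos x))
        with ((r * (lam S + f S x * q) * cos x) * cos x + (r * (lam S + f S x * q) * sin x) * sin x) by ring.
      rewrite E3, E4. ring. }
    apply Rmult_integral in Hz. destruct Hz; [lra|assumption].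
  - intros E. set (q := r ^ (deg S - 1)) in *.
    replace (lam S * r + f S x * (r * q)) with (r * (lam S + f S x * q)) by ring.
    rewrite E. f_equal; ring.
Qed.

Lemma radial_equilibrium_exists S x : (1 < deg S)%nat -> 0 < lam S -> g S x = 0 -> f S x < 0 ->
  unique (radial_equilibrium S x) (radial_point S x).
Proof.
  intros Hd Hl Hg Hf. pose proof (proj1 (equilibrium_pos _ Hl _ Hf)) as Hp. split.
  - exists (root S (- lam S / f S x)). split; [apply root_pos|]. split; [reflexivity|].
    apply radial_vfield; auto using root_pos. rewrite root_pow by auto. field. lra.
  - intros p [r [Hr [-> Hv]]]. apply radial_vfield in Hv; auto.
    unfold radial_point. f_equal. rewrite <- (root_of_pow S r Hd Hr). f_equal.
    apply (Rmult_eq_reg_l (f S x)); [|lra]. field_simplify; lra.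
Qed.

Lemma radial_equilibrium_none S x : (1 < deg S)%nat -> 0 < lam S -> g S x = 0 -> 0 <= f S x ->
  no_radial_equilibrium S x.
Proof.
  intros Hd Hl Hg Hf p [r [Hr [-> Hv]]]. apply radial_vfield in Hv; auto.
  pose proof (pow_lt r (deg S - 1) Hr). nra.
Qed.

(** * Radial behaviour at infinity *)

Lemma constant_flow S x : g S x = 0 -> trajectory_at_infinity S (fun _ => x).
Proof.
  intros Hg t. rewrite Hg. apply (is_derive_const (K := R_AbsRing) (V := R_NormedModule) x t).
Qed.

(** The leaves over the constant flow solve [radial_field] in the coordinate [1 / r]: both
    use the time of the flow at infinity. *)
Lemma radial_derive S x c s : (1 < deg S)%nat -> g S x = 0 ->
  0 < leaf_of S (fun _ => x) c s ->
  is_derive (fun s => / root S (leaf_of S (fun _ => x) c s)) s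
    (radial_field S x (/ root S (leaf_of S (fun _ => x) c s))).
Proof.
  intros Hd Hg Hp. pose proof (root_pos S (leaf_of S (fun _ => x) c s)) as Hr.
  pose proof (rate_pos S Hd).
  eapply is_derive_eq.
  - apply is_derive_inv; [|lra].
    apply (is_derive_comp (root S) (leaf_of S (fun _ => x) c)); [now apply root_derive|].
    apply leaf_of_derive. now apply constant_flow.
  - unfold radial_field, scal; simpl; unfold mult; simpl.
    rewrite pow_deg by exact Hd. rewrite pow_inv, root_pow by auto.
    set (w := leaf_of S (fun _ => x) c s) in *. set (r := root S w) in *. field. repeat split; lra.
Qed.

Lemma inv_root_small S e : (1 < deg S)%nat -> 0 < e ->
  exists M, 0 < M /\ forall w, M <= w -> 0 < / root S w < e.
Proof.
  intros Hd He. assert (He2 : 0 < 2 / e) by (apply Rdiv_lt_0_compat; lra).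
  assert (HM : 0 < (2 / e) ^ (deg S - 1)) by now apply pow_lt.
  exists ((2 / e) ^ (deg S - 1)). split; [exact HM|].
  intros w Hw. pose proof (root_pos S w). split; [now apply Rinv_0_lt_compat|].
  assert (Hr : 2 / e <= root S w) by (rewrite <- (root_of_pow S (2 / e)) by auto; now apply root_le).
  apply Rle_lt_trans with (/ (2 / e)); [now apply Rinv_le_contravar|].
  replace (/ (2 / e)) with (e / 2) by (field; lra). lra.
Qed.

Lemma radially_attracting_intro S x : (1 < deg S)%nat -> 0 < lam S -> g S x = 0 -> 0 <= f S x ->
  radially_attracting S x.
Proof.
  intros Hd Hl Hg Hf. exists 1. split; [lra|]. intros rho Hrho _.
  assert (Hi : 0 < / rho) by now apply Rinv_0_lt_compat.
  destruct (chart_on_leaf S (fun _ => x) 0 ((/ rho) ^ (deg S - 1))) as [c [Ec _]]; [now apply pow_lt|].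
  assert (Hpos0 : 0 < leaf_of S (fun _ => x) c 0) by (rewrite Ec; now apply pow_lt).
  exists (fun s => / root S (leaf_of S (fun _ => x) c s)). split; [|split].
  - rewrite Ec, root_of_pow by auto. apply Rinv_inv.
  - intros t Ht. split; [apply Rinv_0_lt_compat, root_pos|].
    apply radial_derive; auto.
    apply (leaf_of_pos_after S _ Hd Hl (constant_flow S x Hg) c 0); auto.
  - apply is_lim_spec. intros eps. destruct (inv_root_small S eps Hd (cond_pos eps)) as [M [HM Hin]].
    destruct (leaf_to_infinity _ _ _ (rate_pos S Hd) Hl
       (radial_rate_continuous S _ (constant_flow S x Hg)) (f S x)) with (c := c) (s0 := 0) (M := M)
      as [s2 H2]; auto.
    { exact (is_lim_const (f S x) p_infty). }
    exists s2. intros s Hs. specialize (H2 s ltac:(lra)). specialize (Hin _ H2).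
    rewrite Rminus_0_r. fold (leaf_of S (fun _ => x) c s) in Hin. rewrite Rabs_right; lra.
Qed.

Lemma radially_repelling_intro S x : (1 < deg S)%nat -> 0 < lam S -> g S x = 0 -> f S x < 0 ->
  radially_repelling S x.
Proof.
  intros Hd Hl Hg Hf. pose proof (constant_flow S x Hg) as Hth.
  pose proof (radial_rate_continuous S _ Hth) as HF.
  assert (Hlim : is_lim (radial_rate S (fun _ => x)) m_infty (f S x)) by exact (is_lim_const (f S x) m_infty).
  destruct (lowest_leaf_exists_limit _ _ _ (rate_pos S Hd) Hl HF (f S x) Hlim Hf) as [c0 H0].
  set (w1 := leaf_of S (fun _ => x) c0 0).
  assert (Hw1 : 0 < w1) by (apply leaf_of_pos, H0).
  exists (/ root S w1). split; [apply Rinv_0_lt_compat, root_pos|].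
  intros rho Hrho Hlt. rewrite Rminus_0_r, Rabs_right in Hlt by lra.
  assert (Hi : 0 < / rho) by now apply Rinv_0_lt_compat.
  destruct (chart_on_leaf S (fun _ => x) 0 ((/ rho) ^ (deg S - 1))) as [c [Ec _]]; [now apply pow_lt|].
  assert (Hc : c0 < c).
  { apply (leaf_of_lt S (fun _ => x) c0 c 0). rewrite Ec. fold w1.
    rewrite <- (root_pow S w1) by auto.
    assert (Hr : root S w1 < / rho).
    { rewrite <- (Rinv_inv (root S w1)). apply Rinv_lt_contravar; [|exact Hlt].
      apply Rmult_lt_0_compat; [exact Hrho|]. apply Rinv_0_lt_compat, root_pos. }
    pose proof (root_pos S w1).
    assert (Hpl : forall m, root S w1 ^ Datatypes.S m < (/ rho) ^ Datatypes.S m).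
    { induction m as [|m IH]; [simpl; lra|].
      change (root S w1 * root S w1 ^ Datatypes.S m < / rho * (/ rho) ^ Datatypes.S m).
      pose proof (pow_lt (root S w1) (Datatypes.S m) H). nra. }
    replace (deg S - 1)%nat with (Datatypes.S (deg S - 2)) by lia. apply Hpl. }
  assert (Hpos : forall s, 0 < leaf_of S (fun _ => x) c s).
  { intros s. apply leaf_of_pos. pose proof (proj1 H0 s) as Hs. unfold height_of. lra. }
  exists (fun s => / root S (leaf_of S (fun _ => x) c (- s))). split; [|split].
  - rewrite Ropp_0, Ec, root_of_pow by auto. apply Rinv_inv.
  - intros t Ht. split; [apply Rinv_0_lt_compat, root_pos|].
    apply (is_derive_rev (fun s => / root S (leaf_of S (fun _ => x) c s))).
    now apply radial_derive.
  - apply is_lim_spec. intros eps. destruct (inv_root_small S eps Hd (cond_pos eps)) as [M [HM Hin]].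
    destruct (leaf_from_infinity_strict _ _ _ (rate_pos S Hd) Hl HF (f S x) Hlim c0 c H0 Hc M) as [s2 H2].
    exists (- s2). intros s Hs. specialize (H2 (- s) ltac:(lra)). specialize (Hin _ H2).
    rewrite Rminus_0_r. fold (leaf_of S (fun _ => x) c (- s)) in Hin. rewrite Rabs_right; lra.
Qed.

(** A solution tending to [0] would eventually increase. *)
Lemma not_attracting (h : R -> R) (e : R) : 0 < e -> (forall x, 0 < x < e -> 0 < h x) ->
  ~ attracting h 0 (fun x => 0 < x).
Proof.
  intros He Hh [d [Hd H]].
  destruct (H (d / 2)) as [u [_ [Hu Hlim]]]; [lra|rewrite Rabs_right; lra|].
  apply is_lim_spec in Hlim. destruct (Hlim (mkposreal e He)) as [M HM]. simpl in HM.
  set (t0 := Rmax 0 M + 1). pose proof (Rmax_l 0 M). pose proof (Rmax_r 0 M).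
  pose proof (Hu t0 ltac:(unfold t0; lra)) as [Hu0 _].
  destruct (Hlim (mkposreal _ Hu0)) as [N HN]. simpl in HN.
  set (t1 := Rmax t0 N + 1). pose proof (Rmax_l t0 N). pose proof (Rmax_r t0 N).
  specialize (HN t1 ltac:(unfold t1; lra)). apply Rabs_def2 in HN.
  assert (Hm : u t0 <= u t1).
  { apply (nondecreasing_of_derive u (fun t => h (u t))); [unfold t1; lra| |].
    - intros t Ht. apply Hu. unfold t0 in Ht. lra.
    - intros t Ht. left. apply Hh. destruct (Hu t) as [Hp _]; [unfold t0 in Ht; lra|].
      split; [exact Hp|]. specialize (HM t ltac:(unfold t0 in Ht; lra)).
      apply Rabs_def2 in HM. lra. }
  lra.
Qed.

Lemma radially_attracting_elim S x : (1 < deg S)%nat -> 0 < lam S ->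
  radially_attracting S x -> 0 <= f S x.
Proof.
  intros Hd Hl HA. apply Rnot_lt_le. intros Hf. revert HA.
  pose proof (proj1 (equilibrium_pos _ Hl _ Hf)) as Hq.
  apply (not_attracting _ (Rmin 1 (- f S x / lam S))).
  - apply Rmin_pos; [lra|]. apply Rdiv_lt_0_compat; lra.
  - intros rho [H0 H1]. pose proof (Rmin_l 1 (- f S x / lam S)). pose proof (Rmin_r 1 (- f S x / lam S)).
    unfold radial_field. rewrite pow_deg by exact Hd.
    assert (Hp : rho ^ (deg S - 1) <= rho).
    { replace (deg S - 1)%nat with (Datatypes.S (deg S - 2)) by lia. simpl.
      assert (rho ^ (deg S - 2) <= 1); [|nra].
      rewrite <- (pow1 (deg S - 2)). apply pow_incr. lra. }
    assert (Hm : lam S * rho < - f S x).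
    { replace (- f S x) with (lam S * (- f S x / lam S)) by (field; lra).
      apply Rmult_lt_compat_l; lra. }
    set (q := rho ^ (deg S - 1)) in *.
    assert (Hq' : 0 < - lam S * q - f S x) by nra.
    replace (- lam S * (rho * q) - rho * f S x) with (rho * (- lam S * q - f S x)) by ring.
    now apply Rmult_lt_0_compat.
Qed.

Lemma radially_repelling_elim S x : (1 < deg S)%nat -> 0 < lam S ->
  radially_repelling S x -> f S x < 0.
Proof.
  intros Hd Hl HA. apply Rnot_le_lt. intros Hf. revert HA.
  apply (not_attracting _ 1); [lra|]. intros rho [H0 _]. unfold radial_field.
  pose proof (pow_lt rho (deg S) H0). nra.
Qed.

(** On a small cap both factors of [dot x (polar r y) = r cos (y - x)] are close to [1]. *)
Lemma cap_elim x e M : 0 < e <= PI -> exists d, 0 < d /\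
  forall r y, 0 < r -> Rabs (y - x) <= PI -> cap x d (poincare (polar r y)) ->
    Rabs (y - x) < e /\ M < r.
Proof.
  intros [He Hpi].
  assert (Hc : cos e < 1) by (apply cos_lt_1; [lra|rewrite Rabs_right; lra]).
  set (d1 := 1 - cos e). set (d2 := / (2 * (1 + M ^ 2))).
  assert (HM : 0 < 2 * (1 + M ^ 2)) by (pose proof (pow2_ge_0 M); lra).
  assert (Hd2 : 0 < d2) by now apply Rinv_0_lt_compat.
  exists (Rmin d1 d2). pose proof (Rmin_l d1 d2). pose proof (Rmin_r d1 d2).
  split; [apply Rmin_pos; unfold d1; lra|].
  intros r y Hr Hy Hcap. unfold cap in Hcap. rewrite poincare_polar, dot_polar in Hcap.
  destruct (shrink_bounds r ltac:(lra)) as [[Hs0 Hs1] _].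
  pose proof (COS_bound (y - x)) as [_ Hcb].
  assert (Hd : 0 <= 1 - Rmin d1 d2).
  { assert (d2 <= 1 / 2); [|lra].
    unfold d2. replace (1 / 2) with (/ 2) by field. apply Rinv_le_contravar; [lra|].
    pose proof (pow2_ge_0 M). lra. }
  assert (Hcpos : 0 < cos (y - x)) by nra.
  split.
  - apply Rnot_le_lt. intros Hle.
    assert (Hcc : cos (y - x) <= cos e).
    { replace (cos (y - x)) with (cos (Rabs (y - x))).
      - apply cos_decr_1; lra.
      - unfold Rabs. destruct Rcase_abs; [apply cos_neg|reflexivity]. }
    assert (shrink r * cos (y - x) <= cos (y - x)) by nra. unfold d1 in *. lra.
  - apply Rnot_le_lt. intros Hle.
    assert (Hsq : shrink r ^ 2 = r ^ 2 / (1 + r ^ 2)).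
    { unfold shrink, Rdiv. rewrite Rpow_mult_distr, pow_inv, pow2_sqrt; [reflexivity|nra]. }
    assert (Hrm : shrink r ^ 2 <= 1 - / (1 + M ^ 2)).
    { rewrite Hsq. replace (r ^ 2 / (1 + r ^ 2)) with (1 - / (1 + r ^ 2)) by (field; nra).
      apply Rplus_le_compat_l, Ropp_le_contravar, Rinv_le_contravar; nra. }
    assert (Hd2' : / (1 + M ^ 2) = 2 * d2) by (unfold d2; field; pose proof (pow2_ge_0 M); lra).
    assert (shrink r * cos (y - x) <= shrink r) by nra. nra.
Qed.

(** Connectedness of the unit interval. *)
Lemma path_stays (c : R -> R * R) (A B : R * R -> Prop) :
  (forall t, continuous c t) -> 
  (forall t, 0 <= t <= 1 -> A (c t) -> locally (c t) A) ->
  (forall t, 0 <= t <= 1 -> B (c t) -> locally (c t) B) ->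
  (forall t, 0 <= t <= 1 -> (A (c t) \/ B (c t)) /\ ~ (A (c t) /\ B (c t))) ->
  A (c 0) -> A (c 1).
Proof.
  intros Hc HA HB HAB H0.
  set (X := fun t => 0 <= t <= 1 /\ forall u, 0 <= u <= t -> A (c u)).
  assert (X0 : X 0). { split; [lra|]. intros u Hu. replace u with 0 by lra. exact H0. }
  destruct (completeness X) as [m [Hub Hlub]].
  { exists 1. intros t [Ht _]. lra. }
  { now exists 0. }
  assert (Hm0 : 0 <= m) by now apply Hub.
  assert (Hm1 : m <= 1). { apply Hlub. intros t [Ht _]. lra. }
  assert (Hbelow : forall u, 0 <= u < m -> A (c u)).
  { intros u Hu. apply NNPP. intros Hn. assert (m <= u); [|lra].
    apply Hlub. intros t [Ht HX]. apply Rnot_lt_le. intros Hlt. apply Hn, HX. lra. }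
  assert (Hm : A (c m)).
  { destruct (HAB m ltac:(lra)) as [[H|H] _]; [exact H|exfalso].
    pose proof (Hc m B (HB m ltac:(lra) H)) as [d Hd]. pose proof (cond_pos d).
    destruct (Rle_lt_or_eq_dec 0 m Hm0) as [Hlt|E0].
    - set (u := Rmax 0 (m - d / 2)).
      assert (Hu : 0 <= u < m /\ m - d < u) by (unfold u, Rmax; destruct Rle_dec; lra).
      apply (HAB u ltac:(lra)). split; [now apply Hbelow|]. apply Hd.
      unfold ball; simpl. unfold AbsRing_ball, abs, minus, plus, opp; simpl. apply Rabs_def1; lra.
    - apply (HAB m ltac:(lra)). split; [now rewrite <- E0|exact H]. }
  destruct (Rle_lt_or_eq_dec m 1 Hm1) as [Hlt|E1]; [exfalso|now rewrite <- E1].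
  pose proof (Hc m A (HA m ltac:(lra) Hm)) as [d Hd]. pose proof (cond_pos d).
  set (v := Rmin 1 (m + d / 2)).
  assert (Hv : m < v <= 1 /\ v < m + d) by (unfold v, Rmin; destruct Rle_dec; lra).
  assert (X v).
  { split; [lra|]. intros u Hu. destruct (Rlt_dec u m); [apply Hbelow; lra|].
    apply Hd. unfold ball; simpl. unfold AbsRing_ball, abs, minus, plus, opp; simpl. apply Rabs_def1; lra. }
  specialize (Hub v H1). lra.
Qed.

(** * Heteroclinic solutions of scalar equations *)

(** The distance to a zero [q] of [h] decreases at most exponentially, at the rate of a
    Lipschitz constant of [h], so that a solution does not exhaust [[sg 0, q)] in finite
    time. *)
Lemma zero_not_reached (h sg : R -> R) (L q T : R) :
  0 <= L -> (forall x y, Rabs (h x - h y) <= L * Rabs (x - y)) -> h q = 0 -> 0 < T ->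
  (forall t, 0 <= t < T -> sg t < q /\ is_derive sg t (h (sg t))) ->
  (forall x, sg 0 <= x < q -> exists t, 0 <= t < T /\ sg t = x) -> False.
Proof.
  intros HL Hlip Hq HT Hsg Honto.
  pose proof (exp_pos (- L * T)) as He. pose proof (proj1 (Hsg 0 ltac:(lra))) as Hs0.
  assert (Hdec : forall t, 0 <= t < T -> exp (L * t) * exp (- L * T) <= 1).
  { intros t Ht. rewrite <- exp_plus, <- exp_0. destruct (Req_dec (L * t + - L * T) 0) as [E|E].
    - rewrite E. lra.
    - left. apply exp_increasing. assert (L * t <= L * T) by (apply Rmult_le_compat_l; lra). lra. }
  pose proof (Hdec 0 ltac:(lra)) as Hd0. rewrite Rmult_0_r, exp_0, Rmult_1_l in Hd0.
  set (d := (q - sg 0) * exp (- L * T)).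
  assert (Hd : 0 < d <= q - sg 0) by (unfold d; nra).
  destruct (Honto (q - d / 2)) as [t [Ht Et]]; [lra|].
  assert (Hm : (q - sg 0) * exp (L * 0) <= (q - sg t) * exp (L * t)).
  { apply (nondecreasing_of_derive (fun t => (q - sg t) * exp (L * t))
      (fun t => (L * (q - sg t) - h (sg t)) * exp (L * t))); [lra| |].
    - intros u Hu. destruct (Hsg u) as [_ Hd']; [lra|]. eapply is_derive_eq.
      + apply (is_derive_mult (fun t => q - sg t) (fun t => exp (L * t))).
        * apply (is_derive_minus (fun _ => q) sg); [apply is_derive_const|exact Hd'].
        * apply (is_derive_comp exp (fun t => L * t)); [apply is_derive_exp|].
          apply (is_derive_scal (fun t => t)), is_derive_id.
        * intros; apply Rmult_comm.
      + unfold plus, minus, plus, opp, zero, mult, scal, one; simpl. unfold mult; simpl.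
        unfold minus, plus, opp; simpl. ring.
    - intros u Hu. destruct (Hsg u) as [Hb _]; [lra|]. apply Rmult_le_pos; [|left; apply exp_pos].
      pose proof (Hlip (sg u) q) as Hl. rewrite Hq, Rminus_0_r in Hl.
      rewrite (Rabs_left (sg u - q)) in Hl by lra. pose proof (Rle_abs (h (sg u))). lra. }
  rewrite Rmult_0_r, exp_0, Rmult_1_r, Et in Hm. specialize (Hdec t Ht). pose proof (exp_pos (L * t)).
  assert (q - sg 0 <= d / 2 * exp (L * t)) by lra. unfold d in *. nra.
Qed.

Lemma scalar_heteroclinic (h : R -> R) (L p q x0 : R) :
  0 <= L -> (forall x y, Rabs (h x - h y) <= L * Rabs (x - y)) ->
  h p = 0 -> h q = 0 -> (forall x, p < x < q -> 0 < h x) -> p < x0 < q ->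
  exists sg : R -> R,
    (forall t, p < sg t < q /\ is_derive sg t (h (sg t))) /\
    is_lim sg m_infty p /\ is_lim sg p_infty q.
Proof.
  intros HL Hlip Hp Hq Hpos Hx0.
  destruct (scalar_flow (fun x => p < x < q) h x0 0) as [t1 [t2 [sg [Ht1 [Ht2 [E0 [Hsg Honto]]]]]]].
  - exact Hx0.
  - intros; lra.
  - intros x Hx. exists ((p + x) / 2), ((x + q) / 2). lra.
  - intros x _. now apply (continuous_of_lipschitz h L).
  - exact Hpos.
  - assert (Hinc : forall u v : R, Rbar_lt t1 (Finite u) -> Rbar_lt (Finite v) t2 -> u < v -> sg u < sg v).
    { intros u v Hu Hv Huv.
      assert (Ht : forall t, u <= t <= v -> (p < sg t < q) /\ is_derive sg t (h (sg t))).
      { intros t Ht. apply Hsg.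
        - apply (Rbar_lt_le_trans _ u); [exact Hu|]. simpl. lra.
        - apply (Rbar_le_lt_trans _ v); [|exact Hv]. simpl. lra. }
      apply (increasing_of_derive sg (fun t => h (sg t)) u v Huv); intros t Htt; [|apply Hpos]; now apply Ht. }
    assert (Et2 : t2 = p_infty).
    { destruct t2 as [T| |]; [exfalso| reflexivity|contradiction]. simpl in Ht2.
      apply (zero_not_reached h sg L q T HL Hlip Hq Ht2).
      - intros t Ht. destruct (Hsg t) as [Hb Hd]; [|simpl; lra|split; [lra|exact Hd]].
        apply (Rbar_lt_le_trans _ 0); [exact Ht1|simpl; lra].
      - intros x Hx. destruct (Honto x) as [t [Hta [Htb Et]]]; [lra|]. exists t.
        split; [|exact Et]. split; [|exact Htb].
        apply Rnot_lt_le. intros Hlt. pose proof (Hinc t 0 Hta Ht2 Hlt). lra. }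
    assert (Et1 : t1 = m_infty).
    { destruct t1 as [T| |]; [exfalso|contradiction| reflexivity]. simpl in Ht1.
      apply (zero_not_reached (fun x => h (- x)) (fun t => - sg (- t)) L (- p) (- T) HL).
      - intros x y. replace (Rabs (x - y)) with (Rabs (- x - - y)); [apply Hlip|].
        rewrite <- Rabs_Ropp. f_equal. ring.
      - now rewrite Ropp_involutive.
      - lra.
      - intros t Ht. destruct (Hsg (- t)) as [Hb Hd]; [simpl; lra| |].
        + apply (Rbar_le_lt_trans _ 0); [simpl; lra|exact Ht2].
        + split; [lra|]. rewrite Ropp_involutive. eapply is_derive_eq.
          * apply (is_derive_opp (fun t => sg (- t))). apply (is_derive_rev sg), Hd.
          * unfold opp; simpl. ring.
      - rewrite Ropp_0. intros x Hx. destruct (Honto (- x)) as [t [Hta [Htb Et]]]; [lra|].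
        exists (- t). rewrite Ropp_involutive. split; [|lra]. simpl in Hta. split; [|lra].
        apply Rnot_lt_le. intros Hlt. pose proof (Hinc 0 t Ht1 Htb ltac:(lra)). lra. }
    subst t1 t2. exists sg. split; [intros t; now apply Hsg|].
    assert (Hmid : forall x, p < x < q -> exists t, sg t = x).
    { intros x Hx. destruct (Honto x Hx) as [t [_ [_ Et]]]. now exists t. }
    split; apply is_lim_spec; intros eps; pose proof (cond_pos eps).
    + set (x := Rmin (p + eps / 2) ((p + q) / 2)).
      assert (Hx : p < x < q /\ x < p + eps) by (unfold x, Rmin; destruct Rle_dec; lra).
      destruct (Hmid x (proj1 Hx)) as [t Et]. exists t. intros u Hu.
      pose proof (Hinc u t I I Hu). destruct (Hsg u I I) as [Hb _]. apply Rabs_def1; lra.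
    + set (x := Rmax (q - eps / 2) ((p + q) / 2)).
      assert (Hx : p < x < q /\ q - eps < x) by (unfold x, Rmax; destruct Rle_dec; lra).
      destruct (Hmid x (proj1 Hx)) as [t Et]. exists t. intros u Hu.
      pose proof (Hinc t u I I Hu). destruct (Hsg u I I) as [Hb _]. apply Rabs_def1; lra.
Qed.

Lemma same_sign (h : R -> R) x y : (forall z, continuous h z) -> x <= y ->
  (forall z, x <= z <= y -> h z <> 0) -> 0 < h x * h y.
Proof.
  intros Hc Hxy Hn. apply Rnot_le_lt. intros Hle.
  destruct (intermediate_value h x y 0 Hxy) as [z [Hz E]]; [auto| |now apply (Hn z)].
  destruct (Rle_dec (h x) 0); destruct (Rle_dec (h y) 0); try (left; lra); try (right; lra); nra.
Qed.

Lemma between_same_sign S a b x y : consecutive S a b -> between a b x -> between a b y ->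
  0 < g S x * g S y.
Proof.
  intros Hcons Hx Hy.
  assert (W : forall x y, between a b x -> between a b y -> x <= y -> 0 < g S x * g S y).
  { intros u v Hu Hv Huv. apply same_sign; [apply g_continuous|exact Huv|].
    intros z Hz. apply Hcons. apply between_cases in Hu. apply between_cases in Hv.
    apply between_cases. lra. }
  destruct (Rle_dec x y); [now apply W|]. rewrite Rmult_comm. apply W; auto; lra.
Qed.

(** On the arc the flow at infinity is a scalar equation between two consecutive zeros of
    [g]. The sign [e] treats both orientations of the arc at the same time. *)
Lemma arc_exists S a b m : consecutive S a b -> between a b m -> 0 < (b - a) * g S m ->
  exists th, connecting_arc S a b th.
Proof.
  intros Hcons Hm Hdir. pose proof (proj1 (between_cases _ _ _) Hm) as Hmc.
  assert (He : exists e, e * e = 1 /\ e * a < e * b).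
  { destruct Hmc; [exists 1|exists (-1)]; lra. }
  destruct He as [e [He Hab]].
  assert (Hecase : e = 1 \/ e = -1) by (assert ((e - 1) * (e + 1) = 0) by lra;
      apply Rmult_integral in H; lra).
  assert (Hbt : forall x, e * a < x < e * b -> between a b (e * x)).
  { intros x Hx. apply between_cases. destruct Hecase as [-> | ->]; lra. }
  destruct (g_lipschitz S) as [L [HL Hlip]].
  destruct (scalar_heteroclinic (fun x => e * g S (e * x)) L (e * a) (e * b) (e * m) HL) as [sg [Hsg [L1 L2]]].
  - intros x y. specialize (Hlip (e * x) (e * y)).
    assert (Habs : Rabs e = 1) by (destruct Hecase as [-> | ->]; [apply Rabs_R1|rewrite Rabs_left; lra]).
    replace (e * x - e * y) with (e * (x - y)) in Hlip by ring.
    replace (e * g S (e * x) - e * g S (e * y)) with (e * (g S (e * x) - g S (e * y))) by ring.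
    rewrite Rabs_mult, Habs in Hlip. rewrite Rabs_mult, Habs. lra.
  - rewrite <- Rmult_assoc, He, Rmult_1_l. rewrite (proj1 (proj2 Hcons)). ring.
  - rewrite <- Rmult_assoc, He, Rmult_1_l. rewrite (proj1 (proj2 (proj2 Hcons))). ring.
  - intros x Hx. pose proof (between_same_sign S a b (e * x) m Hcons (Hbt x Hx) Hm).
    destruct Hecase as [-> | ->]; nra.
  - destruct Hecase as [-> | ->]; lra.
  - exists (fun t => e * sg t). split; [exact Hcons|]. split; [|split; [|split]].
    + intros t. eapply is_derive_eq.
      * apply (is_derive_scal sg t e). apply Hsg.
      * simpl. rewrite <- Rmult_assoc, He. ring.
    + intros t. apply Hbt, Hsg.
    + pose proof (is_lim_scal_l sg e m_infty _ L1) as H. simpl in H.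
      now rewrite <- Rmult_assoc, He, Rmult_1_l in H.
    + pose proof (is_lim_scal_l sg e p_infty _ L2) as H. simpl in H.
      now rewrite <- Rmult_assoc, He, Rmult_1_l in H.
Qed.

(** * Perturbation of the zeros of a function *)

Lemma nearest_zero (h : R -> R) m u : (forall x, continuous h x) -> m < u -> h m * h u < 0 ->
  exists z, m < z < u /\ h z = 0 /\ forall y, m <= y < z -> h y <> 0.
Proof.
  intros Hc Hmu Hs.
  set (X := fun x => m <= x <= u /\ forall y, m <= y <= x -> h y <> 0).
  assert (Hm0 : h m <> 0) by nra. assert (Hu0 : h u <> 0) by nra.
  destruct (completeness X) as [z [Hub Hlub]].
  { exists u. intros x [Hx _]. lra. }
  { exists m. split; [lra|]. intros y Hy. replace y with m by lra. exact Hm0. }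
  assert (Hz1 : m <= z).
  { apply Hub. split; [lra|]. intros y Hy. replace y with m by lra. exact Hm0. }
  assert (Hz2 : z <= u). { apply Hlub. intros x [Hx _]. lra. }
  assert (Hbelow : forall y, m <= y < z -> h y <> 0).
  { intros y Hy E. assert (z <= y); [|lra]. apply Hlub. intros x [Hx HX].
    apply Rnot_lt_le. intros Hlt. apply (HX y); [lra|exact E]. }
  assert (Hz : h z = 0).
  { apply NNPP. intros Hn.
    assert (Hzu : z < u).
    { destruct Hz2 as [Hz2| ->]; [exact Hz2|exfalso].
      assert (0 < h m * h u); [|lra]. apply same_sign; [exact Hc|lra|].
      intros y Hy. destruct (Req_dec y u) as [->|Hne]; [exact Hn|apply Hbelow; lra]. }
    destruct (near_point h z (Rabs (h z)) (Hc z) (Rabs_pos_lt _ Hn)) as [d [Hd Hnear]].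
    set (v := Rmin u (z + d / 2)).
    assert (Hv : z < v <= u /\ v < z + d) by (unfold v, Rmin; destruct Rle_dec; lra).
    assert (X v).
    { split; [lra|]. intros y Hy. destruct (Rlt_dec y z); [apply Hbelow; lra|].
      intros E. specialize (Hnear y ltac:(apply Rabs_def1; lra)).
      rewrite E, Rminus_0_l, Rabs_Ropp in Hnear. lra. }
    specialize (Hub v H). lra. }
  exists z. split; [|now split].
  split; [destruct Hz1 as [Hz1|Hz1]; [exact Hz1|]|destruct Hz2 as [Hz2|Hz2]; [exact Hz2|]];
    exfalso; subst z; contradiction.
Qed.

Definition changes_sign (h : R -> R) (x : R) : Prop :=
  forall e, 0 < e -> exists d, 0 < d < e /\ h (x - d) * h (x + d) < 0.

Lemma simple_zero_changes_sign (h : R -> R) (x l : R) : is_derive h x l -> l <> 0 -> h x = 0 ->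
  changes_sign h x.
Proof.
  intros Hd Hl H0 e He. apply is_derive_Reals in Hd.
  destruct (Hd (Rabs l / 2)) as [d Hdd]; [pose proof (Rabs_pos_lt l Hl); lra|].
  pose proof (cond_pos d) as Hdp. set (k := Rmin (d / 2) (e / 2)).
  assert (Hk : 0 < k) by (apply Rmin_pos; lra).
  pose proof (Rmin_l (d / 2) (e / 2)). pose proof (Rmin_r (d / 2) (e / 2)). fold k in H, H1.
  exists k. split; [lra|].
  pose proof (Hdd k ltac:(lra) ltac:(rewrite Rabs_right; lra)) as P1.
  pose proof (Hdd (- k) ltac:(lra) ltac:(rewrite Rabs_left; lra)) as P2.
  rewrite H0, Rminus_0_r in P1, P2. change (x + - k) with (x - k) in P2.
  set (u := h (x + k)) in *. set (v := h (x - k)) in *.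
  assert (Eu : u = u / k * k) by (field; lra). assert (Ev : v = - (v / - k * k)) by (field; lra).
  set (u' := u / k) in *. set (v' := v / - k) in *.
  apply Rabs_def2 in P1. apply Rabs_def2 in P2.
  assert (Huv : 0 < u' * v').
  { pose proof (Rabs_pos_lt l Hl) as Hlp. unfold Rabs in *. destruct (Rcase_abs l).
    - assert (u' < 0) by lra. assert (v' < 0) by lra. nra.
    - assert (0 < u') by lra. assert (0 < v') by lra. nra. }
  rewrite Eu, Ev. replace (- (v' * k) * (u' * k)) with (- (u' * v' * (k * k))) by ring.
  assert (0 < k * k) by nra. nra.
Qed.

(** The first zeros of [H] met when going down and up from [1 / 2] are consecutive by
    construction. They are close to [0] and [1] because [G], hence [H], is bounded away
    from [0] in between. *)
Lemma perturbed_zeros (G : R -> R) (e : R) :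
  (forall t, continuous G t) -> (forall t, 0 < t < 1 -> G t <> 0) ->
  changes_sign G 0 -> changes_sign G 1 -> 0 < e ->
  exists k, 0 < k /\ forall H : R -> R, (forall t, continuous H t) ->
    (forall t, Rabs (H t - G t) < k) ->
    exists t0 t1, Rabs t0 < e /\ Rabs (t1 - 1) < e /\ H t0 = 0 /\ H t1 = 0 /\
      forall t, t0 < t < t1 -> H t <> 0.
Proof.
  intros HG Hn C0 C1 He.
  assert (He' : 0 < Rmin e (1 / 4)) by (apply Rmin_pos; lra).
  pose proof (Rmin_l e (1 / 4)) as HR1. pose proof (Rmin_r e (1 / 4)) as HR2.
  destruct (C0 _ He') as [d0 [Hd0 S0]]. destruct (C1 _ He') as [d1 [Hd1 S1]].
  rewrite Rplus_0_l, Rminus_0_l in S0.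
  destruct (continuity_ab_min (fun t => Rabs (G t)) d0 (1 - d1)) as [tm [Hmin Htm]]; [lra| |].
  { intros c _. apply continuity_pt_filterlim. apply (continuous_comp G Rabs); [apply HG|apply continuous_Rabs]. }
  set (k := Rmin (Rabs (G tm)) (Rmin (Rabs (G (- d0))) (Rabs (G (1 + d1))))).
  assert (Hk : 0 < k).
  { repeat apply Rmin_pos; apply Rabs_pos_lt; [apply Hn; lra|nra|nra]. }
  assert (K1 : k <= Rabs (G tm)) by apply Rmin_l.
  assert (K2 : k <= Rabs (G (- d0))) by (eapply Rle_trans; [apply Rmin_r|apply Rmin_l]).
  assert (K3 : k <= Rabs (G (1 + d1))) by (eapply Rle_trans; [apply Rmin_r|apply Rmin_r]).
  exists k. split; [exact Hk|]. intros H HH Hclose.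
  assert (Hsign : forall t, k <= Rabs (G t) -> 0 < H t * G t).
  { intros t Ht. specialize (Hclose t). apply Rabs_def2 in Hclose.
    unfold Rabs in Ht. destruct (Rcase_abs (G t)); nra. }
  assert (Hmid : forall t, d0 <= t <= 1 - d1 -> 0 < H t * G t).
  { intros t Ht. apply Hsign. specialize (Hmin t Ht). simpl in Hmin. lra. }
  assert (G0 : 0 < G d0 * G (1 / 2)).
  { apply same_sign; [exact HG|lra|]. intros z Hz. apply Hn. lra. }
  assert (G1 : 0 < G (1 / 2) * G (1 - d1)).
  { apply same_sign; [exact HG|lra|]. intros z Hz. apply Hn. lra. }
  pose proof (Hmid (1 / 2) ltac:(lra)) as M0.
  pose proof (Hsign _ K2) as M1. pose proof (Hsign _ K3) as M2.
  assert (W : forall x y z u v : R, 0 < x * y -> 0 < z * u -> u * v < 0 -> 0 < v * y -> x * z < 0).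
  { intros x y z u v A1 A2 A3 A4.
    assert (P1 : 0 < (x * y) * (v * y)) by nra.
    assert (P2 : 0 < x * v) by nra.
    assert (P3 : z * v < 0) by nra. nra. }
  assert (N0 : H (1 / 2) * H (- d0) < 0).
  { apply (W _ (G (1 / 2)) _ (G (- d0)) (G d0)); auto. }
  assert (N1 : H (1 / 2) * H (1 + d1) < 0).
  { apply (W _ (G (1 / 2)) _ (G (1 + d1)) (G (1 - d1))); auto; [|rewrite Rmult_comm; auto].
    now rewrite Rmult_comm. }
  destruct (nearest_zero H (1 / 2) (1 + d1) HH ltac:(lra) N1) as [t1 [Ht1 [E1 Z1]]].
  destruct (nearest_zero (fun t => H (- t)) (- (1 / 2)) d0) as [t0 [Ht0 [E0 Z0]]].
  { intros t. apply (continuous_comp Ropp H); [|apply HH].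
    apply (continuous_opp (fun t : R => t)), continuous_id. }
  { lra. }
  { now rewrite Ropp_involutive. }
  assert (T1 : 1 - d1 < t1).
  { apply Rnot_le_lt. intros Hle. specialize (Hmid t1 ltac:(lra)). rewrite E1 in Hmid. lra. }
  assert (T0 : - d0 < t0).
  { apply Rnot_le_lt. intros Hle. specialize (Hmid (- t0) ltac:(lra)). rewrite E0 in Hmid. lra. }
  exists (- t0), t1. split; [apply Rabs_def1; lra|]. split; [apply Rabs_def1; lra|].
  split; [exact E0|]. split; [exact E1|]. intros t Ht.
  destruct (Rle_dec (1 / 2) t).
  - apply Z1. lra.
  - pose proof (Z0 (- t) ltac:(lra)) as Hz. now rewrite Ropp_involutive in Hz.
Qed.

(** * The chart of a half-cone *)

Section Cone.
Variables (S : system) (a b : R) (th : R -> R).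
Hypothesis Hdeg : (1 < deg S)%nat.
Hypothesis Hlam : 0 < lam S.
Hypothesis Harc : connecting_arc S a b th.

Let Hcons : consecutive S a b := proj1 Harc.
Let Hth : trajectory_at_infinity S th := proj1 (proj2 Harc).
Let Hbtw : forall t, between a b (th t) := proj1 (proj2 (proj2 Harc)).
Let Hlima : is_lim th m_infty a := proj1 (proj2 (proj2 (proj2 Harc))).
Let Hlimb : is_lim th p_infty b := proj2 (proj2 (proj2 (proj2 Harc))).

Let Hga : g S a = 0 := proj1 (proj2 Hcons).
Let Hgb : g S b = 0 := proj1 (proj2 (proj2 Hcons)).
Let D := cone_interior a b.

Lemma arc_width x y : between a b x -> between a b y -> Rabs (x - y) < 2 * PI.
Proof.
  intros Hx Hy. pose proof (consecutive_width S a b (proj1 Harc)) as Hw. pose proof PI_RGT_0.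
  apply between_cases in Hx. apply between_cases in Hy.
  apply Rabs_le_between in Hw. apply Rabs_def1; lra.
Qed.

Lemma arc_end_width x : between a b x -> 0 < Rabs (x - a) < 2 * PI /\ 0 < Rabs (x - b) < 2 * PI.
Proof.
  intros Hx. pose proof (consecutive_width S a b (proj1 Harc)) as Hw. pose proof PI_RGT_0.
  apply between_cases in Hx. apply Rabs_le_between in Hw.
  repeat split; try (apply Rabs_pos_lt; lra); apply Rabs_def1; lra.
Qed.

Lemma arc_monotone :
  (forall s s', s < s' -> th s < th s') \/ (forall s s', s < s' -> th s' < th s).
Proof.
  assert (W : forall s s', s < s' -> 0 < (th s' - th s) * g S (th 0)).
  { intros s s' Hlt.
    destruct (mean_value th (fun u => g S (th u)) s s' Hlt) as [z [_ ->]]; [intros; apply Hth|].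
    pose proof (between_same_sign S a b (th z) (th 0) Hcons (Hbtw z) (Hbtw 0)). nra. }
  destruct (Rle_dec 0 (g S (th 0))); [left|right]; intros s s' Hlt; specialize (W s s' Hlt); nra.
Qed.

Lemma arc_injective s s' : th s = th s' -> s = s'.
Proof.
  intros E. destruct (Rtotal_order s s') as [H|[H|H]]; [|exact H|];
    destruct arc_monotone as [M|M]; apply M in H; lra.
Qed.

Lemma arc_surjective x : between a b x -> exists s, th s = x.
Proof.
  intros Hx. apply between_cases in Hx.
  assert (Hd : 0 < Rmin (Rabs (x - a)) (Rabs (x - b))).
  { apply Rmin_pos; apply Rabs_pos_lt; lra. }
  set (d := Rmin (Rabs (x - a)) (Rabs (x - b))) in *.
  pose proof (Rmin_l (Rabs (x - a)) (Rabs (x - b))).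
  pose proof (Rmin_r (Rabs (x - a)) (Rabs (x - b))). fold d in H, H0.
  destruct (angle_near_backward th a Hlima d Hd) as [s1 Hs1].
  destruct (angle_near_forward th b Hlimb d Hd) as [s2 Hs2].
  specialize (Hs1 (Rmin s1 s2) (Rmin_l _ _)). specialize (Hs2 (Rmax s1 s2) (Rmax_r _ _)).
  destruct (intermediate_value th (Rmin s1 s2) (Rmax s1 s2) x) as [s [_ Es]].
  - unfold Rmin, Rmax. destruct Rle_dec; lra.
  - intros; apply (flow_continuous S); exact Hth.
  - apply Rabs_def2 in Hs1. apply Rabs_def2 in Hs2.
    destruct Hx as [Hx|Hx].
    + rewrite (Rabs_right (x - a)) in H by lra. rewrite (Rabs_left (x - b)) in H0 by lra. lra.
    + rewrite (Rabs_left (x - a)) in H by lra. rewrite (Rabs_right (x - b)) in H0 by lra. lra.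
  - now exists s.
Qed.

Lemma arc_open s0 e : 0 < e ->
  exists d, 0 < d /\ forall x, Rabs (x - th s0) < d -> exists s, Rabs (s - s0) < e /\ th s = x.
Proof.
  intros He. set (u := th (s0 - e / 2)). set (v := th (s0 + e / 2)).
  assert (Hside : u < th s0 < v \/ v < th s0 < u).
  { unfold u, v. destruct arc_monotone as [H|H]; [left|right]; split; apply H; lra. }
  exists (Rmin (Rabs (u - th s0)) (Rabs (v - th s0))).
  split; [apply Rmin_pos; apply Rabs_pos_lt; lra|]. intros x Hx.
  destruct (intermediate_value th (s0 - e / 2) (s0 + e / 2) x) as [s [Hs Es]]; [lra| | |].
  - intros; now apply (flow_continuous S).
  - fold u v. apply Rabs_def2 in Hx. unfold Rmin, Rabs in Hx.
    repeat destruct Rcase_abs; destruct Rle_dec; lra.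
  - exists s. split; [apply Rabs_def1; lra|exact Es].
Qed.

Lemma chart_injective s s' w w' : 0 < w -> 0 < w' ->
  chart S th s w = chart S th s' w' -> s = s' /\ w = w'.
Proof.
  intros Hw Hw' E. apply polar_inj in E; try apply root_pos; [|now apply arc_width].
  destruct E as [E1 E2]. split; [now apply arc_injective|]. now apply (root_inj S).
Qed.

Lemma cone_chart z : cone_interior a b z <-> exists s w, 0 < w /\ z = chart S th s w.
Proof.
  split.
  - intros [r [x [Hr [Hx ->]]]]. destruct (arc_surjective x Hx) as [s <-].
    exists s, (r ^ (deg S - 1)). split; [now apply pow_lt|].
    unfold chart. now rewrite root_of_pow.
  - intros [s [w [Hw ->]]]. exists (root S w), (th s).
    split; [apply root_pos|]. split; [apply Hbtw|reflexivity].
Qed.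

(** Inequalities in the coordinates [s] and [w] therefore define open sets. *)
Lemma chart_open s0 w0 e : 0 < w0 -> 0 < e ->
  locally (chart S th s0 w0)
    (fun z => exists s w, Rabs (s - s0) < e /\ Rabs (w - w0) < e /\ 0 < w /\ z = chart S th s w).
Proof.
  intros Hw He. destruct (arc_open s0 e He) as [d1 [Hd1 H1]].
  destruct (near_point (fun r => r ^ (deg S - 1)) (root S w0) e) as [d2 [Hd2 H2]]; [|exact He|].
  { apply (ex_derive_continuous (fun r : R => r ^ (deg S - 1))).
    apply (ex_derive_pow (fun r : R => r)). apply ex_derive_id. }
  rewrite root_pow in H2 by auto.
  pose proof (polar_open (root S w0) (th s0) (Rmin d1 d2) (root_pos S w0) ltac:(now apply Rmin_pos)) as HL.
  pose proof (Rmin_l d1 d2). pose proof (Rmin_r d1 d2).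
  revert HL. apply filter_imp. intros z [r [x [Hr [Hx [Hr0 ->]]]]].
  destruct (H1 x ltac:(lra)) as [s [Hs Es]].
  exists s, (r ^ (deg S - 1)). split; [exact Hs|]. split; [apply H2; lra|].
  split; [now apply pow_lt|]. unfold chart. now rewrite root_of_pow, Es.
Qed.

(** * Regions bounded by leaves *)

Definition strip (m : R -> R) (I : R -> Prop) (z : R * R) : Prop :=
  exists s v, I v /\ z = chart S th s (v * m s).

(** In the coordinates [s] and [w / m s] the strip is the product of the line and of an
    interval: it is open because the chart is, and segments in it are paths. *)
Lemma strip_region (m : R -> R) (I : R -> Prop) :
  (forall s, 0 < m s) -> (forall s, continuous m s) ->
  (exists v, I v) -> (forall v, I v -> 0 < v) ->
  (forall v, I v -> locally v I) -> (forall u v x, I u -> I v -> u <= x <= v -> I x) ->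
  region (strip m I).
Proof.
  intros Hm Hmc [v0 Hv0] HIp HIo HIc. split; [|split].
  - exists (chart S th 0 (v0 * m 0)), 0, v0. now split.
  - intros z [s1 [v1 [Hv1 ->]]].
    set (q := fun p : R * R => snd p * / m (fst p)).
    pose proof (HIp v1 Hv1) as Hv1p. pose proof (Hm s1) as Hm1.
    assert (Hq : continuous q (s1, v1 * m s1)).
    { apply (continuous_mult (fun p : R * R => snd p) (fun p => / m (fst p))); [apply continuous_snd|].
      apply (continuous_comp (fun p : R * R => m (fst p)) Rinv).
      - apply (continuous_comp (fun p : R * R => fst p) m); [apply continuous_fst|apply Hmc].
      - apply (ex_derive_continuous Rinv). auto_derive. simpl. lra. }
    assert (Hq0 : q (s1, v1 * m s1) = v1) by (unfold q; simpl; field; lra).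
    pose proof (Hq I) as HL. rewrite Hq0 in HL. specialize (HL (HIo v1 Hv1)).
    destruct HL as [d Hd].
    pose proof (chart_open s1 (v1 * m s1) d ltac:(nra) (cond_pos d)) as HO.
    revert HO. apply filter_imp. intros z [s [w [Hs [Hw [Hw0 ->]]]]].
    exists s, (q (s, w)). split.
    + apply Hd. split; [exact Hs|exact Hw].
    + f_equal. unfold q; simpl. pose proof (Hm s). field. lra.
  - intros z w [s1 [v1 [Hv1 ->]]] [s2 [v2 [Hv2 ->]]].
    set (sp := fun t => s1 + unit_clamp t * (s2 - s1)).
    set (vp := fun t => v1 + unit_clamp t * (v2 - v1)).
    assert (HvI : forall t, I (vp t)).
    { intros t. pose proof (unit_clamp_bounds t). unfold vp. destruct (Rle_dec v1 v2).
      - apply (HIc v1 v2); auto. nra.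
      - apply (HIc v2 v1); auto. nra. }
    assert (Haff : forall x y t, continuous (fun t => x + unit_clamp t * (y - x)) t).
    { intros x y t. apply (continuous_plus (fun _ => x) (fun t => unit_clamp t * (y - x))).
      - apply continuous_const.
      - apply (continuous_mult unit_clamp (fun _ => y - x)); [apply unit_clamp_continuous|apply continuous_const]. }
    assert (Hspc : forall t, continuous sp t) by (intros; apply Haff).
    assert (Hrc : forall t, continuous (fun t => root S (vp t * m (sp t))) t).
    { intros t. apply (continuous_comp (fun t => vp t * m (sp t)) (root S)).
      - apply (continuous_mult vp (fun t => m (sp t))); [apply Haff|].
        apply (continuous_comp sp m); auto.
      - apply root_continuous; [exact Hdeg|]. pose proof (HIp _ (HvI t)). pose proof (Hm (sp t)). nra. }
    assert (Htc : forall t, continuous (fun t => th (sp t)) t).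
    { intros t. apply (continuous_comp sp th); [auto|]. now apply (flow_continuous S). }
    exists (fun t => chart S th (sp t) (vp t * m (sp t))). split; [|split; [|split]].
    + intros t. apply continuous_pair.
      * apply (continuous_mult (fun t => root S (vp t * m (sp t))) (fun t => cos (th (sp t)))); [apply Hrc|].
        apply (continuous_comp (fun t => th (sp t)) cos); [apply Htc|apply continuous_cos].
      * apply (continuous_mult (fun t => root S (vp t * m (sp t))) (fun t => sin (th (sp t)))); [apply Hrc|].
        apply (continuous_comp (fun t => th (sp t)) sin); [apply Htc|apply continuous_sin].
    + assert (E : unit_clamp 0 = 0) by (unfold unit_clamp, Rmax, Rmin; repeat destruct Rle_dec; lra).
      unfold sp, vp. rewrite E, !Rmult_0_l, !Rplus_0_r. reflexivity.
    + assert (E : unit_clamp 1 = 1) by (unfold unit_clamp, Rmax, Rmin; repeat destruct Rle_dec; lra).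
      unfold sp, vp. rewrite E, !Rmult_1_l. f_equal; [ring|f_equal; [ring|f_equal; ring]].
    + intros t _. exists (sp t), (vp t). split; [apply HvI|reflexivity].
Qed.

Definition below (c : R) (z : R * R) : Prop := exists c', c' < c /\ on_leaf S th c' z.
Definition above (c : R) (z : R * R) : Prop := exists c', c < c' /\ on_leaf S th c' z.

Lemma on_leaf_cone c z : on_leaf S th c z -> cone_interior a b z.
Proof. intros [s [Hs ->]]. apply cone_chart. exists s, (leaf_of S th c s). now split. Qed.

Lemma cone_on_leaf z : cone_interior a b z -> exists c, on_leaf S th c z.
Proof.
  intros Hz. apply cone_chart in Hz. destruct Hz as [s [w [Hw ->]]].
  destruct (chart_on_leaf S th s w Hw) as [c [_ Hc]]. now exists c.
Qed.

Lemma on_leaf_unique c c' z : on_leaf S th c z -> on_leaf S th c' z -> c = c'.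
Proof.
  intros [s [Hs ->]] [s' [Hs' E]]. apply chart_injective in E; auto. destruct E as [<- E].
  destruct (Rtotal_order c c') as [H|[H|H]]; [|exact H|];
    apply (leaf_of_lt S th _ _ s) in H; lra.
Qed.

Section Sides.
Variable c : R.
Hypothesis Hc : forall s, 0 < leaf_of S th c s.

Lemma below_strip : inter (cone_interior a b) (below c) = strip (leaf_of S th c) (fun v => 0 < v < 1).
Proof.
  apply functional_extensionality; intros z. apply propositional_extensionality. split.
  - intros [_ [c' [Hlt [s [Hs ->]]]]]. apply (leaf_of_lt S th _ _ s) in Hlt. pose proof (Hc s).
    assert (Hq : leaf_of S th c' s = leaf_of S th c' s / leaf_of S th c s * leaf_of S th c s)
      by (field; lra).
    exists s, (leaf_of S th c' s / leaf_of S th c s). split.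
    + split; [now apply Rdiv_lt_0_compat|]. nra.
    + now rewrite <- Hq.
  - intros [s [v [Hv ->]]]. pose proof (Hc s).
    destruct (chart_on_leaf S th s (v * leaf_of S th c s)) as [c' [E Hc']]; [nra|].
    split; [now apply (on_leaf_cone c')|]. exists c'. split; [|exact Hc'].
    apply (leaf_of_lt S th _ _ s). rewrite E. nra.
Qed.

Lemma above_strip : inter (cone_interior a b) (above c) = strip (leaf_of S th c) (fun v => 1 < v).
Proof.
  apply functional_extensionality; intros z. apply propositional_extensionality. split.
  - intros [_ [c' [Hlt [s [Hs ->]]]]]. apply (leaf_of_lt S th _ _ s) in Hlt. pose proof (Hc s).
    assert (Hq : leaf_of S th c' s = leaf_of S th c' s / leaf_of S th c s * leaf_of S th c s)
      by (field; lra).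
    exists s, (leaf_of S th c' s / leaf_of S th c s). split.
    + nra.
    + now rewrite <- Hq.
  - intros [s [v [Hv ->]]]. pose proof (Hc s).
    destruct (chart_on_leaf S th s (v * leaf_of S th c s)) as [c' [E Hc']]; [nra|].
    split; [now apply (on_leaf_cone c')|]. exists c'. split; [|exact Hc'].
    apply (leaf_of_lt S th _ _ s). rewrite E. nra.
Qed.

Lemma below_region : region (inter (cone_interior a b) (below c)).
Proof.
  rewrite below_strip. apply strip_region; auto.
  - intros. now apply leaf_of_continuous.
  - exists (1 / 2). lra.
  - intros; lra.
  - intros v [H0 H1]. apply filter_and; [now apply open_gt|now apply open_lt].
  - intros; lra.
Qed.

Lemma above_region : region (inter (cone_interior a b) (above c)).
Proof.
  rewrite above_strip. apply strip_region; auto.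
  - intros. now apply leaf_of_continuous.
  - exists 2. lra.
  - intros; lra.
  - intros v H1. now apply open_gt.
  - intros; lra.
Qed.

(** The three sets are unions of leaves, so it suffices to know the level of each leaf in
    them. *)
Lemma sides_separate (W A B : R * R -> Prop) :
  (forall c' z, on_leaf S th c' z ->
     (W z <-> c' = c) /\ (A z <-> c' < c) /\ (B z <-> c < c')) ->
  separates (cone_interior a b) W A B.
Proof.
  intros H. split; [|split].
  - apply (region_ext _ (below c)); [|apply below_region].
    intros z Hz. destruct (cone_on_leaf z Hz) as [c' Hc']. rewrite (proj1 (proj2 (H c' z Hc'))). split.
    + intros [c1 [Hlt H1]]. now rewrite (on_leaf_unique c' c1 z Hc' H1).
    + intros Hlt. now exists c'.
  - apply (region_ext _ (above c)); [|apply above_region].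
    intros z Hz. destruct (cone_on_leaf z Hz) as [c' Hc']. rewrite (proj2 (proj2 (H c' z Hc'))). split.
    + intros [c1 [Hlt H1]]. now rewrite (on_leaf_unique c' c1 z Hc' H1).
    + intros Hlt. now exists c'.
  - intros z Hz. destruct (cone_on_leaf z Hz) as [c' Hc']. destruct (H c' z Hc') as [-> [-> ->]]. lra.
Qed.
End Sides.

(** * Trajectories in the half-cone *)

Lemma leaf_exists c z : on_leaf S th c z -> exists T, follows S th c T /\ orbit T z.
Proof.
  intros [s [Hs ->]]. destruct (leaf_trajectory S th Hdeg Hlam Hth c s 0 Hs) as [T [HT [Ht E]]].
  exists T. split; [exact HT|]. now exists 0.
Qed.

Lemma cone_follows T t : trajectory S T -> time T t -> cone_interior a b (pos T t) ->
  exists c, follows S th c T /\ on_leaf S th c (pos T t).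
Proof.
  intros HT Ht Hz. destruct (cone_on_leaf _ Hz) as [c [s [Hs E]]]. exists c. split; [|now exists s].
  now apply (follows_of_point S th Hdeg Hlam Hth c T t s).
Qed.

Lemma on_leaf_follows T c z : trajectory S T -> orbit T z -> on_leaf S th c z -> follows S th c T.
Proof.
  intros HT [t [Ht <-]] [s [Hs E]]. now apply (follows_of_point S th Hdeg Hlam Hth c T t s).
Qed.

(** All trajectories through a point follow the leaf of that point. *)
Lemma basin_of_repulsion_leaf c z w w' : on_leaf S th c z ->
  (forall T, follows S th c T -> alpha_is T w') -> (basin_of_repulsion S w z <-> w = w').
Proof.
  intros Hz Ha. split.
  - intros [T [HT [HO HA]]]. apply (alpha_is_unique T); [exact HA|]. apply Ha.
    now apply (on_leaf_follows T c z).
  - intros ->. destruct (leaf_exists c z Hz) as [T [HT HO]]. exists T.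
    split; [apply HT|]. split; [exact HO|]. now apply Ha.
Qed.

Lemma ends_cos : cos (b - a) < 1.
Proof.
  pose proof (consecutive_width S a b Hcons) as Hw. pose proof PI_RGT_0.
  apply cos_lt_1; [intros E; apply (proj1 Hcons); lra|].
  rewrite Rabs_minus_sym. lra.
Qed.

(** The common omega-limit of all trajectories in the half-cone. *)
Definition target : R * R :=
  if Rlt_dec (f S b) 0 then poincare (radial_point S b) else infinity b.

Lemma follows_target c T : follows S th c T -> omega_is T target.
Proof.
  intros HT. unfold target. destruct (Rlt_dec (f S b) 0).
  - now apply (omega_equilibrium S th Hdeg Hlam Hth b Hlimb c).
  - apply (omega_infinity S th Hdeg Hlam Hth b Hlimb c); [lra|exact HT].
Qed.

Lemma cone_target : all_omega S D target.
Proof.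
  intros T t HT Ht HD. destruct (cone_follows T t HT Ht HD) as [c [Hc _]].
  now apply (follows_target c).
Qed.

Lemma target_polar : exists r, 0 < r <= 1 /\ target = polar r b.
Proof.
  unfold target. destruct (Rlt_dec (f S b) 0).
  - exists (shrink (root S (- lam S / f S b))). pose proof (root_pos S (- lam S / f S b)) as H.
    split; [|apply poincare_polar]. split; [now apply shrink_pos|].
    apply Rlt_le, shrink_bounds. lra.
  - exists 1. split; [lra|reflexivity].
Qed.

Lemma target_dot : dot a target < 1.
Proof.
  destruct target_polar as [r [Hr ->]]. rewrite dot_polar. pose proof ends_cos. nra.
Qed.

Lemma dot_self x : dot x (infinity x) = 1.
Proof. unfold infinity. rewrite dot_polar, Rminus_diag, cos_0. ring. Qed.

Lemma near_a e : 0 < e -> exists s, Rabs (th s - a) < e.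
Proof.
  intros He. destruct (angle_near_backward th a Hlima e He) as [s Hs]. exists s. apply Hs. lra.
Qed.

Lemma near_b e : 0 < e -> exists s, Rabs (th s - b) < e.
Proof.
  intros He. destruct (angle_near_forward th b Hlimb e He) as [s Hs]. exists s. apply Hs. lra.
Qed.

Lemma near_end x e : x = a \/ x = b \/ (exists t, x = th t) -> 0 < e -> exists s, Rabs (th s - x) < e.
Proof.
  intros [->|[->|[t ->]]] He; [now apply near_a|now apply near_b|].
  exists t. rewrite Rminus_diag, Rabs_R0. exact He.
Qed.

Lemma chart_in_cone s w : 0 < w -> D (polar (root S w) (th s)).
Proof. intros Hw. apply (cone_chart). exists s, w. now split. Qed.

Lemma cone_closure_infinity x : x = a \/ x = b \/ (exists t, x = th t) ->
  closure (disk_image D) (infinity x).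
Proof.
  intros Hx. apply (closure_infinity S); [exact Hdeg|]. intros e M He.
  destruct (near_end x e Hx He) as [s Hs]. exists (Rmax M 1), (th s).
  split; [apply Rmax_l|]. split; [exact Hs|]. apply chart_in_cone.
  pose proof (Rmax_r M 1). lra.
Qed.

Lemma cone_closure_finite x w : x = a \/ x = b -> 0 < w ->
  closure (disk_image D) (poincare (polar (root S w) x)).
Proof.
  intros Hx Hw. apply (closure_finite S); [exact Hdeg|exact Hw|]. intros e He.
  destruct (near_end x e ltac:(tauto) He) as [s Hs]. exists w, (th s).
  rewrite Rminus_diag, Rabs_R0. split; [exact He|]. split; [exact Hs|]. now apply chart_in_cone.
Qed.

(** * Boundary trajectories *)

Definition infinite_curve : curve := Curve (fun t => infinity (th t)) m_infty p_infty.

Lemma infinite_curve_omega w : omega_limit_set infinite_curve w <-> w = infinity b.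
Proof.
  revert w. apply omega_limit_set_intro; [exists 0; split; exact I|]. intros U HU.
  destruct (polar_near _ _ _ HU) as [e [He H]].
  destruct (angle_near_forward th b Hlimb e He) as [s Hs]. exists s. split; [split; exact I|].
  intros t _ Ht. apply H; [rewrite Rminus_diag, Rabs_R0; exact He|]. apply Hs. lra.
Qed.

Lemma infinite_curve_alpha w : alpha_limit_set infinite_curve w <-> w = infinity a.
Proof.
  revert w. apply alpha_limit_set_intro; [exists 0; split; exact I|]. intros U HU.
  destruct (polar_near _ _ _ HU) as [e [He H]].
  destruct (angle_near_backward th a Hlima e He) as [s Hs]. exists s. split; [split; exact I|].
  intros t _ Ht. apply H; [rewrite Rminus_diag, Rabs_R0; exact He|]. apply Hs. lra.
Qed.

Lemma end_not_inside x t : x = a \/ x = b -> th t <> x /\ Rabs (th t - x) < 2 * PI.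
Proof.
  intros Hx. destruct (arc_end_width (th t) (Hbtw t)) as [[A1 A2] [B1 B2]].
  destruct Hx as [-> | ->]; split; auto; intros E; rewrite E, Rminus_diag, Rabs_R0 in *; lra.
Qed.

Lemma boundary_infinite E x : x = a \/ x = b ->
  (forall t, closure (disk_image E) (infinity (th t))) ->
  boundary_trajectory S E (infinity x) infinite_curve.
Proof.
  intros Hx Hcl. split; [now apply infinite_trajectory|].
  intros t _. simpl pos. destruct (end_not_inside x t Hx) as [Hne Hlt]. split; [|split].
  - intros E1. apply polar_inj in E1; [tauto|lra|lra|exact Hlt].
  - apply Hcl.
  - intros [z [_ Ez]]. pose proof (sqnorm_poincare_lt z) as H. rewrite <- Ez, sqnorm_infinity in H. lra.
Qed.

Lemma poincare_not_infinity z x : poincare z <> infinity x.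
Proof. intros E. pose proof (sqnorm_poincare_lt z) as H. rewrite E, sqnorm_infinity in H. lra. Qed.

Lemma boundary_radial E x c T : x = a \/ x = b -> follows S (fun _ => x) c T ->
  (forall z, E z -> D z) ->
  (forall w, 0 < w -> closure (disk_image E) (poincare (polar (root S w) x))) ->
  boundary_trajectory S E (infinity x) (to_disk T).
Proof.
  intros Hx [HT [sg [Hp _]]] HE Hcl. split; [now apply finite_trajectory|].
  intros t Ht. simpl pos. destruct (Hp t Ht) as [Hpos Epos]. unfold chart in Epos.
  split; [apply poincare_not_infinity|]. rewrite Epos. split; [now apply Hcl|].
  intros [z [Hz Ez]]. apply poincare_inj in Ez. apply HE in Hz.
  apply (cone_chart) in Hz. destruct Hz as [s [w [Hw ->]]].
  destruct (end_not_inside x s Hx) as [Hne Hlt].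
  symmetry in Ez. apply polar_inj in Ez; auto using root_pos. tauto.
Qed.

Lemma radial_to_infinity x : g S x = 0 -> 0 <= f S x ->
  exists c T, follows S (fun _ => x) c T /\ omega_is T (infinity x).
Proof.
  intros Hg Hf. pose proof (constant_flow S x Hg) as Hc.
  destruct (chart_on_leaf S (fun _ => x) 0 1 ltac:(lra)) as [c [Ec _]].
  destruct (leaf_trajectory S _ Hdeg Hlam Hc c 0 0) as [T [HT _]]; [rewrite Ec; lra|].
  exists c, T. split; [exact HT|].
  apply (omega_infinity S _ Hdeg Hlam Hc x (is_lim_const x p_infty) c); auto.
Qed.

Lemma radial_from_infinity x : g S x = 0 -> f S x < 0 ->
  exists c T, follows S (fun _ => x) c T /\ alpha_is T (infinity x).
Proof.
  intros Hg Hf. pose proof (constant_flow S x Hg) as Hc.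
  destruct (lowest_leaf_exists_limit _ _ _ (rate_pos S Hdeg) Hlam (radial_rate_continuous S _ Hc)
     (f S x) (is_lim_const (f S x) m_infty) Hf) as [c0 H0].
  assert (Hp : 0 < leaf_of S (fun _ => x) (c0 + 1) 0).
  { apply leaf_of_pos. pose proof (proj1 H0 0). unfold height_of. lra. }
  destruct (leaf_trajectory S _ Hdeg Hlam Hc (c0 + 1) 0 0 Hp) as [T [HT _]].
  exists (c0 + 1), T. split; [exact HT|].
  apply (alpha_infinity S _ Hdeg Hlam Hc x (is_lim_const x m_infty) c0 (c0 + 1)); auto. lra.
Qed.

(** * Alpha-limits by level *)

Lemma alpha_below c0 c T : lowest_leaf_of S th c0 -> c < c0 -> follows S th c T ->
  alpha_is T (poincare origin).
Proof.
  intros H0 Hc HT. apply (alpha_origin S th Hdeg Hlam Hth c); [|exact HT].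
  destruct (proj2 H0 (c0 - c) ltac:(lra)) as [s Hs]. exists s.
  apply Rnot_lt_le. intros Hp. apply leaf_of_pos in Hp. unfold height_of in Hp. lra.
Qed.

Lemma alpha_unbounded c T : height_unbounded (rate S) (lam S) (radial_rate S th) ->
  follows S th c T -> alpha_is T (poincare origin).
Proof.
  intros H0 HT. apply (alpha_origin S th Hdeg Hlam Hth c); [|exact HT].
  destruct (H0 (- c)) as [s Hs]. exists s.
  apply Rnot_lt_le. intros Hp. apply leaf_of_pos in Hp. unfold height_of in Hp. lra.
Qed.

Lemma level_dichotomy :
  height_unbounded (rate S) (lam S) (radial_rate S th) \/ exists c0, lowest_leaf_of S th c0.
Proof. apply height_dichotomy; auto using rate_pos, radial_rate_continuous. Qed.

Lemma lowest_exists : f S a < 0 -> exists c0, lowest_leaf_of S th c0.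
Proof.
  intros Hf. apply (lowest_leaf_exists_limit _ _ _ (rate_pos S Hdeg) Hlam
    (radial_rate_continuous S th Hth) (f S a)); [now apply radial_rate_lim|exact Hf].
Qed.

Lemma lowest_pos c0 s : lowest_leaf_of S th c0 -> 0 < leaf_of S th c0 s.
Proof. intros [Hp _]. apply leaf_of_pos, Hp. Qed.

Lemma alpha_above c0 c T : lowest_leaf_of S th c0 -> c0 < c -> follows S th c T ->
  alpha_is T (infinity a).
Proof.
  intros H0 Hc HT. apply (alpha_infinity S th Hdeg Hlam Hth a Hlima c0 c T H0); auto.
Qed.

Lemma alpha_lowest_infinite c0 T : lowest_leaf_of S th c0 -> 0 <= f S a -> follows S th c0 T ->
  alpha_is T (infinity a).
Proof.
  intros H0 Hf HT. apply (alpha_infinity S th Hdeg Hlam Hth a Hlima c0 c0 T H0); auto.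
  right. split; [exact Hf|lra].
Qed.

Lemma alpha_lowest_finite c0 T : lowest_leaf_of S th c0 -> f S a < 0 -> follows S th c0 T ->
  alpha_is T (poincare (radial_point S a)).
Proof. intros H0 Hf HT. now apply (alpha_equilibrium S th Hdeg Hlam Hth a Hlima c0 T). Qed.

Lemma alpha_some c T : follows S th c T ->
  exists w, alpha_is T w /\ dot b w <= Rmax 0 (cos (a - b)).
Proof.
  intros HT. pose proof (Rmax_l 0 (cos (a - b))) as R1. pose proof (Rmax_r 0 (cos (a - b))) as R2.
  assert (HO : dot b (poincare origin) <= Rmax 0 (cos (a - b))) by (rewrite dot_origin; exact R1).
  assert (HI : dot b (infinity a) <= Rmax 0 (cos (a - b))).
  { unfold infinity. rewrite dot_polar, Rmult_1_l. exact R2. }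
  destruct level_dichotomy as [Hu|[c0 H0]].
  - exists (poincare origin). split; [now apply (alpha_unbounded c)|exact HO].
  - destruct (Rtotal_order c c0) as [Hc|[Hc|Hc]].
    + exists (poincare origin). split; [now apply (alpha_below c0 c)|exact HO].
    + subst c. destruct (Rlt_dec (f S a) 0) as [Hf|Hf].
      * exists (poincare (radial_point S a)). split; [now apply (alpha_lowest_finite c0)|].
        unfold radial_point. rewrite poincare_polar, dot_polar.
        pose proof (root_pos S (- lam S / f S a)) as Hr.
        destruct (shrink_bounds _ (Rlt_le _ _ Hr)) as [[S1 S2] _].
        destruct (Rle_dec 0 (cos (a - b))); nra.
      * exists (infinity a). split; [apply (alpha_lowest_infinite c0); auto; lra|exact HI].
    + exists (infinity a). split; [now apply (alpha_above c0 c)|exact HI].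
Qed.

(** * Sectors *)

Lemma leaves_cap E x e : 0 < e ->
  (forall T t, trajectory S T -> time T t -> E (pos T t) ->
     (exists w, alpha_is T w /\ dot x w < 1 - e) /\ (exists w, omega_is T w /\ dot x w < 1 - e)) ->
  exists U : R * R -> Prop, locally (infinity x) U /\
    forall (T : curve) (t : R), trajectory S T -> time T t ->
      E (pos T t) -> U (poincare (pos T t)) ->
      (exists s : R, time T s /\ s < t /\ ~ U (poincare (pos T s))) /\
      (exists s : R, time T s /\ t < s /\ ~ U (poincare (pos T s))).
Proof.
  intros He H. exists (cap x e). split; [now apply cap_locally|].
  intros T t HT Ht HE _. destruct (H T t HT Ht HE) as [[w1 [A1 B1]] [w2 [A2 B2]]]. split.
  - now apply (alpha_leaves_cap T x e w1).
  - now apply (omega_leaves_cap T x e w2).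
Qed.

Lemma line_attracting_plus : line_attracting S b a.
Proof.
  exists 1. split; [lra|]. intros x Hx _. apply between_sym in Hx.
  destruct (arc_surjective x Hx) as [s0 <-].
  exists (fun t => th (s0 + t)). split; [now rewrite Rplus_0_r|]. split.
  - intros t _. split; [apply between_sym, Hbtw|].
    eapply is_derive_eq.
    + apply (is_derive_comp th (fun t => s0 + t)); [apply Hth|].
      apply (is_derive_plus (fun _ => s0) (fun t => t)); [apply is_derive_const|apply is_derive_id].
    + unfold scal, plus, zero, one; simpl. unfold mult; simpl. ring.
  - apply is_lim_spec. intros eps.
    destruct (angle_near_forward th b Hlimb eps (cond_pos eps)) as [s Hs].
    exists (s - s0). intros t Ht. apply Hs. lra.
Qed.

Lemma line_repelling_minus : line_repelling S a b.
Proof.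
  exists 1. split; [lra|]. intros x Hx _.
  destruct (arc_surjective x Hx) as [s0 <-].
  exists (fun t => th (s0 - t)). split; [now rewrite Rminus_0_r|]. split.
  - intros t _. split; [apply Hbtw|].
    eapply is_derive_eq.
    + apply (is_derive_comp th (fun t => s0 - t)); [apply Hth|].
      apply (is_derive_minus (fun _ => s0) (fun t => t)); [apply is_derive_const|apply is_derive_id].
    + unfold scal, minus, plus, opp, zero, one; simpl. unfold mult; simpl. ring.
  - apply is_lim_spec. intros eps.
    destruct (angle_near_backward th a Hlima eps (cond_pos eps)) as [s Hs].
    exists (s0 - s). intros t Ht. apply Hs. lra.
Qed.

Lemma angle_plus_parabolic : 0 <= f S b -> angle S b a Pplus.
Proof.
  intros Hf. split; [apply line_attracting_plus|].
  split; [now apply radially_attracting_intro|]. left. rewrite cone_interior_sym.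
  split; [apply cone_closure_infinity; tauto|].
  exists (fun _ => True). split; [apply filter_true|]. left. intros T t HT Ht HD _.
  pose proof (cone_target T t HT Ht HD) as H. unfold target in H.
  destruct (Rlt_dec (f S b) 0); [lra|exact H].
Qed.

(** All trajectories end at the equilibrium on the radius, away from [infinity b]. The
    sector is bounded by the arc at infinity, which tends to [infinity b], and by the
    part of the radius beyond the equilibrium, which comes from it. *)
Lemma angle_plus_hyperbolic : f S b < 0 -> angle S b a Hminus.
Proof.
  intros Hf. split; [apply line_attracting_plus|].
  split; [now apply radially_repelling_intro|]. right. rewrite cone_interior_sym. fold D.
  split; [apply cone_closure_infinity; tauto|]. split; [|split].
  - pose proof ends_cos as Hc. rewrite <- cos_neg in Hc. replace (- (b - a)) with (a - b) in Hc by ring.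
    set (m := Rmax 0 (cos (a - b))). assert (Hm : m < 1) by (apply Rmax_lub_lt; lra).
    pose proof (root_pos S (- lam S / f S b)) as Hr.
    destruct (shrink_bounds _ (Rlt_le _ _ Hr)) as [[_ Hs] _].
    set (q := shrink (root S (- lam S / f S b))) in *.
    pose proof (Rmin_l ((1 - m) / 2) ((1 - q) / 2)). pose proof (Rmin_r ((1 - m) / 2) ((1 - q) / 2)).
    apply (leaves_cap D b (Rmin ((1 - m) / 2) ((1 - q) / 2))); [apply Rmin_pos; lra|].
    intros T t HT Ht HD. destruct (cone_follows T t HT Ht HD) as [c [Hfo _]].
    split.
    + destruct (alpha_some c T Hfo) as [w [A B]]. exists w. split; [exact A|]. fold m in B. lra.
    + exists target. split; [now apply (follows_target c)|]. unfold target.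
      destruct (Rlt_dec (f S b) 0); [|contradiction].
      unfold radial_point. rewrite poincare_polar, dot_polar, Rminus_diag, cos_0. fold q. lra.
  - exists infinite_curve. split; [|apply infinite_curve_omega].
    apply boundary_infinite; [tauto|]. intros t. apply cone_closure_infinity. right; right. now exists t.
  - destruct (radial_from_infinity b Hgb Hf) as [c [T [HT HA]]].
    exists (to_disk T). split; [|exact HA].
    apply (boundary_radial D b c); auto. intros w Hw. apply cone_closure_finite; tauto.
Qed.

Lemma arc_distance_increasing s s' : s < s' -> Rabs (th s - a) < Rabs (th s' - a).
Proof.
  intros Hlt. apply Rnot_le_lt. intros Hle.
  destruct (end_not_inside a s' ltac:(tauto)) as [Hne' _].
  assert (Hp : 0 < Rabs (th s' - a)) by (apply Rabs_pos_lt; lra).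
  destruct (angle_near_backward th a Hlima _ Hp) as [s1 Hs1].
  set (u := Rmin s1 s). specialize (Hs1 u (Rmin_l _ _)).
  assert (Hus : u <= s) by apply Rmin_r.
  destruct (intermediate_value th u s (th s')) as [v [Hv Ev]]; [exact Hus| | |].
  - intros; now apply (flow_continuous S).
  - pose proof (proj1 (between_cases _ _ _) (Hbtw u)) as B1.
    pose proof (proj1 (between_cases _ _ _) (Hbtw s)) as B2.
    pose proof (proj1 (between_cases _ _ _) (Hbtw s')) as B3.
    unfold Rabs in *. repeat destruct Rcase_abs; lra.
  - apply (arc_injective) in Ev. lra.
Qed.

(** The lowest leaf tends to a finite equilibrium, so only the leaves above it come close
    to [infinity a], and these tend to it. *)
Lemma angle_minus_parabolic : f S a < 0 -> angle S a b Pminus.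
Proof.
  intros Hf. split; [apply line_repelling_minus|].
  split; [now apply radially_repelling_intro|]. left. fold D.
  split; [apply cone_closure_infinity; tauto|].
  destruct (lowest_exists Hf) as [c0 H0].
  destruct (leaf_from_equilibrium _ _ _ (rate_pos S Hdeg) Hlam (radial_rate_continuous S th Hth)
    (f S a) (radial_rate_lim S th _ _ Hlima) c0 Hf H0 1 ltac:(lra)) as [s1 Hs1].
  fold (leaf_of S th) in Hs1.
  set (K := - lam S / f S a + 1).
  assert (HK : 0 < K) by (pose proof (proj1 (equilibrium_pos _ Hlam _ Hf)); unfold K; lra).
  pose proof (consecutive_width S a b Hcons) as Hw.
  assert (Hwid : forall s, Rabs (th s - a) <= PI).
  { intros s. pose proof (proj1 (between_cases _ _ _) (Hbtw s)).
    apply Rabs_le_between in Hw. apply Rabs_le. lra. }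
  destruct (cap_elim a (Rabs (th s1 - a)) (root S K)) as [d [Hd Hcap]].
  { split; [|apply Hwid]. destruct (end_not_inside a s1 ltac:(tauto)). apply Rabs_pos_lt. lra. }
  exists (cap a d). split; [now apply cap_locally|]. right. intros T t HT Ht HD HU.
  destruct (cone_follows T t HT Ht HD) as [c [Hfo [s [Hs E]]]].
  apply (alpha_above c0 c); auto. apply (leaf_of_lt S th c0 c s).
  rewrite E in HU. unfold chart in HU. apply Hcap in HU; [|apply root_pos|apply Hwid].
  destruct HU as [H1 H2].
  assert (Hss : s <= s1).
  { apply Rnot_lt_le. intros Hlt. pose proof (arc_distance_increasing s1 s Hlt). lra. }
  specialize (Hs1 s Hss). apply Rabs_le_between in Hs1.
  assert (K < leaf_of S th c s); [|unfold K in *; lra].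
  apply Rnot_le_lt. intros Hle. pose proof (root_le S _ _ Hdeg Hs Hle). lra.
Qed.

Lemma half_gap x w : dot x w < 1 -> exists e, 0 < e /\ dot x w < 1 - e /\ e < 1.
Proof.
  intros H. exists (Rmin ((1 - dot x w) / 2) (1 / 2)).
  pose proof (Rmin_l ((1 - dot x w) / 2) (1 / 2)). pose proof (Rmin_r ((1 - dot x w) / 2) (1 / 2)).
  split; [apply Rmin_pos; lra|lra].
Qed.

(** All trajectories come from the origin. The sector is bounded by the invariant radius,
    which tends to [infinity a], and by the arc at infinity. *)
Lemma angle_minus_hyperbolic : height_unbounded (rate S) (lam S) (radial_rate S th) ->
  0 <= f S a -> angle S a b Hplus.
Proof.
  intros Hu Hf. split; [apply line_repelling_minus|].
  split; [now apply radially_attracting_intro|]. right. fold D.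
  split; [apply cone_closure_infinity; tauto|]. split; [|split].
  - destruct (half_gap a target target_dot) as [e [He [Ht1 He1]]].
    apply (leaves_cap D a e He). intros T t HT Ht HD.
    destruct (cone_follows T t HT Ht HD) as [c [Hfo _]]. split.
    + exists (poincare origin). split; [now apply (alpha_unbounded c)|]. rewrite dot_origin. lra.
    + exists target. split; [now apply (follows_target c)|exact Ht1].
  - destruct (radial_to_infinity a Hga Hf) as [c [T [HT HA]]].
    exists (to_disk T). split; [|exact HA].
    apply (boundary_radial D a c); auto. intros w Hw. apply cone_closure_finite; tauto.
  - exists infinite_curve. split; [|apply infinite_curve_alpha].
    apply boundary_infinite; [tauto|]. intros t. apply cone_closure_infinity. right; right. now exists t.
Qed.

Lemma in_above c0 s w : leaf_of S th c0 s < w -> 0 < w -> inter D (above c0) (polar (root S w) (th s)).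
Proof.
  intros Hlt Hw. split; [now apply chart_in_cone|].
  destruct (chart_on_leaf S th s w Hw) as [c [Ec Hc]]. exists c. split; [|exact Hc].
  apply (leaf_of_lt S th c0 c s). now rewrite Ec.
Qed.

Lemma in_below c0 s w : w < leaf_of S th c0 s -> 0 < w -> inter D (below c0) (polar (root S w) (th s)).
Proof.
  intros Hlt Hw. split; [now apply chart_in_cone|].
  destruct (chart_on_leaf S th s w Hw) as [c [Ec Hc]]. exists c. split; [|exact Hc].
  apply (leaf_of_lt S th c c0 s). now rewrite Ec.
Qed.

Lemma above_closure_infinity c0 x : x = a \/ x = b \/ (exists t, x = th t) ->
  closure (disk_image (inter D (above c0))) (infinity x).
Proof.
  intros Hx. apply (closure_infinity S); [exact Hdeg|]. intros e M He.
  destruct (near_end x e Hx He) as [s Hs].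
  exists (Rmax M (Rmax 1 (leaf_of S th c0 s + 1))), (th s).
  pose proof (Rmax_l M (Rmax 1 (leaf_of S th c0 s + 1))).
  pose proof (Rmax_r M (Rmax 1 (leaf_of S th c0 s + 1))).
  pose proof (Rmax_l 1 (leaf_of S th c0 s + 1)). pose proof (Rmax_r 1 (leaf_of S th c0 s + 1)).
  split; [lra|]. split; [exact Hs|]. apply in_above; lra.
Qed.

Lemma lowest_large c0 : lowest_leaf_of S th c0 -> 0 <= f S a -> forall e M, 0 < e ->
  exists s, Rabs (th s - a) < e /\ M < leaf_of S th c0 s.
Proof.
  intros H0 Hf e M He.
  destruct (leaf_from_infinity_any S th Hdeg Hlam Hth a Hlima c0 c0 H0) with (M := M + 1) as [s2 H2].
  { right. split; [exact Hf|lra]. }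
  destruct (angle_near_backward th a Hlima e He) as [s3 H3].
  exists (Rmin s2 s3). split; [apply H3, Rmin_r|].
  specialize (H2 (Rmin s2 s3) (Rmin_l _ _)). lra.
Qed.

(** The leaves below the lowest one come from the origin, but they are squeezed between
    the invariant radius and the lowest leaf, which both have [infinity a] as a limit. *)
Lemma below_hyperbolic c0 : lowest_leaf_of S th c0 -> 0 <= f S a ->
  hyperbolic_sector S (inter D (below c0)) (infinity a).
Proof.
  intros H0 Hf.
  assert (Hsub : forall z, inter D (below c0) z -> D z) by (intros z [Hz _]; exact Hz).
  split; [|split; [|split]].
  - apply (closure_infinity S); [exact Hdeg|]. intros e M He.
    pose proof (Rmax_l M 1). pose proof (Rmax_r M 1).
    destruct (lowest_large c0 H0 Hf e (Rmax M 1) He) as [s [Hs1 Hs2]].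
    exists (Rmax M 1), (th s). split; [lra|]. split; [exact Hs1|]. apply in_below; lra.
  - destruct (half_gap a target target_dot) as [e [He [Ht1 He1]]].
    apply (leaves_cap _ a e He). intros T t HT Ht [HD [c' [Hc' Hon]]].
    assert (Hfo : follows S th c' T).
    { apply (on_leaf_follows T c' (pos T t)); auto. now exists t. }
    split.
    + exists (poincare origin). split; [now apply (alpha_below c0 c')|]. rewrite dot_origin. lra.
    + exists target. split; [now apply (follows_target c')|exact Ht1].
  - destruct (radial_to_infinity a Hga Hf) as [c [T [HT HA]]].
    exists (to_disk T). split; [|exact HA].
    apply (boundary_radial _ a c); auto. intros w Hw.
    apply (closure_finite S); auto. intros e He.
    destruct (lowest_large c0 H0 Hf e w He) as [s [Hs1 Hs2]].
    exists w, (th s). rewrite Rminus_diag, Rabs_R0. split; [exact He|]. split; [exact Hs1|].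
    now apply in_below.
  - (* the separatrix itself leaves [infinity a] along the sector *)
    destruct (leaf_trajectory S th Hdeg Hlam Hth c0 0 0 (lowest_pos c0 0 H0)) as [T [HT _]].
    exists (to_disk T). split; [|exact (alpha_lowest_infinite c0 T H0 Hf HT)].
    split; [apply finite_trajectory, HT|]. intros t Ht. simpl pos.
    split; [apply poincare_not_infinity|].
    destruct HT as [HT [sg [Hp _]]]. destruct (Hp t Ht) as [Hpos Epos]. rewrite Epos. split.
    + apply (closure_finite S); auto. intros e He.
      set (w := leaf_of S th c0 (sg t)) in *.
      exists (w - Rmin (e / 2) (w / 2)), (th (sg t)).
      pose proof (Rmin_l (e / 2) (w / 2)). pose proof (Rmin_r (e / 2) (w / 2)).
      assert (0 < Rmin (e / 2) (w / 2)) by (apply Rmin_pos; lra).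
      split; [apply Rabs_def1; lra|]. split; [rewrite Rminus_diag, Rabs_R0; exact He|].
      apply in_below; fold w; lra.
    + intros [z [[_ [c' [Hc' Hon]]] Ez]]. apply poincare_inj in Ez. subst z.
      assert (c0 = c'); [|lra].
      apply (on_leaf_unique c0 c' _) with (2 := Hon).
      exists (sg t). now split.
Qed.

Lemma above_parabolic c0 : lowest_leaf_of S th c0 ->
  parabolic_sector S (inter D (above c0)) (infinity a).
Proof.
  intros H0. split; [apply above_closure_infinity; tauto|].
  exists (fun _ => True). split; [apply filter_true|]. right.
  intros T t HT Ht [HD [c' [Hc' Hon]]] _. apply (alpha_above c0 c'); auto.
  apply (on_leaf_follows T c' (pos T t)); auto. now exists t.
Qed.

Lemma lowest_separatrix c0 T : lowest_leaf_of S th c0 -> 0 <= f S a -> follows S th c0 T ->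
  sector_separatrix S D (infinity a) T.
Proof.
  intros H0 Hf HT. split; [apply HT|]. split; [|split].
  - intros z Hz. apply (follows_orbit S th c0 T z HT) in Hz.
    now apply (on_leaf_cone c0).
  - right. now apply (alpha_lowest_infinite c0).
  - exists (above c0), (below c0).
    split; [|split; [now apply above_parabolic|now apply below_hyperbolic]].
    destruct (sides_separate c0 (fun s => lowest_pos c0 s H0)
       (orbit T) (below c0) (above c0)) as [R1 [R2 R3]].
    { intros c' z Hz. rewrite (follows_orbit S th c0 T z HT). split; [|split].
      - split; [intros Hz'; now apply (on_leaf_unique c' c0 z)|now intros <-].
      - split; [|intros Hlt; now exists c'].
        intros [c1 [Hlt H1]]. now rewrite (on_leaf_unique c' c1 z Hz H1).
      - split; [|intros Hlt; now exists c'].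
        intros [c1 [Hlt H1]]. now rewrite (on_leaf_unique c' c1 z Hz H1). }
    split; [exact R2|]. split; [exact R1|]. intros z Hz. specialize (R3 z Hz). tauto.
Qed.

Lemma angle_minus_two_sectors c0 : lowest_leaf_of S th c0 -> 0 <= f S a -> angle S a b H0plus.
Proof.
  intros H0 Hf. split; [apply line_repelling_minus|].
  split; [now apply radially_attracting_intro|].
  destruct (leaf_trajectory S th Hdeg Hlam Hth c0 0 0 (lowest_pos c0 0 H0)) as [T [HT _]].
  exists T. now apply (lowest_separatrix c0).
Qed.

(** * The type of an angle determines its dynamics *)

Lemma target_not_a : target <> infinity a.
Proof. intros E. pose proof target_dot as H. rewrite E, dot_self in H. lra. Qed.

Lemma origin_not_infinity x : poincare origin <> infinity x.
Proof. apply poincare_not_infinity. Qed.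

(** A path that stays on one side of a leaf cannot pass from one of two disjoint open sets
    to the other. *)
Lemma side_in_part (P A B : R * R -> Prop) W : separates D W A B ->
  region (inter D P) -> (forall z, D z -> P z -> ~ W z) ->
  (forall z, inter D P z -> inter D A z) \/ (forall z, inter D P z -> inter D B z).
Proof.
  intros [[_ [HA _]] [[_ [HB _]] Hcov]] [[z0 Hz0] [_ Hpc]] HW.
  assert (Hone : forall z, inter D P z -> (inter D A z \/ inter D B z) /\ ~ (inter D A z /\ inter D B z)).
  { intros z [Hz HP]. specialize (HW z Hz HP). specialize (Hcov z Hz). unfold inter. tauto. }
  destruct (Hone z0 Hz0) as [[H|H] _]; [left|right]; intros z Hz;
    destruct (Hpc z0 z Hz0 Hz) as [c [Hc [E0 [E1 Hin]]]]; rewrite <- E1.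
  - apply (path_stays c (inter D A) (inter D B)).
    + exact Hc.
    + intros t _. apply HA.
    + intros t _. apply HB.
    + intros t Ht. apply (Hone (c t) (Hin t Ht)).
    + now rewrite E0.
  - apply (path_stays c (inter D B) (inter D A)).
    + exact Hc.
    + intros t _. apply HB.
    + intros t _. apply HA.
    + intros t Ht. specialize (Hone (c t) (Hin t Ht)). tauto.
    + now rewrite E0.
Qed.

(** Backward in time such a leaf eventually stays in every neighbourhood of [infinity a],
    whereas the trajectories of a hyperbolic sector leave one. *)
Lemma not_hyperbolic E c0 c : lowest_leaf_of S th c0 -> c0 < c \/ 0 <= f S a /\ c0 <= c ->
  (forall z, on_leaf S th c z -> E z) -> ~ hyperbolic_sector S E (infinity a).
Proof.
  intros H0 Hc HE [_ [[U [HU Hout]] _]].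
  destruct (near_infinity S Hdeg a U HU) as [e [M [He [HM Hin]]]].
  destruct (leaf_from_infinity_any S th Hdeg Hlam Hth a Hlima c0 c H0 Hc M) as [s2 H2].
  destruct (angle_near_backward th a Hlima e He) as [s3 H3].
  set (s1 := Rmin s2 s3).
  assert (HU1 : forall s, s <= s1 -> U (poincare (chart S th s (leaf_of S th c s)))).
  { intros s Hs. pose proof (Rmin_l s2 s3). pose proof (Rmin_r s2 s3). unfold s1 in Hs.
    apply Hin; [apply H2; lra|apply H3; lra]. }
  assert (Hp : 0 < leaf_of S th c s1) by (specialize (H2 s1 (Rmin_l _ _)); lra).
  destruct (leaf_trajectory S th Hdeg Hlam Hth c s1 0 Hp) as [T [[HT [sg [Hsg [Hinc Honto]]]] _]].
  destruct (Honto s1 Hp) as [t1 [Ht1 E1]].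
  destruct (Hsg t1 Ht1) as [Hp1 Ep1].
  destruct (Hout T t1 HT Ht1) as [[s [Hs [Hlt Hn]]] _].
  - apply HE. exists (sg t1). now split.
  - rewrite Ep1. apply HU1. lra.
  - apply Hn. rewrite (proj2 (Hsg s Hs)). apply HU1. rewrite <- E1. left. now apply Hinc.
Qed.

(** A lower leaf does not tend to [infinity a]. A higher one does, but there are such
    leaves on both of its sides, so that neither side is hyperbolic. *)
Lemma separatrix_lowest c0 T : lowest_leaf_of S th c0 -> 0 <= f S a ->
  sector_separatrix S D (infinity a) T -> follows S th c0 T.
Proof.
  intros H0 Hf [HT [HD [Hlim [A [B [Hsep [_ Hhyp]]]]]]].
  destruct (time_inhabited S T HT) as [t Ht].
  destruct (cone_follows T t HT Ht) as [c [Hc _]].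
  { apply HD. now exists t. }
  destruct (Rtotal_order c c0) as [Hlt|[->|Hlt]]; [exfalso|exact Hc|exfalso].
  - destruct Hlim as [Hlim|Hlim].
    + apply target_not_a. apply (omega_is_unique T); [now apply (follows_target c)|exact Hlim].
    + apply (origin_not_infinity a). apply (alpha_is_unique T); [now apply (alpha_below c0 c)|exact Hlim].
  - assert (Hpos : forall s, 0 < leaf_of S th c s).
    { intros s. pose proof (lowest_pos c0 s H0). pose proof (proj1 (leaf_of_lt S th c0 c s) Hlt). lra. }
    assert (Honleaf : forall c' z, on_leaf S th c' z -> c' <> c -> ~ orbit T z).
    { intros c' z Hz Hne HO. apply Hne. apply (follows_orbit S th c T z Hc) in HO.
      now apply (on_leaf_unique c' c z). }
    destruct (side_in_part (below c) A B (orbit T) Hsep) as [HA|HB].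
    { now apply (below_region). }
    { intros z _ [c' [Hc' Hz]]. apply (Honleaf c'); auto; lra. }
    + destruct (side_in_part (above c) A B (orbit T) Hsep) as [HA'|HB].
      { now apply (above_region). }
      { intros z _ [c' [Hc' Hz]]. apply (Honleaf c'); auto; lra. }
      * (* the part [B] would be empty *)
        destruct Hsep as [[[z0 [Dz0 Az0]] _] [[[z [Dz Bz]] _] Hcov]].
        destruct (cone_on_leaf z Dz) as [c' Hz].
        specialize (Hcov z Dz).
        destruct (Rtotal_order c' c) as [Hcc|[->|Hcc]].
        -- assert (HAz : inter D A z) by (apply HA; split; [exact Dz|]; now exists c').
           destruct HAz. tauto.
        -- assert (HO : orbit T z) by now apply (follows_orbit S th c T z Hc).
           tauto.
        -- assert (HAz : inter D A z) by (apply HA'; split; [exact Dz|]; now exists c').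
           destruct HAz. tauto.
      * revert Hhyp. apply (not_hyperbolic _ c0 (c + 1)); [exact H0|left; lra|].
        intros z Hz. apply HB. split; [now apply (on_leaf_cone (c + 1))|].
        exists (c + 1). split; [lra|exact Hz].
    + revert Hhyp. apply (not_hyperbolic _ c0 ((c0 + c) / 2)); [exact H0|left; lra|].
      intros z Hz. apply HB. split; [now apply (on_leaf_cone ((c0 + c) / 2))|].
      exists ((c0 + c) / 2). split; [lra|exact Hz].
Qed.

Lemma plus_parabolic_elim : angle S b a Pplus -> 0 <= f S b.
Proof. intros [_ [H _]]. now apply radially_attracting_elim. Qed.

Lemma plus_hyperbolic_elim : angle S b a Hminus -> f S b < 0.
Proof. intros [_ [H _]]. now apply radially_repelling_elim. Qed.

Lemma minus_parabolic_elim : angle S a b Pminus -> f S a < 0.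
Proof. intros [_ [H _]]. now apply radially_repelling_elim. Qed.

(** Next to a lowest leaf that tends to [infinity a], the leaves below it come close to
    [infinity a] without tending to it. *)
Lemma minus_hyperbolic_elim : angle S a b Hplus ->
  0 <= f S a /\ height_unbounded (rate S) (lam S) (radial_rate S th).
Proof.
  intros [_ [H Hone]]. pose proof (radially_attracting_elim S a Hdeg Hlam H) as Hf.
  split; [exact Hf|]. destruct level_dichotomy as [Hu|[c0 H0]]; [exact Hu|exfalso].
  destruct Hone as [[_ [U [HU Hpar]]]|Hhyp].
  - destruct (near_infinity S Hdeg a U HU) as [e [M [He [HM Hin]]]].
    destruct (lowest_large c0 H0 Hf e M He) as [s [Hs1 Hs2]].
    destruct (in_below c0 s M Hs2 HM) as [HD [c [Hc Hon]]].
    destruct (leaf_exists c _ Hon) as [T [HT [t [Ht E]]]].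
    destruct Hpar as [Hpar|Hpar]; specialize (Hpar T t (proj1 HT) Ht); rewrite E in Hpar;
      specialize (Hpar HD (Hin M (th s) (Rle_refl _) Hs1)).
    + apply target_not_a. apply (omega_is_unique T); [now apply (follows_target c)|exact Hpar].
    + apply (origin_not_infinity a). apply (alpha_is_unique T); [now apply (alpha_below c0 c)|exact Hpar].
  - revert Hhyp. apply (not_hyperbolic _ c0 (c0 + 1)); [exact H0|left; lra|].
    intros z Hz. now apply (on_leaf_cone (c0 + 1)).
Qed.

(** If [height] is unbounded, all trajectories come from the origin, and none of them has
    [infinity a] as a limit. *)
Lemma minus_two_sectors_elim : angle S a b H0plus -> 0 <= f S a /\ exists c0, lowest_leaf_of S th c0.
Proof.
  intros [_ [H [T [HT [HD [Hlim _]]]]]]. pose proof (radially_attracting_elim S a Hdeg Hlam H) as Hf.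
  split; [exact Hf|]. destruct level_dichotomy as [Hu|H0]; [exfalso|exact H0].
  destruct (time_inhabited S T HT) as [t Ht].
  destruct (cone_follows T t HT Ht) as [c [Hc _]].
  { apply HD. now exists t. }
  destruct Hlim as [Hlim|Hlim].
  - apply target_not_a. apply (omega_is_unique T); [now apply (follows_target c)|exact Hlim].
  - apply (origin_not_infinity a). apply (alpha_is_unique T); [now apply (alpha_unbounded c)|exact Hlim].
Qed.

Lemma arc_direction m : between a b m -> 0 < (b - a) * g S m.
Proof.
  intros Hm. destruct (arc_surjective m Hm) as [s2 E2].
  pose proof (proj1 (between_cases _ _ _) Hm) as Hmc.
  destruct (near_a (Rabs (m - a))) as [s Hs]; [apply Rabs_pos_lt; lra|].
  assert (Hlt : s < s2).
  { apply Rnot_le_lt. intros [Hle|Hle].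
    - pose proof (arc_distance_increasing s2 s Hle) as H. rewrite E2 in H. lra.
    - rewrite <- Hle, E2 in Hs. lra. }
  destruct (mean_value th (fun u => g S (th u)) s s2 Hlt) as [z [_ Hz]]; [intros; apply Hth|].
  pose proof (between_same_sign S a b (th z) m Hcons (Hbtw z) Hm) as Hsg.
  pose proof (proj1 (between_cases _ _ _) (Hbtw s)) as Hsc. rewrite E2 in Hz.
  assert (Hz2 : 0 < (b - a) * g S (th z)).
  { destruct Hmc as [Hmc|Hmc].
    - rewrite (Rabs_right (m - a)) in Hs by lra. rewrite Rabs_right in Hs by lra. nra.
    - rewrite (Rabs_left (m - a)) in Hs by lra. rewrite Rabs_left in Hs by lra. nra. }
  nra.
Qed.

End Cone.

(** * Robustness *)

Lemma hpoly_close n c c' d x y : (forall k, (k <= n)%nat -> Rabs (c' k - c k) < d) ->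
  Rabs x <= 1 -> Rabs y <= 1 -> Rabs (hpoly n c' x y - hpoly n c x y) <= INR (Datatypes.S n) * d.
Proof.
  intros Hc Hx Hy.
  assert (Hpow : forall z k, Rabs z <= 1 -> Rabs (z ^ k) <= 1).
  { intros z k Hz. rewrite <- RPow_abs, <- (pow1 k). apply pow_incr. split; [apply Rabs_pos|exact Hz]. }
  assert (W : forall m, (m <= n)%nat ->
    Rabs (sum_f_R0 (fun k => c' k * x ^ k * y ^ (n - k)) m - sum_f_R0 (fun k => c k * x ^ k * y ^ (n - k)) m)
      <= INR (Datatypes.S m) * d).
  { assert (Hterm : forall k, (k <= n)%nat ->
       Rabs (c' k * x ^ k * y ^ (n - k) - c k * x ^ k * y ^ (n - k)) <= d).
    { intros k Hk. replace (_ - _) with ((c' k - c k) * (x ^ k * y ^ (n - k))) by ring.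
      rewrite !Rabs_mult. pose proof (Hpow x k Hx). pose proof (Hpow y (n - k)%nat Hy).
      pose proof (Rabs_pos (c' k - c k)). pose proof (Rabs_pos (x ^ k)). pose proof (Rabs_pos (y ^ (n - k))).
      specialize (Hc k Hk). assert (Rabs (x ^ k) * Rabs (y ^ (n - k)) <= 1) by nra.
      assert (0 <= Rabs (x ^ k) * Rabs (y ^ (n - k))) by nra. nra. }
    induction m as [|m IH]; intros Hm.
    - simpl sum_f_R0. rewrite Rmult_1_l. now apply Hterm.
    - rewrite S_INR, !tech5. specialize (IH ltac:(lia)). specialize (Hterm (Datatypes.S m) Hm).
      match goal with |- Rabs (?A + ?B - (?C + ?E)) <= _ =>
        replace (A + B - (C + E)) with ((A - C) + (B - E)) by ring end.
      eapply Rle_trans; [apply Rabs_triang|]. lra. }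
  now apply W.
Qed.

Definition coefficient_bound (S : system) : R := 2 * INR (Datatypes.S (deg S)).

Lemma coefficient_bound_pos S : 0 < coefficient_bound S.
Proof. unfold coefficient_bound. pose proof (lt_0_INR (Datatypes.S (deg S)) ltac:(lia)). lra. Qed.

Lemma fg_close S S' d x : close_system d S S' ->
  Rabs (f S' x - f S x) <= coefficient_bound S * d /\ Rabs (g S' x - g S x) <= coefficient_bound S * d.
Proof.
  intros [Ed [_ Hc]]. unfold f, g, Q1, Q2, coefficient_bound. rewrite Ed.
  destruct (cos_sin_abs x) as [Hx Hy].
  pose proof (hpoly_close (deg S) (coef1 S) (coef1 S') d (cos x) (sin x)
     (fun k Hk => proj1 (Hc k Hk)) Hx Hy) as H1.
  pose proof (hpoly_close (deg S) (coef2 S) (coef2 S') d (cos x) (sin x)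
     (fun k Hk => proj2 (Hc k Hk)) Hx Hy) as H2.
  set (q1 := hpoly _ (coef1 S) _ _) in *. set (q2 := hpoly _ (coef2 S) _ _) in *.
  set (q1' := hpoly _ (coef1 S') _ _) in *. set (q2' := hpoly _ (coef2 S') _ _) in *.
  pose proof (Rabs_pos (q1' - q1)). pose proof (Rabs_pos (q2' - q2)).
  pose proof (Rabs_pos (cos x)). pose proof (Rabs_pos (sin x)). split.
  - replace (_ - _) with (cos x * (q1' - q1) + sin x * (q2' - q2)) by ring.
    eapply Rle_trans; [apply Rabs_triang|]. rewrite !Rabs_mult. nra.
  - replace (_ - _) with (cos x * (q2' - q2) + - (sin x * (q1' - q1))) by ring.
    eapply Rle_trans; [apply Rabs_triang|]. rewrite Rabs_Ropp, !Rabs_mult. nra.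
Qed.

Lemma radial_point_near S x eps : (1 < deg S)%nat -> 0 < lam S -> f S x < 0 -> 0 < eps ->
  exists e, 0 < e /\ forall S' x', deg S' = deg S -> Rabs (lam S' - lam S) < e ->
    Rabs (f S' x' - f S x) < e -> Rabs (x' - x) < e ->
    0 < lam S' /\ f S' x' < 0 /\ ball (radial_point S x) eps (radial_point S' x').
Proof.
  intros Hd Hl Hf Heps. pose proof (proj1 (equilibrium_pos _ Hl _ Hf)) as Hq.
  destruct (polar_near (root S (- lam S / f S x)) x (ball (radial_point S x) eps)) as [e1 [He1 H1]].
  { exact (locally_ball (radial_point S x) (mkposreal eps Heps)). }
  assert (Hc : continuous (fun p : R * R => root S (- fst p / snd p)) (lam S, f S x)).
  { apply (continuous_comp (fun p : R * R => - fst p / snd p) (root S)).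
    - apply (continuous_mult (fun p : R * R => - fst p) (fun p => / snd p)).
      + apply (continuous_opp (fun p : R * R => fst p)), continuous_fst.
      + apply (continuous_comp (fun p : R * R => snd p) Rinv); [apply continuous_snd|].
        apply (ex_derive_continuous Rinv). auto_derive. simpl. lra.
    - apply root_continuous; [exact Hd|exact Hq]. }
  destruct (proj1 (filterlim_locally _ _) Hc (mkposreal e1 He1)) as [d Hdd]. pose proof (cond_pos d).
  set (e := Rmin (Rmin d e1) (Rmin (lam S) (- f S x))).
  assert (He : e <= d /\ e <= e1 /\ e <= lam S /\ e <= - f S x).
  { unfold e. pose proof (Rmin_l (Rmin d e1) (Rmin (lam S) (- f S x))).
    pose proof (Rmin_r (Rmin d e1) (Rmin (lam S) (- f S x))).
    pose proof (Rmin_l d e1). pose proof (Rmin_r d e1).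
    pose proof (Rmin_l (lam S) (- f S x)). pose proof (Rmin_r (lam S) (- f S x)). lra. }
  exists e. split; [repeat apply Rmin_pos; lra|].
  intros S' x' Ed L1 L2 L3.
  split; [apply Rabs_def2 in L1; lra|]. split; [apply Rabs_def2 in L2; lra|].
  replace (radial_point S' x') with (polar (root S (- lam S' / f S' x')) x').
  2: { unfold radial_point, root, rate. now rewrite Ed. }
  apply H1; [|lra]. apply (Hdd (lam S', f S' x')).
  split; unfold ball; simpl; unfold AbsRing_ball, abs, minus, plus, opp; simpl; unfold Rminus in *; lra.
Qed.

Lemma equilibria_connection S a b th : (1 < deg S)%nat -> 0 < lam S -> connecting_arc S a b th ->
  f S a < 0 -> f S b < 0 -> forall c0 T, lowest_leaf_of S th c0 -> follows S th c0 T ->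
  connection S (cone_interior a b) (radial_point S a) (radial_point S b) T.
Proof.
  intros Hd Hl Harc Ha Hb c0 T H0 HT. split; [apply HT|]. split; [|split].
  - intros z Hz. apply (follows_orbit S th c0 T z HT) in Hz.
    now apply (on_leaf_cone S a b th Hd Harc c0).
  - now apply (alpha_lowest_finite S a b th Hd Hl Harc c0).
  - pose proof (follows_target S a b th Hd Hl Harc c0 T HT) as H. unfold target in H.
    destruct (Rlt_dec (f S b) 0); [exact H|contradiction].
Qed.

(** The sign of [g] at one point [m] of the arc determines the direction of the flow at
    infinity, hence which end of the arc is the source. *)
Lemma connected_near_intro S a b m p1 p2 eps : (1 < deg S)%nat -> 0 < lam S ->
  consecutive S a b -> between a b m -> 0 < (b - a) * g S m -> f S a < 0 -> f S b < 0 ->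
  ball p1 eps (radial_point S a) -> ball p2 eps (radial_point S b) ->
  connected_near S a b p1 p2 eps.
Proof.
  intros Hd Hl Hcons Hm Hdir Ha Hb B1 B2.
  destruct (arc_exists S a b m Hcons Hm Hdir) as [th Harc].
  destruct (lowest_exists S a b th Hd Hl Harc Ha) as [c0 H0].
  destruct (leaf_trajectory S th Hd Hl (proj1 (proj2 Harc)) c0 0 0
     (lowest_pos S th c0 0 H0)) as [T [HT _]].
  exists (radial_point S a), (radial_point S b).
  split; [apply radial_equilibrium_exists; auto; apply Hcons|].
  split; [apply radial_equilibrium_exists; auto; apply Hcons|].
  split; [exact B1|]. split; [exact B2|]. exists T.
  now apply (equilibria_connection S a b th Hd Hl Harc Ha Hb c0).
Qed.

Lemma ex_derive_g S x : ex_derive (g S) x.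
Proof.
  assert (Hh : forall n c, ex_derive (fun x => hpoly n c (cos x) (sin x)) x).
  { intros n c. unfold hpoly.
    assert (W : forall m, ex_derive (fun x => sum_f_R0 (fun k => c k * cos x ^ k * sin x ^ (n - k)) m) x).
    { induction m as [|m IH]; simpl sum_f_R0; [auto_derive; exact I|].
      apply (ex_derive_plus (fun x => sum_f_R0 (fun k => c k * cos x ^ k * sin x ^ (n - k)) m)); [exact IH|].
      auto_derive. exact I. }
    apply W. }
  unfold g, Q1, Q2.
  apply (ex_derive_minus (fun x => cos x * hpoly (deg S) (coef2 S) (cos x) (sin x))
                         (fun x => sin x * hpoly (deg S) (coef1 S) (cos x) (sin x))).
  - apply (ex_derive_mult cos (fun x => hpoly (deg S) (coef2 S) (cos x) (sin x))); [auto_derive; exact I|apply Hh].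
  - apply (ex_derive_mult sin (fun x => hpoly (deg S) (coef1 S) (cos x) (sin x))); [auto_derive; exact I|apply Hh].
Qed.

(** Near [S] the equilibria on the two radii persist and [g] keeps its sign at the middle
    of the arc, hence its direction. *)
Lemma connected_near_perturbed S a b th eps : (1 < deg S)%nat -> 0 < lam S ->
  connecting_arc S a b th -> f S a < 0 -> f S b < 0 -> 0 < eps ->
  exists d, 0 < d /\ forall S' a' b', close_system d S S' ->
    Rabs (a' - a) < d -> Rabs (b' - b) < d -> consecutive S' a' b' ->
    connected_near S' a' b' (radial_point S a) (radial_point S b) eps.
Proof.
  intros Hd Hl Harc Ha Hb Heps. destruct (proj1 Harc) as [Hab [_ [_ Hgn]]].
  set (m := (a + b) / 2).
  assert (Hm : between a b m) by (apply between_cases; unfold m; destruct (Rtotal_order a b) as [|[|]]; lra).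
  pose proof (arc_direction S a b th Harc m Hm) as Hdir.
  assert (Hgm : 0 < Rabs (g S m)) by (apply Rabs_pos_lt, Hgn, Hm).
  destruct (radial_point_near S a eps Hd Hl Ha Heps) as [ea [Hea Na]].
  destruct (radial_point_near S b eps Hd Hl Hb Heps) as [eb [Heb Nb]].
  destruct (f_lipschitz S) as [L [HL Hlip]].
  pose proof (coefficient_bound_pos S) as HC. set (C := coefficient_bound S) in *.
  set (w := Rabs (b - a)). assert (Hw : 0 < w) by (apply Rabs_pos_lt; lra).
  assert (He : exists e, 0 < e /\ e <= ea /\ e <= eb /\ e <= w / 4 /\ e <= Rabs (g S m)).
  { exists (Rmin (Rmin ea eb) (Rmin (w / 4) (Rabs (g S m)))).
    split; [repeat apply Rmin_pos; lra|].
    unfold Rmin. repeat destruct Rle_dec; lra. }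
  destruct He as [e [He0 He]].
  (* with this choice [lam], [f], [g] and the two angles all move by less than [e] *)
  set (d := e / (C + L + 1)).
  assert (Hd0 : 0 < d) by (apply Rdiv_lt_0_compat; lra).
  assert (Ed : d * (C + L + 1) = e) by (unfold d; field; lra).
  assert (HCd : C * d + L * d < e) by nra.
  assert (Hde : d <= e) by nra. assert (HCd' : C * d < e) by nra.
  exists d. split; [exact Hd0|].
  intros S' a' b' Hcl Ha' Hb' Hcons'. destruct Hcl as [Edeg [El Hco]].
  assert (Hcl : close_system d S S') by (split; [exact Edeg|now split]).
  assert (Hff : forall x x', Rabs (x' - x) < d -> Rabs (f S' x' - f S x) < e).
  { intros x x' Hx. destruct (fg_close S S' d x' Hcl) as [F1 _]. specialize (Hlip x' x). fold C in F1.
    replace (f S' x' - f S x) with ((f S' x' - f S x') + (f S x' - f S x)) by ring.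
    eapply Rle_lt_trans; [apply Rabs_triang|].
    assert (L * Rabs (x' - x) <= L * d) by (apply Rmult_le_compat_l; lra). lra. }
  pose proof (Hff a a' Ha') as Hfa. pose proof (Hff b b' Hb') as Hfb.
  destruct (Na S' a' Edeg) as [Hl' [Ha1 Ba]]; [lra|lra|lra|].
  destruct (Nb S' b' Edeg) as [_ [Hb1 Bb]]; [lra|lra|lra|].
  destruct (fg_close S S' d m Hcl) as [_ F2]. fold C in F2.
  assert (F3 : Rabs (g S' m - g S m) < Rabs (g S m)) by lra.
  apply Rabs_def2 in F3. apply Rabs_def2 in Ha'. apply Rabs_def2 in Hb'.
  apply (connected_near_intro S' a' b' m); auto.
  - now rewrite Edeg.
  - apply between_cases. unfold m, w, Rabs in *. destruct (Rcase_abs (b - a)); lra.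
  - assert (Hsg : 0 < g S m * g S' m) by (unfold Rabs in F3; destruct (Rcase_abs (g S m)); nra).
    assert (Hba : 0 < (b' - a') * (b - a)) by (unfold w, Rabs in *; destruct (Rcase_abs (b - a)); nra).
    assert (Hp1 : 0 < ((b - a) * g S m) * (g S m * g S' m)) by now apply Rmult_lt_0_compat.
    assert (Hp2 : 0 < (b - a) * g S' m) by nra.
    assert (Hp3 : 0 < ((b' - a') * (b - a)) * ((b - a) * g S' m)) by now apply Rmult_lt_0_compat.
    nra.
Qed.

Lemma consecutive_persists S a b e : consecutive S a b -> Derive (g S) a <> 0 -> Derive (g S) b <> 0 ->
  0 < e -> exists d, 0 < d /\ forall S', close_system d S S' ->
    exists a' b', Rabs (a' - a) < e /\ Rabs (b' - b) < e /\ consecutive S' a' b'.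
Proof.
  intros [Hab [Hga [Hgb Hgn]]] Da Db He.
  (* the affine parameter of the arc makes the two orientations alike *)
  set (x := fun t => a + t * (b - a)).
  assert (Hx : forall t, is_derive x t (b - a)) by (intros t; unfold x; auto_derive; [exact I|ring]).
  assert (Hgc : forall S0 t, continuous (fun t => g S0 (x t)) t).
  { intros S0 t. apply (continuous_comp x (g S0)); [|apply g_continuous].
    apply (ex_derive_continuous x). eexists. apply Hx. }
  assert (Hgd : forall t, is_derive (fun t => g S (x t)) t ((b - a) * Derive (g S) (x t))).
  { intros t. apply (is_derive_comp (g S) x); [|apply Hx]. apply Derive_correct, ex_derive_g. }
  assert (Ex0 : x 0 = a) by (unfold x; ring). assert (Ex1 : x 1 = b) by (unfold x; ring).
  set (w := Rabs (b - a)). assert (Hw : 0 < w) by (apply Rabs_pos_lt; lra).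
  set (et := Rmin (e / w) (1 / 4)).
  assert (Het : 0 < et) by (apply Rmin_pos; [now apply Rdiv_lt_0_compat|lra]).
  assert (Het1 : et * w <= e).
  { replace e with (e / w * w) by (field; lra). apply Rmult_le_compat_r; [lra|apply Rmin_l]. }
  assert (Het2 : et <= 1 / 4) by apply Rmin_r.
  destruct (perturbed_zeros (fun t => g S (x t)) et) as [k [Hk Hpert]].
  { apply Hgc. }
  { intros t Ht. apply Hgn. apply between_cases. unfold x.
    destruct (Rtotal_order a b) as [Hlt|[Hlt|Hlt]]; [left; nra|lra|right; nra]. }
  { apply (simple_zero_changes_sign _ 0 _ (Hgd 0)); rewrite Ex0; [|exact Hga].
    apply Rmult_integral_contrapositive. split; [lra|exact Da]. }
  { apply (simple_zero_changes_sign _ 1 _ (Hgd 1)); rewrite Ex1; [|exact Hgb].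
    apply Rmult_integral_contrapositive. split; [lra|exact Db]. }
  { exact Het. }
  pose proof (coefficient_bound_pos S) as HC. set (C := coefficient_bound S) in *.
  assert (Ed : k / (C + 1) * (C + 1) = k) by (field; lra).
  exists (k / (C + 1)). split; [apply Rdiv_lt_0_compat; lra|]. intros S' Hcl.
  destruct (Hpert (fun t => g S' (x t))) as [t0 [t1 [Ht0 [Ht1 [Z0 [Z1 Hnz]]]]]].
  { apply Hgc. }
  { intros t. destruct (fg_close S S' _ (x t) Hcl) as [_ F2]. fold C in F2.
    assert (0 < k / (C + 1)) by (apply Rdiv_lt_0_compat; lra). lra. }
  assert (Ht01 : t0 < t1) by (apply Rabs_def2 in Ht0; apply Rabs_def2 in Ht1; lra).
  exists (x t0), (x t1). split; [|split; [|split; [|split; [exact Z0|split; [exact Z1|]]]]].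
  - replace (x t0 - a) with (t0 * (b - a)) by (unfold x; ring). rewrite Rabs_mult. fold w. nra.
  - replace (x t1 - b) with ((t1 - 1) * (b - a)) by (unfold x; ring). rewrite Rabs_mult. fold w. nra.
  - unfold x. intros E. assert (H : (t1 - t0) * (b - a) = 0) by lra. apply Rmult_integral in H. lra.
  - intros y Hy. assert (Ey : y = x ((y - a) / (b - a))) by (unfold x; field; lra).
    rewrite Ey in Hy |- *. apply Hnz. set (t := (y - a) / (b - a)) in *.
    apply between_cases in Hy. unfold x in Hy.
    destruct (Rtotal_order a b) as [Hlt|[Hlt|Hlt]]; [nra|lra|nra].
Qed.

Lemma robust_intro S a b th : (1 < deg S)%nat -> 0 < lam S -> connecting_arc S a b th ->
  f S a < 0 -> f S b < 0 -> robust_connection S a b (radial_point S a) (radial_point S b).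
Proof.
  intros Hd Hl Harc Ha Hb eps Heps.
  destruct (connected_near_perturbed S a b th eps Hd Hl Harc Ha Hb Heps) as [d1 [Hd1 Main]].
  assert (Hmono : forall S' d d', d <= d' -> close_system d S S' -> close_system d' S S').
  { intros S' d d' Hdd [E1 [E2 E3]]. split; [exact E1|]. split; [lra|].
    intros j Hj. destruct (E3 j Hj). lra. }
  destruct (classic (Derive (g S) a <> 0 /\ Derive (g S) b <> 0)) as [[Da Db]|Hnd].
  - destruct (consecutive_persists S a b (Rmin d1 eps) (proj1 Harc) Da Db) as [d2 [Hd2 Hpers]].
    { now apply Rmin_pos. }
    pose proof (Rmin_l d1 eps). pose proof (Rmin_r d1 eps).
    pose proof (Rmin_l d1 d2) as R1. pose proof (Rmin_r d1 d2) as R2.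
    exists (Rmin d1 d2). split; [now apply Rmin_pos|]. intros S' Hcl.
    pose proof (Hmono S' _ d1 R1 Hcl) as Hcl1. split; [intros; apply Main; auto; lra|]. intros _ _.
    destruct (Hpers S' (Hmono S' _ d2 R2 Hcl)) as [a' [b' [Ha' [Hb' Hcons']]]].
    exists a', b'. split; [lra|]. split; [lra|]. split; [exact Hcons'|]. apply Main; auto; lra.
  - exists d1. split; [exact Hd1|]. intros S' Hcl. split; [intros; now apply Main|]. tauto.
Qed.

(** * Dynamics for a repelling origin *)

Section PositiveCases.
Variables (S : system) (a b : R) (th : R -> R).
Hypothesis Hdeg : (1 < deg S)%nat.
Hypothesis Hlam : 0 < lam S.
Hypothesis Harc : connecting_arc S a b th.

Let Hga : g S a = 0 := proj1 (proj2 (proj1 Harc)).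
Let Hgb : g S b = 0 := proj1 (proj2 (proj2 (proj1 Harc))).

Lemma all_omega_infinite : 0 <= f S b -> all_omega S (cone_interior a b) (infinity b).
Proof.
  intros Hf. pose proof (cone_target S a b th Hdeg Hlam Harc) as H. unfold target in H.
  destruct (Rlt_dec (f S b) 0); [lra|exact H].
Qed.

Lemma all_omega_finite : f S b < 0 -> all_omega S (cone_interior a b) (poincare (radial_point S b)).
Proof.
  intros Hf. pose proof (cone_target S a b th Hdeg Hlam Harc) as H. unfold target in H.
  destruct (Rlt_dec (f S b) 0); [exact H|contradiction].
Qed.

Lemma all_alpha_origin : height_unbounded (rate S) (lam S) (radial_rate S th) ->
  all_alpha S (cone_interior a b) (poincare origin).
Proof.
  intros Hu T t HT Ht HD. destruct (cone_follows S a b th Hdeg Hlam Harc T t HT Ht HD) as [c [Hc _]].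
  now apply (alpha_unbounded S a b th Hdeg Hlam Harc c).
Qed.

Lemma origin_ne_radial x : poincare origin <> poincare (radial_point S x).
Proof.
  intros E. apply poincare_inj in E. pose proof (f_equal sqnorm E) as H.
  unfold radial_point in H. rewrite sqnorm_polar in H.
  unfold sqnorm, origin in H; simpl fst in H; simpl snd in H.
  pose proof (root_pos S (- lam S / f S x)). nra.
Qed.

Section FiniteSource.
Variable c0 : R.
Hypothesis H0 : lowest_leaf_of S th c0.
Hypothesis Hfa : f S a < 0.

Lemma basins_finite c z : on_leaf S th c z ->
  (unstable_manifold S (radial_point S a) z <-> c = c0) /\
  (basin_of_repulsion S (poincare origin) z <-> c < c0) /\
  (basin_of_repulsion S (infinity a) z <-> c0 < c).
Proof.
  intros Hz. unfold unstable_manifold.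
  pose proof (origin_ne_radial a) as N1.
  pose proof (poincare_not_infinity origin a) as N2.
  pose proof (poincare_not_infinity (radial_point S a) a) as N3.
  pose proof (fun w w' => basin_of_repulsion_leaf S a b th Hdeg Hlam Harc c z w w' Hz) as HB.
  destruct (Rtotal_order c c0) as [Hc|[Hc|Hc]].
  - pose proof (fun w => HB w _ (fun T => alpha_below S a b th Hdeg Hlam Harc c0 c T H0 Hc)) as HB'.
    rewrite !HB'. repeat split; intros E; try lra; congruence.
  - subst c.
    pose proof (fun w => HB w _ (fun T => alpha_lowest_finite S a b th Hdeg Hlam Harc c0 T H0 Hfa)) as HB'.
    rewrite !HB'. repeat split; intros E; try lra; congruence.
  - pose proof (fun w => HB w _ (fun T => alpha_above S a b th Hdeg Hlam Harc c0 c T H0 Hc)) as HB'.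
    rewrite !HB'. repeat split; intros E; try lra; congruence.
Qed.

Lemma unstable_manifold_separates :
  separates (cone_interior a b) (unstable_manifold S (radial_point S a))
    (basin_of_repulsion S (poincare origin)) (basin_of_repulsion S (infinity a)).
Proof.
  apply (sides_separate S a b th Hdeg Harc c0 (fun s => lowest_pos S th c0 s H0)).
  intros c z Hz. now apply basins_finite.
Qed.

Lemma lowest_trajectory : exists T, follows S th c0 T.
Proof.
  destruct (leaf_trajectory S th Hdeg Hlam (proj1 (proj2 Harc)) c0 0 0
     (lowest_pos S th c0 0 H0)) as [T [HT _]]. now exists T.
Qed.

Lemma unstable_manifold_one_orbit :
  one_orbit S (cone_interior a b) (unstable_manifold S (radial_point S a)).
Proof.
  destruct lowest_trajectory as [T HT]. exists T. split; [apply HT|].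
  intros z. rewrite (follows_orbit S th c0 T z HT). split.
  - intros Hz. split; [now apply (on_leaf_cone S a b th Hdeg Harc c0)|]. now apply (basins_finite c0 z Hz).
  - intros [HD HU]. destruct (cone_on_leaf S a b th Hdeg Harc z HD) as [c Hz].
    apply (basins_finite c z Hz) in HU. now subst c.
Qed.

Lemma orbit_separates_finite T : follows S th c0 T ->
  separates (cone_interior a b) (orbit T)
    (basin_of_repulsion S (poincare origin)) (basin_of_repulsion S (infinity a)).
Proof.
  intros HT. apply (sides_separate S a b th Hdeg Harc c0 (fun s => lowest_pos S th c0 s H0)).
  intros c z Hz. split; [|now apply basins_finite].
  rewrite (follows_orbit S th c0 T z HT). split.
  - intros Hz'. now apply (on_leaf_unique S a b th Hdeg Harc c c0 z).
  - now intros <-.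
Qed.
End FiniteSource.

Lemma separatrix_separates c0 T : lowest_leaf_of S th c0 -> 0 <= f S a ->
  sector_separatrix S (cone_interior a b) (infinity a) T ->
  separates (cone_interior a b) (orbit T) (basin_of_repulsion S (poincare origin))
    (fun z => basin_of_repulsion S (infinity a) z /\ ~ orbit T z).
Proof.
  intros H0 Hfa HS. pose proof (separatrix_lowest S a b th Hdeg Hlam Harc c0 T H0 Hfa HS) as HT.
  apply (sides_separate S a b th Hdeg Harc c0 (fun s => lowest_pos S th c0 s H0)).
  intros c z Hz.
  assert (HO : orbit T z <-> c = c0).
  { rewrite (follows_orbit S th c0 T z HT). split.
    - intros Hz'. now apply (on_leaf_unique S a b th Hdeg Harc c c0 z).
    - now intros <-. }
  rewrite HO.
  pose proof (poincare_not_infinity origin a) as N.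
  pose proof (fun w w' => basin_of_repulsion_leaf S a b th Hdeg Hlam Harc c z w w' Hz) as HB.
  destruct (Rtotal_order c c0) as [Hc|[Hc|Hc]].
  - pose proof (fun w => HB w _ (fun T => alpha_below S a b th Hdeg Hlam Harc c0 c T H0 Hc)) as HB'.
    assert (C1 : c <> c0) by (intros E; lra). assert (C2 : ~ c0 < c) by lra.
    assert (N' : infinity a <> poincare origin) by congruence.
    rewrite !HB'. tauto.
  - subst c.
    pose proof (fun w => HB w _ (fun T => alpha_lowest_infinite S a b th Hdeg Hlam Harc c0 T H0 Hfa)) as HB'.
    assert (C1 : ~ c0 < c0) by lra. rewrite !HB'. tauto.
  - pose proof (fun w => HB w _ (fun T => alpha_above S a b th Hdeg Hlam Harc c0 c T H0 Hc)) as HB'.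
    assert (C1 : c <> c0) by (intros E; lra). assert (C2 : ~ c < c0) by lra.
    rewrite !HB'. tauto.
Qed.

Lemma above_connects c0 : lowest_leaf_of S th c0 -> 0 <= f S b -> parabolic_sector_connecting S a b.
Proof.
  intros H0 Hfb. exists (inter (cone_interior a b) (above S th c0)).
  split; [apply (above_region S a b th Hdeg Harc c0 (fun s => lowest_pos S th c0 s H0))|].
  assert (HF : forall T t, trajectory S T -> time T t ->
     inter (cone_interior a b) (above S th c0) (pos T t) -> exists c, c0 < c /\ follows S th c T).
  { intros T t HT Ht [_ [c [Hc Hon]]]. exists c. split; [exact Hc|].
    apply (on_leaf_follows S a b th Hdeg Hlam Harc T c (pos T t)); auto. now exists t. }
  assert (HA : all_alpha S (inter (cone_interior a b) (above S th c0)) (infinity a)).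
  { intros T t HT Ht HE. destruct (HF T t HT Ht HE) as [c [Hc Hfo]].
    now apply (alpha_above S a b th Hdeg Hlam Harc c0 c). }
  assert (HO : all_omega S (inter (cone_interior a b) (above S th c0)) (infinity b)).
  { intros T t HT Ht [HD _]. now apply (all_omega_infinite Hfb T t). }
  split; [intros z [Hz _]; exact Hz|]. split; [|split; [|split; [|split; [exact HA|exact HO]]]].
  - intros x Hx. destruct (arc_surjective S a b th Harc x Hx) as [t <-].
    apply (above_closure_infinity S a b th Hdeg Harc). right; right. now exists t.
  - now apply above_parabolic.
  - split; [apply (above_closure_infinity S a b th Hdeg Harc); tauto|].
    exists (fun _ => True). split; [apply filter_true|]. left. intros T t HT Ht HE _. now apply (HO T t).
Qed.

(** The sign of [f a] and the existence of a lowest leaf give the type of the angle at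
    [infinity a], the sign of [f b] that of the angle at [infinity b]. *)
Lemma positive_cases :
  let D := cone_interior a b in
  let am := infinity a in
  let ap := infinity b in
  let o := poincare origin in
  let at_minus := angle S a b in
  let at_plus := angle S b a in
     ((at_minus Pminus /\ at_plus Pplus) \/
      (at_minus Hplus /\ at_plus Hminus) \/
      (at_minus Hplus /\ at_plus Pplus) \/
      (at_minus Pminus /\ at_plus Hminus) \/
      (at_minus H0plus /\ at_plus Hminus) \/
      (at_minus H0plus /\ at_plus Pplus)) /\
     (at_minus Pminus -> at_plus Pplus ->
        exists pm : R * R,
          unique (radial_equilibrium S a) pm /\
          no_radial_equilibrium S b /\
          all_omega S D ap /\
          one_orbit S D (unstable_manifold S pm) /\
          separates D (unstable_manifold S pm)
            (basin_of_repulsion S o) (basin_of_repulsion S am)) /\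
     (at_minus Hplus -> at_plus Hminus ->
        exists pp : R * R,
          unique (radial_equilibrium S b) pp /\
          no_radial_equilibrium S a /\
          all_go S D o (poincare pp)) /\
     (at_minus Hplus -> at_plus Pplus ->
        no_radial_equilibrium S a /\
        no_radial_equilibrium S b /\
        all_go S D o ap) /\
     (at_minus Pminus -> at_plus Hminus ->
        exists pm pp : R * R,
          unique (radial_equilibrium S a) pm /\
          unique (radial_equilibrium S b) pp /\
          robust_connection S a b pm pp /\
          all_omega S D (poincare pp) /\
          exists T : curve,
            connection S D pm pp T /\
            separates D (orbit T)
              (basin_of_repulsion S o) (basin_of_repulsion S am)) /\
     (at_minus H0plus -> at_plus Hminus ->
        exists pp : R * R,
          unique (radial_equilibrium S b) pp /\
          all_omega S D (poincare pp) /\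
          forall T : curve, sector_separatrix S D am T ->
            separates D (orbit T)
              (basin_of_repulsion S o)
              (fun z => basin_of_repulsion S am z /\ ~ orbit T z)) /\
     (at_minus H0plus -> at_plus Pplus ->
        no_radial_equilibrium S a /\
        no_radial_equilibrium S b /\
        all_omega S D ap /\
        (forall T : curve, sector_separatrix S D am T ->
           separates D (orbit T)
             (basin_of_repulsion S o)
             (fun z => basin_of_repulsion S am z /\ ~ orbit T z)) /\
        parabolic_sector_connecting S a b).
Proof.
  intros D am ap o at_minus at_plus.
  pose proof (minus_parabolic_elim S a b Hdeg Hlam) as EPm.
  pose proof (plus_parabolic_elim S a b Hdeg Hlam) as EPp.
  pose proof (plus_hyperbolic_elim S a b Hdeg Hlam) as EHm.
  pose proof (minus_hyperbolic_elim S a b th Hdeg Hlam Harc) as EHp.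
  pose proof (minus_two_sectors_elim S a b th Hdeg Hlam Harc) as EH0.
  split; [|split; [|split; [|split; [|split; [|split]]]]].
  - assert (Hat_minus : at_minus Pminus \/ at_minus Hplus \/ at_minus H0plus).
    { destruct (Rlt_dec (f S a) 0) as [Ha|Ha].
      - left. now apply (angle_minus_parabolic S a b th).
      - right. destruct (level_dichotomy S a b th Hdeg Hlam Harc) as [Hu|[c0 H0]].
        + left. apply (angle_minus_hyperbolic S a b th); auto. lra.
        + right. apply (angle_minus_two_sectors S a b th Hdeg Hlam Harc c0); auto. lra. }
    assert (Hat_plus : at_plus Pplus \/ at_plus Hminus).
    { destruct (Rlt_dec (f S b) 0) as [Hb|Hb].
      - right. now apply (angle_plus_hyperbolic S a b th).
      - left. apply (angle_plus_parabolic S a b th); auto. lra. }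
    tauto.
  - intros Am Ap. apply EPm in Am. apply EPp in Ap.
    destruct (lowest_exists S a b th Hdeg Hlam Harc Am) as [c0 H0].
    exists (radial_point S a). split; [now apply radial_equilibrium_exists|].
    split; [now apply radial_equilibrium_none|]. split; [now apply all_omega_infinite|].
    split; [now apply (unstable_manifold_one_orbit c0)|now apply (unstable_manifold_separates c0)].
  - intros Am Ap. destruct (EHp Am) as [Hf Hu]. apply EHm in Ap.
    exists (radial_point S b). split; [now apply radial_equilibrium_exists|].
    split; [now apply radial_equilibrium_none|].
    split; [now apply all_alpha_origin|now apply all_omega_finite].
  - intros Am Ap. destruct (EHp Am) as [Hf Hu]. apply EPp in Ap.
    split; [now apply radial_equilibrium_none|]. split; [now apply radial_equilibrium_none|].
    split; [now apply all_alpha_origin|now apply all_omega_infinite].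
  - intros Am Ap. apply EPm in Am. apply EHm in Ap.
    destruct (lowest_exists S a b th Hdeg Hlam Harc Am) as [c0 H0].
    exists (radial_point S a), (radial_point S b).
    split; [now apply radial_equilibrium_exists|]. split; [now apply radial_equilibrium_exists|].
    split; [now apply (robust_intro S a b th)|]. split; [now apply all_omega_finite|].
    destruct (lowest_trajectory c0 H0) as [T HT]. exists T.
    split; [now apply (equilibria_connection S a b th Hdeg Hlam Harc Am Ap c0)|].
    now apply (orbit_separates_finite c0).
  - intros Am Ap. destruct (EH0 Am) as [Hf [c0 H0]]. apply EHm in Ap.
    exists (radial_point S b). split; [now apply radial_equilibrium_exists|].
    split; [now apply all_omega_finite|]. intros T HT. now apply (separatrix_separates c0).
  - intros Am Ap. destruct (EH0 Am) as [Hf [c0 H0]]. apply EPp in Ap.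
    split; [now apply radial_equilibrium_none|]. split; [now apply radial_equilibrium_none|].
    split; [now apply all_omega_infinite|]. split; [|now apply (above_connects c0)].
    intros T HT. now apply (separatrix_separates c0).
Qed.
End PositiveCases.

(** * The reversed system *)

Lemma time_rev_opp T t : time T t -> time (reversed_curve T) (- t).
Proof. intros H. apply time_rev. now rewrite Ropp_involutive. Qed.

Lemma pos_rev_opp T t : pos (reversed_curve T) (- t) = pos T t.
Proof. simpl. now rewrite Ropp_involutive. Qed.

Lemma orbit_rev T : orbit (reversed_curve T) = orbit T.
Proof.
  assert (W : forall T z, orbit T z -> orbit (reversed_curve T) z).
  { intros T' z [t [Ht <-]]. exists (- t). split; [now apply time_rev_opp|apply pos_rev_opp]. }
  apply functional_extensionality; intros z. apply propositional_extensionality. split; [|apply W].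
  intros H. apply W in H. now rewrite rev_rev in H.
Qed.

Lemma trajectory_neg S T : trajectory (reversed S) T -> trajectory S (reversed_curve T).
Proof. intros H. apply trajectory_rev in H. now rewrite neg_neg in H. Qed.

Lemma basin_neg S w : basin_of_repulsion (reversed S) w = basin_of_attraction S w.
Proof.
  apply functional_extensionality; intros z. apply propositional_extensionality. split.
  - intros [T [HT [HO HA]]]. exists (reversed_curve T). split; [now apply trajectory_neg|].
    split; [now rewrite orbit_rev|now apply omega_is_rev].
  - intros [T [HT [HO HA]]]. exists (reversed_curve T). split; [now apply trajectory_rev|].
    split; [now rewrite orbit_rev|now apply alpha_is_rev].
Qed.

Lemma unstable_manifold_neg S p : unstable_manifold (reversed S) p = stable_manifold S p.
Proof. apply basin_neg. Qed.

Lemma all_omega_neg S D w : all_omega (reversed S) D w = all_alpha S D w.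
Proof.
  apply propositional_extensionality. split; intros H T t HT Ht HD.
  - apply omega_is_rev. apply (H (reversed_curve T) (- t)).
    + now apply trajectory_rev.
    + now apply time_rev_opp.
    + now rewrite pos_rev_opp.
  - apply alpha_is_rev. apply (H (reversed_curve T) (- t)).
    + now apply trajectory_neg.
    + now apply time_rev_opp.
    + now rewrite pos_rev_opp.
Qed.

Lemma all_alpha_neg S D w : all_alpha (reversed S) D w = all_omega S D w.
Proof. rewrite <- all_omega_neg. now rewrite neg_neg. Qed.

Lemma all_go_neg S D w w' : all_go (reversed S) D w w' = all_go S D w' w.
Proof.
  unfold all_go. rewrite all_alpha_neg, all_omega_neg. apply propositional_extensionality. tauto.
Qed.

Lemma radial_equilibrium_neg S x : radial_equilibrium (reversed S) x = radial_equilibrium S x.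
Proof.
  assert (W : forall S p, radial_equilibrium S x p -> radial_equilibrium (reversed S) x p).
  { intros S' p [r [Hr [Ep Hv]]]. exists r. split; [exact Hr|]. split; [exact Ep|].
    rewrite vfield_neg, Hv. unfold origin; simpl. f_equal; ring. }
  apply functional_extensionality; intros p. apply propositional_extensionality. split; [|apply W].
  intros H. apply W in H. now rewrite neg_neg in H.
Qed.

Lemma no_radial_equilibrium_neg S x : no_radial_equilibrium (reversed S) x = no_radial_equilibrium S x.
Proof. unfold no_radial_equilibrium. now rewrite radial_equilibrium_neg. Qed.

Lemma one_orbit_neg S D M : one_orbit (reversed S) D M = one_orbit S D M.
Proof.
  apply propositional_extensionality. split; intros [T [HT H]]; exists (reversed_curve T); rewrite orbit_rev.
  - split; [now apply trajectory_neg|exact H].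
  - split; [now apply trajectory_rev|exact H].
Qed.

Lemma connection_neg S D p q T : connection (reversed S) D p q T -> connection S D q p (reversed_curve T).
Proof.
  intros [HT [HD [HA HO]]]. split; [now apply trajectory_neg|]. rewrite orbit_rev.
  split; [exact HD|]. split; [now apply alpha_is_rev|now apply omega_is_rev].
Qed.

Lemma parabolic_sector_neg S D a : parabolic_sector (reversed S) D a = parabolic_sector S D a.
Proof.
  assert (W : forall S, parabolic_sector (reversed S) D a -> parabolic_sector S D a).
  { intros S' [Hcl [U [HU H]]]. split; [exact Hcl|]. exists U. split; [exact HU|].
    assert (HT : forall T t, trajectory S' T -> time T t ->
       trajectory (reversed S') (reversed_curve T) /\ time (reversed_curve T) (- t) /\ pos (reversed_curve T) (- t) = pos T t).
    { intros T t HT Ht. split; [now apply trajectory_rev|]. split; [now apply time_rev_opp|apply pos_rev_opp]. }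
    destruct H as [H|H]; [right|left]; intros T t HT1 Ht HD HU1;
      destruct (HT T t HT1 Ht) as [A1 [A2 A3]]; specialize (H (reversed_curve T) (- t) A1 A2);
      rewrite A3 in H; specialize (H HD HU1).
    - now apply omega_is_rev.
    - now apply alpha_is_rev. }
  apply propositional_extensionality. split; [apply W|].
  intros H. apply W. now rewrite neg_neg.
Qed.

Lemma disk_trajectory_neg S G : disk_trajectory S G -> disk_trajectory (reversed S) (reversed_curve G).
Proof.
  intros [T HT|th Hth].
  - apply (finite_trajectory (reversed S) (reversed_curve T)). now apply trajectory_rev.
  - apply (infinite_trajectory (reversed S) (fun t => th (- t))). intros t. rewrite g_neg.
    apply (is_derive_rev th), Hth.
Qed.

Lemma boundary_trajectory_neg S D a G :
  boundary_trajectory S D a G -> boundary_trajectory (reversed S) D a (reversed_curve G).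
Proof.
  intros [HG H]. split; [now apply disk_trajectory_neg|].
  intros t Ht. apply time_rev in Ht. apply (H _ Ht).
Qed.

Lemma hyperbolic_sector_neg S D a : hyperbolic_sector (reversed S) D a = hyperbolic_sector S D a.
Proof.
  assert (W : forall S, hyperbolic_sector S D a -> hyperbolic_sector (reversed S) D a).
  { intros S' [Hcl [[U [HU H]] [[G1 [B1 L1]] [G2 [B2 L2]]]]].
    split; [exact Hcl|]. split; [|split].
    - exists U. split; [exact HU|]. intros T t HT Ht HD HU1.
      destruct (H (reversed_curve T) (- t)) as [[s1 [Hs1 [Hlt1 Hn1]]] [s2 [Hs2 [Hlt2 Hn2]]]].
      + now apply trajectory_neg.
      + now apply time_rev_opp.
      + now rewrite pos_rev_opp.
      + now rewrite pos_rev_opp.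
      + apply time_rev in Hs1. apply time_rev in Hs2. split.
        * exists (- s2). split; [exact Hs2|]. split; [lra|exact Hn2].
        * exists (- s1). split; [exact Hs1|]. split; [lra|exact Hn1].
    - exists (reversed_curve G2). split; [now apply boundary_trajectory_neg|].
      intros w. rewrite omega_limit_set_rev. apply L2.
    - exists (reversed_curve G1). split; [now apply boundary_trajectory_neg|].
      intros w. rewrite alpha_limit_set_rev. apply L1. }
  apply propositional_extensionality. split; [|apply W].
  intros H. apply W in H. now rewrite neg_neg in H.
Qed.

Lemma sector_separatrix_neg S D a T :
  sector_separatrix S D a T -> sector_separatrix (reversed S) D a (reversed_curve T).
Proof.
  intros [HT [HD [Hlim [A [B [H1 [H2 H3]]]]]]]. split; [now apply trajectory_rev|].
  rewrite orbit_rev. split; [exact HD|]. split.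
  - destruct Hlim; [right; now apply alpha_is_rev|left; now apply omega_is_rev].
  - exists A, B. rewrite parabolic_sector_neg, hyperbolic_sector_neg. tauto.
Qed.

Lemma one_sector_neg S D a : one_sector (reversed S) D a = one_sector S D a.
Proof. unfold one_sector. now rewrite parabolic_sector_neg, hyperbolic_sector_neg. Qed.

Lemma two_sectors_neg S D a : two_sectors (reversed S) D a = two_sectors S D a.
Proof.
  assert (W : forall S, two_sectors S D a -> two_sectors (reversed S) D a).
  { intros S' [T HT]. exists (reversed_curve T). now apply sector_separatrix_neg. }
  apply propositional_extensionality. split; [|apply W].
  intros H. apply W in H. now rewrite neg_neg in H.
Qed.

Lemma line_attracting_neg S x y : line_attracting (reversed S) x y = line_repelling S x y.
Proof.
  unfold line_attracting, line_repelling, repelling. f_equal.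
  apply functional_extensionality; intros; apply g_neg.
Qed.

Lemma line_repelling_neg S x y : line_repelling (reversed S) x y = line_attracting S x y.
Proof. now rewrite <- line_attracting_neg, neg_neg. Qed.

Lemma radially_attracting_neg S x : radially_attracting (reversed S) x = radially_repelling S x.
Proof.
  unfold radially_attracting, radially_repelling, repelling. f_equal.
  apply functional_extensionality; intros rho. unfold radial_field. rewrite f_neg. simpl. ring.
Qed.

Lemma radially_repelling_neg S x : radially_repelling (reversed S) x = radially_attracting S x.
Proof. now rewrite <- radially_attracting_neg, neg_neg. Qed.

Definition reversed_type (ty : angle_type) : angle_type :=
  match ty with
  | Pminus => Pplus | Pplus => Pminus | Defs.Hminus => Hplus
  | Hplus => Defs.Hminus | H0minus => H0plus | H0plus => H0minus
  end.

Lemma angle_neg S x y ty : angle (reversed S) x y ty = angle S x y (reversed_type ty).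
Proof.
  destruct ty; cbn [angle reversed_type];
    rewrite ?line_attracting_neg, ?line_repelling_neg, ?radially_attracting_neg,
      ?radially_repelling_neg, ?one_sector_neg, ?two_sectors_neg; reflexivity.
Qed.

Lemma close_system_neg d S S' : close_system d S S' -> close_system d (reversed S) (reversed S').
Proof.
  intros [E1 [E2 E3]]. split; [exact E1|]. simpl.
  assert (W : forall x y, Rabs (- x - - y) = Rabs (x - y)).
  { intros x y. replace (- x - - y) with (- (x - y)) by ring. apply Rabs_Ropp. }
  rewrite W. split; [exact E2|]. intros k Hk. rewrite !W. now apply E3.
Qed.

Lemma consecutive_neg S a b : consecutive S a b -> consecutive (reversed S) b a.
Proof.
  intros [H1 [H2 [H3 H4]]]. split; [auto|]. rewrite !g_neg, H2, H3, Ropp_0.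
  split; [reflexivity|]. split; [reflexivity|].
  intros x Hx. rewrite g_neg. apply Ropp_neq_0_compat, H4. now apply between_sym.
Qed.

Lemma connected_near_neg S a b p q eps :
  connected_near (reversed S) b a q p eps -> connected_near S a b p q eps.
Proof.
  intros [q' [p' [Hq [Hp [Bq [Bp [T HT]]]]]]]. rewrite radial_equilibrium_neg in Hp, Hq.
  exists p', q'. repeat (split; [assumption|]). exists (reversed_curve T).
  rewrite cone_interior_sym. now apply connection_neg.
Qed.

Lemma robust_connection_neg S a b p q :
  robust_connection (reversed S) b a q p -> robust_connection S a b p q.
Proof.
  intros H eps Heps. destruct (H eps Heps) as [d [Hd H1]]. exists d. split; [exact Hd|].
  intros S' Hcl. destruct (H1 (reversed S') (close_system_neg _ _ _ Hcl)) as [HA HB]. split.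
  - intros a' b' Ha Hb Hc. apply connected_near_neg. apply HA; auto. now apply consecutive_neg.
  - intros Da Db.
    assert (HD : forall x, Derive (g S) x <> 0 -> Derive (g (reversed S)) x <> 0).
    { intros x Hx. rewrite (Derive_ext _ (fun x => - g S x)) by (intros; apply g_neg).
      rewrite Derive_opp. now apply Ropp_neq_0_compat. }
    destruct (HB (HD b Db) (HD a Da)) as [b' [a' [Hb [Ha [Hc Hn]]]]].
    exists a', b'. split; [exact Ha|]. split; [exact Hb|]. split.
    + apply consecutive_neg in Hc. now rewrite neg_neg in Hc.
    + now apply connected_near_neg.
Qed.

Lemma parabolic_sector_connecting_neg S a b :
  parabolic_sector_connecting (reversed S) b a -> parabolic_sector_connecting S a b.
Proof.
  intros [E [HR [HE [Hcl [P1 [P2 HG]]]]]]. exists E.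
  rewrite parabolic_sector_neg in P1, P2. rewrite all_go_neg in HG.
  split; [exact HR|]. split; [now rewrite cone_interior_sym|]. split; [|tauto].
  intros x Hx. apply Hcl. now apply between_sym.
Qed.

Lemma connecting_arc_neg S a b th :
  connecting_arc S a b th -> connecting_arc (reversed S) b a (fun t => th (- t)).
Proof.
  intros [H1 [H2 [H3 [H4 H5]]]]. split; [now apply consecutive_neg|]. split; [|split; [|split]].
  - intros t. rewrite g_neg. apply (is_derive_rev th), H2.
  - intros t. now apply between_sym.
  - apply is_lim_spec. intros eps. apply is_lim_spec in H5. destruct (H5 eps) as [M HM].
    exists (- M). intros t Ht. apply HM. lra.
  - apply is_lim_spec. intros eps. apply is_lim_spec in H4. destruct (H4 eps) as [M HM].
    exists (- M). intros t Ht. apply HM. lra.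
Qed.

Theorem theorem5p6 (S : system) (thm thp : R) (conn : R -> R)
  (hlam : lam S <> 0)
  (hdeg : (1 < deg S)%nat)
  (hQ1 : hpoly_nonzero (deg S) (coef1 S))
  (hQ2 : hpoly_nonzero (deg S) (coef2 S))
  (hfin : finitely_many_infinite_equilibria S)
  (hex : exists w : R * R, infinite_equilibrium S w)
  (* [thm] and [thp] are the directions of [a_-] and [a_+] *)
  (hcons : consecutive S thm thp)
  (hconn : trajectory_at_infinity S conn)
  (hconn_arc : forall t : R, between thm thp (conn t))
  (hconn_minus : is_lim conn m_infty thm)
  (hconn_plus : is_lim conn p_infty thp) :
  let D := cone_interior thm thp in
  let am := infinity thm in
  let ap := infinity thp in
  let o := poincare origin in
  let at_minus := angle S thm thp in
  let at_plus := angle S thp thm in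
  (0 < lam S ->
     ((at_minus Pminus /\ at_plus Pplus) \/
      (at_minus Hplus /\ at_plus Hminus) \/
      (at_minus Hplus /\ at_plus Pplus) \/
      (at_minus Pminus /\ at_plus Hminus) \/
      (at_minus H0plus /\ at_plus Hminus) \/
      (at_minus H0plus /\ at_plus Pplus)) /\
     (at_minus Pminus -> at_plus Pplus ->
        exists pm : R * R,
          unique (radial_equilibrium S thm) pm /\
          no_radial_equilibrium S thp /\
          all_omega S D ap /\
          one_orbit S D (unstable_manifold S pm) /\
          separates D (unstable_manifold S pm)
            (basin_of_repulsion S o) (basin_of_repulsion S am)) /\
     (at_minus Hplus -> at_plus Hminus ->
        exists pp : R * R,
          unique (radial_equilibrium S thp) pp /\
          no_radial_equilibrium S thm /\
          all_go S D o (poincare pp)) /\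
     (at_minus Hplus -> at_plus Pplus ->
        no_radial_equilibrium S thm /\
        no_radial_equilibrium S thp /\
        all_go S D o ap) /\
     (at_minus Pminus -> at_plus Hminus ->
        exists pm pp : R * R,
          unique (radial_equilibrium S thm) pm /\
          unique (radial_equilibrium S thp) pp /\
          robust_connection S thm thp pm pp /\
          all_omega S D (poincare pp) /\
          exists T : curve,
            connection S D pm pp T /\
            separates D (orbit T)
              (basin_of_repulsion S o) (basin_of_repulsion S am)) /\
     (at_minus H0plus -> at_plus Hminus ->
        exists pp : R * R,
          unique (radial_equilibrium S thp) pp /\
          all_omega S D (poincare pp) /\
          forall T : curve, sector_separatrix S D am T ->
            separates D (orbit T)
              (basin_of_repulsion S o)
              (fun z => basin_of_repulsion S am z /\ ~ orbit T z)) /\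
     (at_minus H0plus -> at_plus Pplus ->
        no_radial_equilibrium S thm /\
        no_radial_equilibrium S thp /\
        all_omega S D ap /\
        (forall T : curve, sector_separatrix S D am T ->
           separates D (orbit T)
             (basin_of_repulsion S o)
             (fun z => basin_of_repulsion S am z /\ ~ orbit T z)) /\
        parabolic_sector_connecting S thm thp)) /\
  (lam S < 0 ->
     ((at_minus Pminus /\ at_plus Pplus) \/
      (at_minus Hplus /\ at_plus Hminus) \/
      (at_minus Hplus /\ at_plus Pplus) \/
      (at_minus Pminus /\ at_plus Hminus) \/
      (at_minus Hplus /\ at_plus H0minus) \/
      (at_minus Pminus /\ at_plus H0minus)) /\
     (at_minus Pminus -> at_plus Pplus ->
        exists pp : R * R,
          unique (radial_equilibrium S thp) pp /\
          no_radial_equilibrium S thm /\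
          all_alpha S D am /\
          one_orbit S D (stable_manifold S pp) /\
          separates D (stable_manifold S pp)
            (basin_of_attraction S o) (basin_of_attraction S ap)) /\
     (at_minus Hplus -> at_plus Hminus ->
        exists pm : R * R,
          unique (radial_equilibrium S thm) pm /\
          no_radial_equilibrium S thp /\
          all_go S D (poincare pm) o) /\
     (at_minus Hplus -> at_plus Pplus ->
        exists pm pp : R * R,
          unique (radial_equilibrium S thm) pm /\
          unique (radial_equilibrium S thp) pp /\
          robust_connection S thm thp pm pp /\
          all_alpha S D (poincare pm) /\
          exists T : curve,
            connection S D pm pp T /\
            separates D (orbit T)
              (basin_of_attraction S o) (basin_of_attraction S ap)) /\
     (at_minus Pminus -> at_plus Hminus ->
        no_radial_equilibrium S thm /\
        no_radial_equilibrium S thp /\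
        all_go S D am o) /\
     (at_minus Hplus -> at_plus H0minus ->
        exists pm : R * R,
          unique (radial_equilibrium S thm) pm /\
          all_alpha S D (poincare pm) /\
          forall T : curve, sector_separatrix S D ap T ->
            separates D (orbit T)
              (basin_of_attraction S o)
              (fun z => basin_of_attraction S ap z /\ ~ orbit T z)) /\
     (at_minus Pminus -> at_plus H0minus ->
        no_radial_equilibrium S thm /\
        no_radial_equilibrium S thp /\
        all_alpha S D am /\
        (forall T : curve, sector_separatrix S D ap T ->
           separates D (orbit T)
             (basin_of_attraction S o)
             (fun z => basin_of_attraction S ap z /\ ~ orbit T z)) /\
        parabolic_sector_connecting S thm thp)).
Proof.
  intros D am ap o at_minus at_plus.
  assert (Harc : connecting_arc S thm thp conn)
    by exact (conj hcons (conj hconn (conj hconn_arc (conj hconn_minus hconn_plus)))).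
  split.
  - intros Hl. exact (positive_cases S thm thp conn hdeg Hl Harc).
  - intros Hl.
    assert (Hl' : 0 < lam (reversed S)) by (simpl; lra).
    pose proof (positive_cases (reversed S) thp thm _ hdeg Hl' (connecting_arc_neg _ _ _ _ Harc)) as H.
    cbv zeta in H.
    rewrite !angle_neg, !no_radial_equilibrium_neg, !all_omega_neg, !all_go_neg,
      !(cone_interior_sym thp thm) in H.
    cbn [reversed_type] in H.
    fold D am ap o at_minus at_plus in H.
    destruct H as [Hty [Ha [Hb [Hd [Hc [H0a H0b]]]]]].
    split; [tauto|]. split; [|split; [|split; [|split; [|split]]]].
    + intros Am Ap. destruct (Ha Ap Am) as [pp [E1 [E2 [E3 [E4 E5]]]]]. exists pp.
      rewrite radial_equilibrium_neg in E1. rewrite unstable_manifold_neg in E4, E5.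
      rewrite one_orbit_neg in E4. rewrite !basin_neg in E5. tauto.
    + intros Am Ap. destruct (Hb Ap Am) as [pm [E1 [E2 E3]]]. exists pm.
      rewrite radial_equilibrium_neg in E1. rewrite all_go_neg in E3. tauto.
    + intros Am Ap. destruct (Hc Ap Am) as [pp [pm [E1 [E2 [E3 [E4 [T [E5 E6]]]]]]]].
      rewrite radial_equilibrium_neg in E1, E2. rewrite all_omega_neg in E4. rewrite !basin_neg in E6.
      exists pm, pp. split; [exact E2|]. split; [exact E1|].
      split; [now apply robust_connection_neg|]. split; [exact E4|].
      exists (reversed_curve T). rewrite orbit_rev. split; [now apply connection_neg|exact E6].
    + intros Am Ap. destruct (Hd Ap Am) as [E1 [E2 E3]]. tauto.
    + intros Am Ap. destruct (H0a Ap Am) as [pm [E1 [E2 E3]]].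
      rewrite radial_equilibrium_neg in E1. rewrite all_omega_neg in E2.
      exists pm. split; [exact E1|]. split; [exact E2|]. intros T HT.
      specialize (E3 (reversed_curve T) (sector_separatrix_neg _ _ _ _ HT)).
      now rewrite orbit_rev, !basin_neg in E3.
    + intros Am Ap. destruct (H0b Ap Am) as [E1 [E2 [E3 [E4 E5]]]].
      split; [exact E2|]. split; [exact E1|]. split; [exact E3|]. split.
      * intros T HT. specialize (E4 (reversed_curve T) (sector_separatrix_neg _ _ _ _ HT)).
        now rewrite orbit_rev, !basin_neg in E4.
      * now apply parabolic_sector_connecting_neg.
Qed.
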